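(* Let $f(z)=\sum_{n=0}^{\infty}a_nz^n$ be analytic in $\mathbb{D}$ with $|f(z)|\le 1$ for all $z\in\mathbb{D}$. Then, for every $z\in\mathbb{D}$ with $|z|=r\le \frac{\sqrt{17}-3}{4}$, $$\mathcal{J}_f(r):=|f(z)|+|f'(z)|\,r+B_2(f,r)+A(f_0,r)+\frac{221-43\sqrt{17}}{64}\left(\frac{S_r}{\pi-S_r}\right)+\mu\left(\frac{S_r}{\pi-S_r}\right)^2\le 1,$$ where $$\mu=\frac{E_1(a_{**})}{128(1+a_{**})^3E_2(a_{**})}=16.0824\ldots,$$ with $$\begin{aligned}E_1(a)=\;&(321568-77024\sqrt{17})+8(-1166421+282995\sqrt{17})a\\&+(2287452-554244\sqrt{17})a^2+16(-974531+236341\sqrt{17})a^3\\&-40(-181177+43951\sqrt{17})a^4+(88788654-21534594\sqrt{17})a^5\\&+7(-2416805+586147\sqrt{17})a^6+32(-3664887+888865\sqrt{17})a^7\\&+36(-1952633+473583\sqrt{17})a^8,\end{aligned}$$ $$E_2(a)=8(-251+61\sqrt{17})+(-33442+8110\sqrt{17})a-3(-36847+8937\sqrt{17})a^2+7(-11351+2753\sqrt{17})a^3,$$ and $a_{**}\approx 0.565671$ is the unique root in $(0,1)$ of the equation $\Psi_2^*(t)=0$, where $$\begin{aligned}\Psi_2^*(t)=\;&128(-12782703+3100265\sqrt{17})+64(-207084487+50225361\sqrt{17})t\\&-32(-1297411581+314668555\sqrt{17})t^2+(32440299472-7867928752\sqrt{17})t^3\\&+16(-10605671261+2572253099\sqrt{17})t^4+(85784031284-20805683692\sqrt{17})t^5\\&+(197798732932-47973239324\sqrt{17})t^6+(-193832516055+47011290433\sqrt{17})t^7\\&+(-132672807253+32177882227\sqrt{17})t^8+(75432873692-18295159172\sqrt{17})t^9\\&+(170513297282-41355549134\sqrt{17})t^{10}+(-33414320906+8104163206\sqrt{17})t^{11}\\&+2(-22164247583+5375619641\sqrt{17})t^{12}.\end{aligned}$$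 Equality is achieved for a function $f_a(z)=\frac{a-z}{1-az}$, $a\in[0,1)$; that is, there exist $a\in[0,1)$ and $z$ with $|z|=r\le\frac{\sqrt{17}-3}{4}$ such that for $f=f_a$ the left-hand side above equals $1$.
   Context: $\mathbb{D}=\{z\in\mathbb{C}:|z|<1\}$ and $\mathbb{D}_r=\{z\in\mathbb{C}:|z|<r\}$. For $f(z)=\sum_{n=0}^\infty a_nz^n$ analytic in $\mathbb{D}$ with $|f|\le 1$, and $0\le r<1$: - $f_0(z):=f(z)-f(0)$ and $\|f_0\|_r^2:=\sum_{n=1}^{\infty}|a_n|^2r^{2n}$. - $B_2(f,r):=\sum_{n=2}^{\infty}|a_n|r^n$. - $A(f_0,r):=\left(\frac{1}{1+|a_0|}+\frac{r}{1-r}\right)\|f_0\|_r^2$. - $S_r=S_r(f):=\int_{\mathbb{D}_r}|f'(z)|^2\,dA(z)$, where $dA$ is planar Lebesgue measure; equivalently $S_r=\pi\sum_{n=1}^\infty n|a_n|^2r^{2n}$. *)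

(* Defs.v *)
From HB Require Import structures.
From mathcomp Require Import all_boot all_order all_algebra.
From mathcomp Require Import all_classical all_reals all_analysis.
From mathcomp.real_closed Require Import complex.

Set Implicit Arguments.
Unset Strict Implicit.
Unset Printing Implicit Defensive.

Import Order.TTheory GRing.Theory Num.Theory numFieldNormedType.Exports Normc.

Local Open Scope classical_set_scope.
Local Open Scope ring_scope.

(* The complex numbers, packaged as a [numFieldType]: in this way [Cplx R] gets
   the topology of its modulus, and [derive1] is the complex derivative.
   [normc] is the [R]-valued modulus, [`|z| = (normc z)%:C]. *)
Definition Cplx (R : realType) : numFieldType := R[i].

Section Bohr.
Variable R : realType.
Implicit Types (f : Cplx R -> Cplx R) (a : nat -> Cplx R) (r t : R) (z : Cplx R).

Definition power_series_on_disc f a : Prop :=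
  forall z, normc z < 1 -> series (fun n => a n * z ^+ n) @ \oo --> f z.

(* [\|f_0\|_r^2] *)
Definition norm0_sqr a r : R :=
  limn (fun N => \sum_(1 <= n < N) normc (a n) ^+ 2 * r ^+ (2 * n)).

Definition B2 a r : R :=
  limn (fun N => \sum_(2 <= n < N) normc (a n) * r ^+ n).

(* [A(f_0, r)] *)
Definition A0 a r : R :=
  (1 / (1 + normc (a 0%N)) + r / (1 - r)) * norm0_sqr a r.

(* [S_r]; the point [(x, y)] of the plane is the complex number [x + iy]. *)
Definition area f r : R :=
  \int[(lebesgue_measure \x lebesgue_measure)%E]_(p in
    [set p : R * R | normc (p.1 +i* p.2)%C < r])
    normc (derive1 f (p.1 +i* p.2)%C) ^+ 2.

Definition moebius (b : R) : Cplx R -> Cplx R :=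
  fun z => let b : Cplx R := b%:C%C in (b - z) / (1 - b * z).

Local Notation s17 := (Num.sqrt 17%:R : R).

Definition r_max : R := (s17 - 3%:R) / 4%:R.

(* Numerals are written [n%:R], with [n] read in [nat_scope]: large numerals
   of [ring_scope] would be expanded in unary. *)
Definition E1 t : R :=
    (321568%:R - 77024%:R * s17)
  + 8%:R * (- 1166421%:R + 282995%:R * s17) * t
  + (2287452%:R - 554244%:R * s17) * t ^+ 2
  + 16%:R * (- 974531%:R + 236341%:R * s17) * t ^+ 3
  - 40%:R * (- 181177%:R + 43951%:R * s17) * t ^+ 4
  + (88788654%:R - 21534594%:R * s17) * t ^+ 5
  + 7%:R * (- 2416805%:R + 586147%:R * s17) * t ^+ 6
  + 32%:R * (- 3664887%:R + 888865%:R * s17) * t ^+ 7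
  + 36%:R * (- 1952633%:R + 473583%:R * s17) * t ^+ 8.

Definition E2 t : R :=
    8%:R * (- 251%:R + 61%:R * s17)
  + (- 33442%:R + 8110%:R * s17) * t
  - 3%:R * (- 36847%:R + 8937%:R * s17) * t ^+ 2
  + 7%:R * (- 11351%:R + 2753%:R * s17) * t ^+ 3.

Definition mu t : R := E1 t / (128%:R * (1 + t) ^+ 3 * E2 t).

Definition Psi2 t : R :=
    128%:R * (- 12782703%:R + 3100265%:R * s17)
  + 64%:R * (- 207084487%:R + 50225361%:R * s17) * t
  - 32%:R * (- 1297411581%:R + 314668555%:R * s17) * t ^+ 2
  + (32440299472%:R - 7867928752%:R * s17) * t ^+ 3
  + 16%:R * (- 10605671261%:R + 2572253099%:R * s17) * t ^+ 4
  + (85784031284%:R - 20805683692%:R * s17) * t ^+ 5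
  + (197798732932%:R - 47973239324%:R * s17) * t ^+ 6
  + (- 193832516055%:R + 47011290433%:R * s17) * t ^+ 7
  + (- 132672807253%:R + 32177882227%:R * s17) * t ^+ 8
  + (75432873692%:R - 18295159172%:R * s17) * t ^+ 9
  + (170513297282%:R - 41355549134%:R * s17) * t ^+ 10
  + (- 33414320906%:R + 8104163206%:R * s17) * t ^+ 11
  + 2%:R * (- 22164247583%:R + 5375619641%:R * s17) * t ^+ 12.

(* The functional [J_f], at the point [z], for [f] with coefficients [a]. *)
Definition J (m : R) f a z : R :=
  let r := normc z in
  let q := area f r / (pi - area f r) in
  normc (f z) + normc (derive1 f z) * r + B2 a r + A0 a r
  + (221%:R - 43%:R * s17) / 64%:R * q + m * q ^+ 2.

End Bohr.

(* Main.v *)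
Require Import Defs.
From mathcomp Require Import all_boot all_order all_algebra.
From mathcomp Require Import cyclic separable cyclotomic.
From mathcomp Require Import all_classical all_reals all_analysis.
From mathcomp Require Import measurable_realfun.
From mathcomp.real_closed Require Import complex.
From mathcomp Require Import ring lra zify.

Set Implicit Arguments.
Unset Strict Implicit.
Unset Printing Implicit Defensive.

Import Order.TTheory GRing.Theory Num.Theory numFieldNormedType.Exports Normc.

Local Open Scope classical_set_scope.
Local Open Scope ring_scope.

(** Let A = |a_0|. Each of |f z| + |f' z| r, of B2 + A0 and of S is bounded by
    the value that it takes, for the function (A - z) / (1 - A z), at z = - r;
    these bounds increase with r, so it is enough to bound one function of A,
    bohr_majorant, at the largest radius.

    The coefficients enter only through one fact: a function bounded by 1 acts
    on square summable sequences as a contraction by multiplication, so the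
    truncated Toeplitz matrices of its coefficients are contractions
    (bounded_contractive). For polynomials this follows by averaging over roots
    of unity. Particular test vectors give:
    - the Carlson inequalities for a_(2k) and a_(2k+1), whose weighted sum
      telescopes to B2 + A0 <= (1 - A^2) r^2 / (1 - r) (B2_A0_le);
    - the Rogosinski inequality for the partial sums of |a_n|^2, which Abel
      summation turns into a bound of the sum of n |a_n|^2 r^(2n)
      (area_partial_sums);
    - truncated Szego kernels at two points, hence the positivity of the Pick
      matrix, the Schwarz-Pick inequality, and from it the growth bound of
      |f z| and the bound of |f' z| (growth_bound, schwarz_pick_derivative).

    The area is an integral over a disc in the product of two Lebesgue
    measures. Rotations preserve that measure, being products of three shears,
    so averaging over rotations by roots of unity removes the mixed terms of
    |f'|^2; what remains is radial, and the squared distance to the origin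
    carries planar measure to pi times Lebesgue measure on the half-line. The
    area is therefore pi times the sum of n |a_n|^2 r^(2n) (area_cvg).

    At r = r_max the difference between 1 and the majorant without its last
    term vanishes at A = 1 to the third order: r_max cancels the term of the
    first order, and the coefficient of S / (pi - S) the one of the second.
    Up to a constant, it is the quotient of two polynomials in A times the
    square of the bound of S / (pi - S), so the best factor of the last term is the minimum of that
    quotient. Its derivative has the sign of - Psi2 (bohr_wronskian). Since all
    the coefficients of Psi2 except the constant one are negative, Psi2 is
    decreasing on the half-line and its root is the minimum point; there the
    quotient is the stated mu (mu_bohr_quotient). The function
    (t0 - z) / (1 - t0 z), with t0 the root, turns all the inequalities into
    equalities at z = - r_max. *)

(** * Multiplication by a bounded polynomial is a contraction *)

Section Contraction.
Variable C : numClosedFieldType.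
Implicit Types (w z : C) (p q x y : {poly C}) (a : nat -> C).

Lemma prim_root_exists n : (0 < n)%N -> exists w, n.-primitive_root w.
Proof.
pose p : {poly C} := 'X^n - 1; have [s Ds] := closed_field_poly_normal p.
move=> n_gt0; rewrite (monicP _) ?monicXnsubC // scale1r in Ds.
have rs : all n.-unity_root s by apply/allP=> z; rewrite -root_prod_XsubC -Ds.
have sz_s : (n < (size s).+1)%N by rewrite -(size_prod_XsubC s id) -Ds size_XnsubC.
have [|z] := hasP (has_prim_root n_gt0 rs _ sz_s); last by exists z.
by rewrite -separable_prod_XsubC -Ds separable_Xn_sub_1 // pnatr_eq0 -lt0n.
Qed.

Lemma prim_root_norm n w : n.-primitive_root w -> `|w| = 1.
Proof.
move=> wn; have n_gt0 := prim_order_gt0 wn.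
apply/eqP; rewrite -(pexpr_eq1 n_gt0) // -normrX (prim_expr_order wn) normr1 //.
Qed.

Lemma root_of_unity_orthogonal M w n k : M.-primitive_root w ->
    (n < M)%N -> (k < M)%N ->
  \sum_(j < M) (w ^+ j) ^+ n * ((w ^+ j) ^+ k)^* = if n == k then M%:R else 0.
Proof.
move=> wM nM kM; have w1 := prim_root_norm wM.
have w0 : w != 0 by rewrite -normr_eq0 w1 oner_eq0.
have wconj : w^* = w^-1 by rewrite invC_norm w1 expr1n invr1 mul1r.
set v := w ^+ n / w ^+ k.
have E (j : 'I_M) : (w ^+ j) ^+ n * ((w ^+ j) ^+ k)^* = v ^+ j.
  by rewrite !rmorphXn /= wconj /v expr_div_n !exprVn -!exprM [(j * n)%N]mulnC [(j * k)%N]mulnC.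
rewrite (eq_bigr _ (fun j _ => E j)); case: eqVneq => [nk|nk].
  rewrite /v nk divff ?expf_neq0 // (eq_bigr (fun=> 1)) => [|? _]; last by rewrite expr1n.
  by rewrite sumr_const card_ord.
have v1 : v != 1.
  rewrite /v -(inj_eq (mulIf (expf_neq0 k w0))) divfK ?expf_neq0 // mul1r.
  by rewrite (eq_prim_root_expr wM) !modn_small.
have /eqP : (v - 1) * (\sum_(j < M) v ^+ j) = 0.
  rewrite -subrX1 /v expr_div_n -!exprM !(mulnC _ M) !exprM (prim_expr_order wM).
  by rewrite !expr1n divr1 subrr.
by rewrite mulf_eq0 subr_eq0 (negbTE v1) => /eqP.
Qed.

(** The discrete form is exact for polynomials of size at most M, so no integral over
    the circle is needed. *)
Lemma parseval M w p q : M.-primitive_root w -> (size p <= M)%N -> (size q <= M)%N ->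
  \sum_(j < M) p.[w ^+ j] * (q.[w ^+ j])^* = M%:R * \sum_(n < M) p`_n * (q`_n)^*.
Proof.
move=> wM pM qM.
under eq_bigr => j _ do rewrite (horner_coef_wide _ pM) (horner_coef_wide _ qM) rmorph_sum
  mulr_suml /=.
rewrite exchange_big mulr_sumr; apply: eq_bigr => n _ /=.
under eq_bigr => j _ do rewrite mulr_sumr.
rewrite exchange_big /= (bigD1 n) //= [X in _ + X]big1 ?addr0 => [|k kn].
  under eq_bigr => j _ do rewrite rmorphM /= mulrACA.
  by rewrite -mulr_sumr root_of_unity_orthogonal // eqxx mulrC.
under eq_bigr => j _ do rewrite rmorphM /= mulrACA.
rewrite -mulr_sumr root_of_unity_orthogonal //.
by rewrite -(inj_eq val_inj) eq_sym in kn; rewrite (negbTE kn) mulr0.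
Qed.

(** On the circle |q x y| <= |x| |y| <= (|x|^2 + |y|^2) / 2, and averages over roots of unity
    of high order turn this into a bound between coefficients. *)
Lemma polynomial_contraction q x y N :
    (forall z, `|z| = 1 -> `|q.[z]| <= 1) ->
    (size x <= N)%N -> (size y <= N)%N ->
  `|\sum_(n < N) (q * x)`_n * (y`_n)^*| <=
    (\sum_(n < N) `|x`_n| ^+ 2 + \sum_(n < N) `|y`_n| ^+ 2) / 2.
Proof.
move=> q1 xN yN; pose M := (N + size q).+1; have M_gt0 : (0 < M)%N by [].
have NM : (N <= M)%N by rewrite /M; lia.
have [w wM] := prim_root_exists M_gt0.
have extend (F : nat -> C) : (forall n, (N <= n)%N -> F n = 0) ->
    \sum_(n < N) F n = \sum_(n < M) F n.
  move=> F0; rewrite (big_ord_widen _ _ NM) big_mkcond; apply: eq_bigr => n _.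
  by case: ifPn => // /negbTE; rewrite ltnNge => /negbFE /F0.
have norm2 p : (size p <= N)%N ->
    M%:R * \sum_(n < N) `|p`_n| ^+ 2 = \sum_(j < M) `|p.[w ^+ j]| ^+ 2.
  move=> pN; under [RHS]eq_bigr => j _ do rewrite normCK.
  rewrite (parseval wM) ?(leq_trans pN) // (extend (fun n => `|p`_n| ^+ 2)) => [|n Nn].
    by congr (_ * _); apply: eq_bigr => n _; rewrite normCK.
  by rewrite nth_default ?normr0 ?expr0n // (leq_trans pN).
have M0 : 0 < M%:R :> C by rewrite ltr0n.
rewrite -(ler_pM2l M0) -{1}(normr_nat C M) -normrM.
rewrite (extend (fun n => (q * x)`_n * (y`_n)^*)) => [|n Nn]; last first.
  by rewrite [y`__]nth_default ?(leq_trans yN) // conjC0 mulr0.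
have qxM : (size (q * x)%R <= M)%N.
  by apply: leq_trans (size_polyMleq _ _) _; rewrite /M; lia.
rewrite -(parseval wM) ?(leq_trans yN) //.
rewrite mulrA mulrDr norm2 // norm2 // -big_split /= mulr_suml.
apply: le_trans (ler_norm_sum _ _ _) _; apply: ler_sum => j _.
rewrite hornerM !normrM norm_conjC -mulrA.
have : `|q.[w ^+ j]| <= 1 by apply: q1; rewrite normrX (prim_root_norm wM) expr1n.
move: (normr_ge0 q.[w ^+ j]) (normr_ge0 x.[w ^+ j]) (normr_ge0 y.[w ^+ j]).
set u := `|_|; set s := `|_|; set t := `|_| => u0 s0 t0 u1.
apply: (@le_trans _ _ (s * t)); first by rewrite ler_piMl ?mulr_ge0.
rewrite ler_pdivlMr ?ltr0n // -subr_ge0.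
have -> : s ^+ 2 + t ^+ 2 - s * t * 2 = (s - t) ^+ 2 by ring.
by rewrite real_exprn_even_ge0 // rpredB ?ger0_real.
Qed.

(** The inner sum g is the image of y under the transpose of multiplication by the b_i. Its squared norm is the
    pairing of y with conj(g) multiplied by the b_i, to which polynomial_contraction applies. *)
Lemma truncation_contraction (b : nat -> C) (c : C) m N (y : nat -> C) : 0 < c ->
    (forall z, `|z| = 1 -> `|\sum_(i < m) b i * z ^+ i| <= c) -> (N <= m)%N ->
  \sum_(k < N) `|\sum_(n < N | (k <= n)%N) b (n - k)%N * y n| ^+ 2 <=
    c ^+ 2 * \sum_(n < N) `|y n| ^+ 2.
Proof.
move=> c0 bc Nm.
pose g k := \sum_(n < N | (k <= n)%N) b (n - k)%N * y n.
(* with this scaling the pairing and the squared norm of X are equal, so that the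
   bound can be solved for their common value *)
pose q := \poly_(i < m) (c^-1 * b i); pose X := \poly_(k < N) (c^-1 * (g k)^*).
pose Y := \poly_(n < N) (y n)^*.
have q1 z : `|z| = 1 -> `|q.[z]| <= 1.
  move=> z1; rewrite horner_poly; under eq_bigr => i _ do rewrite -mulrA.
  rewrite -mulr_sumr normrM normfV (gtr0_norm c0) mulrC ler_pdivrMr // mul1r.
  exact: bc.
have := polynomial_contraction q1 (size_poly _ _ : size X <= N)%N (size_poly _ _ : size Y <= N)%N.
have -> : \sum_(n < N) (q * X)`_n * (Y`_n)^* = c^-1 ^+ 2 * \sum_(k < N) `|g k| ^+ 2.
  transitivity (\sum_(n < N) \sum_(k < N | (k <= n)%N)
     c^-1 * (c^-1 * (b (n - k)%N * y n * (g k)^*))).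
    apply: eq_bigr => n _; rewrite coefMr coef_poly ltn_ord conjCK mulr_suml.
    rewrite (big_ord_widen_cond N xpredT (fun k => q`_(n - k) * X`_k * y n)) //=.
    apply: eq_big => k; first by rewrite ltnS.
    rewrite ltnS => kn; rewrite !coef_poly ltn_ord (leq_ltn_trans (leq_subr _ _)) //; first ring.
    exact: leq_trans Nm.
  rewrite (exchange_big_dep xpredT) //= mulr_sumr; apply: eq_bigr => k _.
  rewrite normCK {1}/g mulr_suml mulr_sumr; apply: eq_bigr => n _; ring.
have gE : \sum_(n < N) `|X`_n| ^+ 2 = c^-1 ^+ 2 * \sum_(k < N) `|g k| ^+ 2.
  rewrite mulr_sumr; apply: eq_bigr => k _; rewrite coef_poly ltn_ord normrM norm_conjC exprMn.
  by rewrite normfV (gtr0_norm c0).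
have yE : \sum_(n < N) `|Y`_n| ^+ 2 = \sum_(n < N) `|y n| ^+ 2.
  by apply: eq_bigr => n _; rewrite coef_poly ltn_ord norm_conjC.
rewrite gE yE; set G := \sum_(k < N) `|g k| ^+ 2; set H := \sum_(n < N) `|y n| ^+ 2.
have G0 : 0 <= G by apply: sumr_ge0 => k _; rewrite exprn_ge0.
rewrite ger0_norm ?mulr_ge0 ?exprn_ge0 ?invr_ge0 ?(ltW c0) // ler_pdivlMr // mulrDr mulr1 lerD2l.
by rewrite mulrC exprVn ler_pdivrMr ?exprn_gt0 // mulrC.
Qed.
End Contraction.

(** * The complex modulus *)

Section Modulus.
Variable R : realType.
Implicit Types (z w : Cplx R) (u : nat -> Cplx R).

Lemma normc_E z : `|z| = (normc z)%:C%C. Proof. by case: z. Qed.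

Lemma normc_ge0 z : 0 <= normc z. Proof. by rewrite -ler0c -normc_E normr_ge0. Qed.

Lemma normc_eq0 z : (normc z == 0) = (z == 0).
Proof. by rewrite -[z == 0]normr_eq0 normc_E -(inj_eq (@complexI R)). Qed.

Lemma normcX z n : normc (z ^+ n) = normc z ^+ n.
Proof. by apply: complexI; rewrite rmorphXn -!normc_E normrX. Qed.

Lemma normc_sum (I : Type) (s : seq I) (P : pred I) (F : I -> Cplx R) :
  normc (\sum_(i <- s | P i) F i) <= \sum_(i <- s | P i) normc (F i).
Proof.
rewrite -lecR rmorph_sum -normc_E; apply: le_trans (ler_norm_sum _ _ _) _.
by apply: ler_sum => i _; rewrite normc_E.
Qed.

Lemma normc_conj z : normc (z^*)%C = normc z.
Proof. by apply: complexI; rewrite -!normc_E normcJ. Qed.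

Lemma normc_real (x : R) : normc (x%:C)%C = `|x|.
Proof. by rewrite /= expr0n addr0 sqrtr_sqr. Qed.

Lemma normc_Re_conj z w :
  normc (z + w) ^+ 2 = normc z ^+ 2 + normc w ^+ 2 + 2 * complex.Re (z * (w^*)%C).
Proof.
case: z w => [a b] [c d] /=; rewrite !sqr_sqrtr ?addr_ge0 ?sqr_ge0 //; ring.
Qed.

Lemma cvg_normcP u z : u @ \oo --> z <->
  (forall e : R, 0 < e -> exists N, forall n, (N <= n)%N -> normc (z - u n) < e).
Proof.
split=> [/cvgrPdist_lt uz e e0|uz].
  have [|N _ NP] := uz (e%:C)%C; first by rewrite (ltcR 0).
  by exists N => n Nn; have := NP n Nn; rewrite /= normc_E ltcR.
apply/cvgrPdist_lt => e e0; have /complex_realP[r er] := gtr0_real e0.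
rewrite er (ltcR 0) in e0; have [N NP] := uz r e0.
by exists N => // n Nn; rewrite /= normc_E er ltcR NP.
Qed.

Lemma cvg_normc u z : u @ \oo --> z -> (fun n => normc (u n)) @ \oo --> normc z.
Proof.
move=> /cvg_normcP uz; apply/cvgrPdist_lt => e e0.
have [N NP] := uz e e0; exists N => // n Nn /=; apply: le_lt_trans (NP n Nn).
have h1 := le_normcD (u n) (z - u n); have h2 := le_normcD z (- (z - u n)).
by rewrite addrC subrK in h1; rewrite subKr normcN in h2; rewrite ler_norml; lra.
Qed.

Lemma truncation_contractionR (b : nat -> Cplx R) (c : R) m N (y : nat -> Cplx R) : 0 < c ->
    (forall z, normc z = 1 -> normc (\sum_(i < m) b i * z ^+ i) <= c) -> (N <= m)%N ->
  \sum_(k < N) normc (\sum_(n < N | (k <= n)%N) b (n - k)%N * y n) ^+ 2 <=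
    c ^+ 2 * \sum_(n < N) normc (y n) ^+ 2.
Proof.
move=> c0 bc Nm; rewrite -lecR rmorphM !rmorph_sum rmorphXn /=.
under eq_bigr => k _ do rewrite rmorphXn /= -normc_E.
under [X in _ <= _ * X]eq_bigr => k _ do rewrite rmorphXn /= -normc_E.
apply: (@truncation_contraction R[i] b _ m) => //; first by rewrite (ltcR 0).
move=> z; rewrite normc_E => /complexI z1; rewrite normc_E lecR; exact: bc.
Qed.
End Modulus.

(** * Bounded power series have contractive coefficients *)

Section PowerSeries.
Variable R : realType.
Implicit Types (f : Cplx R -> Cplx R) (a : nat -> Cplx R) (z w : Cplx R) (r e : R).

Lemma coef_growth f a r : power_series_on_disc f a -> 0 <= r < 1 ->
  exists2 K, 0 < K & forall n, normc (a n) * r ^+ n <= K.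
Proof.
move=> fa /andP[r0 r1]; have rN : normc (r%:C)%C = r by rewrite normc_real ger0_norm.
have /fa /cvgP /cvg_series_cvg_0 /cvg_normcP /(_ 1 ltr01) [N NP] : normc (r%:C)%C < 1.
  by rewrite rN.
have tE n : normc (a n) * r ^+ n = normc (a n * (r%:C)%C ^+ n) by rewrite normcM normcX rN.
exists (1 + \sum_(n < N) normc (a n) * r ^+ n) => [|n].
  by rewrite ltr_pwDl // sumr_ge0 // => i _; rewrite tE normc_ge0.
have [Nn|nN] := leqP N n.
  rewrite ler_wpDr ?sumr_ge0 // => [i _|]; first by rewrite tE normc_ge0.
  by have /ltW := NP n Nn; rewrite sub0r normcN tE.
rewrite (bigD1 (Ordinal nN)) //= addrCA lerDl addr_ge0 ?sumr_ge0 // => i _.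
by rewrite tE normc_ge0.
Qed.

Lemma geometric_sum_le (q : R) m n : 0 <= q < 1 ->
  \sum_(m <= i < n) q ^+ i <= q ^+ m / (1 - q).
Proof.
move=> /andP[q0 q1]; have q1' : 0 < 1 - q by rewrite subr_gt0.
have [mn|/ltnW nm] := leqP m n; last first.
  by rewrite big_geq //; apply: divr_ge0; [exact: exprn_ge0|exact: ltW].
rewrite ler_pdivlMr // mulr_suml; under eq_bigr => i _ do rewrite mulrBr mulr1 -exprSr.
rewrite (@telescope_sumr_eq _ _ _ (fun i => - q ^+ i)) // => [|i _]; last by ring.
by rewrite opprK addrC lerBlDr lerDl exprn_ge0.
Qed.

Lemma expr_small (q e : R) : 0 <= q < 1 -> 0 < e -> exists m, q ^+ m < e.
Proof.
move=> /andP[q0 q1] e0; have /cvg_expr : `|q| < 1 by rewrite ger0_norm.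
move=> /cvgrPdist_lt /(_ e e0)[N _ /(_ N (leqnn N))] /=; rewrite sub0r normrN ger0_norm ?exprn_ge0 //.
by exists N.
Qed.

(** Pointwise convergence on the whole disc makes the terms bounded on a larger circle, so
    the tail is dominated by a geometric series, uniformly on the smaller disc. *)
Lemma power_series_uniform f a r e : power_series_on_disc f a -> 0 <= r < 1 -> 0 < e ->
  exists m0, forall m z, (m0 <= m)%N -> normc z <= r ->
    normc (f z - \sum_(n < m) a n * z ^+ n) <= e.
Proof.
move=> fa /andP[r0 r1] e0; pose r' := (1 + r) / 2; pose q := r / r'.
have r'0 : 0 < r' by rewrite /r'; lra.
have r'1 : 0 <= r' < 1 by rewrite /r'; lra.
have q01 : 0 <= q < 1.
  by rewrite /q divr_ge0 ?(ltW r'0) //= ltr_pdivrMr // mul1r /r'; lra.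
have [K K0 aK] := coef_growth fa r'1.
have q1 : 0 < 1 - q by lra.
have [|m0 m0P] := @expr_small q (e * (1 - q) / K) q01; first by rewrite divr_gt0 ?mulr_gt0.
exists m0 => m z m0m zr; have z1 : normc z < 1 by apply: le_lt_trans r1.
have tail M : (m <= M)%N -> normc (\sum_(n < M) a n * z ^+ n - \sum_(n < m) a n * z ^+ n) <= e.
  move=> mM; rewrite -!(big_mkord xpredT (fun n => a n * z ^+ n)) (@big_cat_nat _ _ _ m) //= addrAC subrr add0r.
  apply: le_trans (normc_sum _ _ _) _.
  apply: (@le_trans _ _ (\sum_(m <= n < M) K * q ^+ n)).
    apply: ler_sum => n _; rewrite normcM normcX /q expr_div_n mulrA ler_pdivlMr ?exprn_gt0 //.
    rewrite mulrAC; apply: ler_pM; rewrite ?mulr_ge0 ?normc_ge0 ?exprn_ge0 ?(ltW r'0) ?normc_ge0 //.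
    by rewrite lerXn2r ?nnegrE ?normc_ge0.
  rewrite -mulr_sumr; apply: le_trans (ler_wpM2l (ltW K0) (geometric_sum_le _ _ q01)) _.
  rewrite mulrA ler_pdivrMr // mulrC -ler_pdivlMr //; apply: le_trans (ltW m0P).
  by rewrite ler_wiXn2l //; case/andP: q01 => // _ /ltW.
apply/ler_addgt0Pr => d d0; have /cvg_normcP /(_ d d0)[N NP] := fa z z1.
have := NP (maxn N m) (leq_maxl _ _); rewrite /series /= big_mkord => /ltW lt1.
rewrite -(subrK (\sum_(n < maxn N m) a n * z ^+ n) (f z)) -addrA.
apply: le_trans (le_normcD _ _) _; rewrite [e + d]addrC lerD //.
by rewrite tail // leq_maxr.
Qed.

(** The upper triangular Toeplitz matrices of [a] have operator norm at most 1. *)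
Definition contractive a := forall N (y : nat -> Cplx R),
  \sum_(k < N) normc (\sum_(n < N | (k <= n)%N) a (n - k)%N * y n) ^+ 2 <=
    \sum_(n < N) normc (y n) ^+ 2.

(** On the circle of radius r = 1 - d the partial sums are uniformly close to f, hence bounded
    by 1 + d; the dilation by r costs a factor r^(2N) for the matrix of size N, and d tends
    to 0 with N fixed. *)
Lemma bounded_contractive f a : power_series_on_disc f a ->
  (forall z, normc z < 1 -> normc (f z) <= 1) -> contractive a.
Proof.
move=> fa f1 N y.
set G := (X in X <= _); set H := (X in _ <= X).
have sum_ge0 (n : nat) (F : 'I_n -> Cplx R) : 0 <= \sum_(k < n) normc (F k) ^+ 2.
  by apply: sumr_ge0 => k _; rewrite exprn_ge0 ?normc_ge0.
have G0 : 0 <= G by exact: sum_ge0.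
have H0 : 0 <= H by exact: sum_ge0.
have key d : 0 < d -> d < 1 -> (1 - d) ^+ (2 * N) * G <= (1 + d) ^+ 2 * H.
  move=> d0 d1; pose r := 1 - d; have r0 : 0 < r by rewrite /r; lra.
  have r01 : 0 <= r < 1 by rewrite /r; lra.
  have rN (x : R) : 0 < x -> normc ((x%:C)%C : Cplx R) = x.
    by move=> x0; rewrite normc_real gtr0_norm.
  have [m0 m0P] := power_series_uniform fa r01 d0.
  pose b n := a n * ((r%:C)%C) ^+ n; pose y' n := y n * (((r^-1)%:C)%C) ^+ n.
  have bc z : normc z = 1 -> normc (\sum_(i < maxn m0 N) b i * z ^+ i) <= 1 + d.
    move=> z1; have rz : normc ((r%:C)%C * z) <= r by rewrite normcM z1 mulr1 rN.
    have := m0P (maxn m0 N) _ (leq_maxl _ _) rz.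
    have -> : \sum_(n < maxn m0 N) a n * ((r%:C)%C * z) ^+ n =
        \sum_(i < maxn m0 N) b i * z ^+ i.
      by apply: eq_bigr => i _; rewrite exprMn mulrA.
    set T := (\sum_(i < _) _) => fT.
    rewrite -(subKr (f ((r%:C)%C * z)) T); apply: le_trans (le_normcD _ _) _.
    by rewrite normcN lerD // f1 // (le_lt_trans rz) // /r; lra.
  have := truncation_contractionR y' _ bc (leq_maxr _ _).
  rewrite -/H => /(_ ltac:(lra)) tc.
  have rX n : 0 <= r ^+ n <= 1.
    by rewrite exprn_ge0 ?(ltW r0) // exprn_ile1 //; case/andP: r01 => // _ /ltW.
  have lhs : G <= \sum_(k < N) normc (\sum_(n < N | (k <= n)%N) b (n - k)%N * y' n) ^+ 2.
    apply: ler_sum => k _; rewrite lerXn2r ?nnegrE ?normc_ge0 //.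
    have -> : \sum_(n < N | (k <= n)%N) b (n - k)%N * y' n =
       ((r^-1)%:C)%C ^+ k * \sum_(n < N | (k <= n)%N) a (n - k)%N * y n.
      rewrite mulr_sumr; apply: eq_bigr => n kn.
      rewrite /b /y' mulrACA -[X in (r^-1)%:C%C ^+ X](subnK kn) exprD.
      by rewrite [r%:C%C ^+ _ * _]mulrA -exprMn -rmorphM /= mulfV ?gt_eqF // expr1n mul1r mulrC.
    rewrite normcM normcX rN ?invr_gt0 // ler_peMl ?normc_ge0 // exprn_ege1 //.
    by rewrite -[X in X <= _]invr1 lef_pV2 ?posrE // /r; lra.
  have rhs : r ^+ (2 * N) * \sum_(n < N) normc (y' n) ^+ 2 <= H.
    rewrite mulr_sumr; apply: ler_sum => n _; rewrite normcM normcX rN ?invr_gt0 // exprMn mulrCA.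
    rewrite ler_piMr ?exprn_ge0 ?normc_ge0 // -exprM exprVn ler_pdivrMr ?exprn_gt0 // mul1r.
    by rewrite ler_wiXn2l ?(ltW r0) //; [rewrite /r; lra|rewrite mulnC leq_mul2l /= ltnW].
  apply: le_trans (ler_wpM2l _ (le_trans lhs tc)) _; first by case/andP: (rX (2 * N)%N).
  by rewrite mulrCA ler_wpM2l ?exprn_ge0 //; lra.
(* Bernoulli: it makes the loss in key linear in d *)
have bern (d : R) n : 0 <= d <= 1 -> 1 - n%:R * d <= (1 - d) ^+ n.
  move=> /andP[d0 d1]; elim: n => [|n IH]; first by rewrite mul0r expr0; lra.
  rewrite exprS; have := ler_wpM2l (_ : 0 <= 1 - d) IH; rewrite subr_ge0 => /(_ d1).
  apply: le_trans; rewrite -natr1.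
  have : 0 <= n%:R * d * d by rewrite !mulr_ge0.
  nra.
apply/ler_addgt0Pr => e e0; pose K := 1 + 3 * H + (2 * N)%:R * G.
have nG : 0 <= (2 * N)%:R * G by rewrite mulr_ge0.
have K1 : 1 <= K by rewrite /K; lra.
pose d := Num.min (1 / 2) (e / K).
have d0 : 0 < d by rewrite /d lt_min; apply/andP; split; [lra|apply: divr_gt0; lra].
have d2 : d <= 1 / 2 by rewrite /d ge_min lexx.
have dK : d * K <= e.
  by rewrite -ler_pdivlMr; [rewrite /d ge_min lexx orbT|lra].
have d1 : d < 1 by lra.
have := key d d0 d1; have := bern d (2 * N)%N; rewrite (ltW d0) (ltW d1) => /(_ isT).
move=> /(ler_wpM2r G0) h1 h2; have h3 := le_trans h1 h2.
have dd : 0 <= d * H by rewrite mulr_ge0 // ltW.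
have dd2 : d * d * H <= d * H by rewrite ler_wpM2r // ger_pMl //; lra.
move: h3 dK; rewrite /K; set M := (2 * N)%:R; nra.
Qed.
End PowerSeries.

(** * The Carlson and Rogosinski inequalities *)

Section Coefficients.
Variable R : realType.
Implicit Types (a : nat -> Cplx R) (z w : Cplx R) (r e : R).

Lemma contractive_column a n (y : nat -> Cplx R) : contractive a ->
  normc (\sum_(0 <= j < n.+1) a j * y j) ^+ 2 +
  \sum_(1 <= k < n.+1) normc (\sum_(k <= j < n.+1) a (j - k)%N * y j) ^+ 2 <=
  \sum_(0 <= j < n.+1) normc (y j) ^+ 2.
Proof.
move=> /(_ n.+1 y); rewrite -(big_mkord xpredT (fun j => normc (y j) ^+ 2)).
have E k : \sum_(j < n.+1 | (k <= j)%N) a (j - k)%N * y j = \sum_(k <= j < n.+1) a (j - k)%N * y j.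
  by rewrite big_geq_mkord.
under [X in X <= _ -> _]eq_bigr => k _ do rewrite E.
rewrite -(big_mkord xpredT (fun k => normc (\sum_(k <= j < n.+1) a (j - k)%N * y j) ^+ 2)).
rewrite [X in X <= _ -> _]big_ltn //.
by under [X in normc X]eq_bigr => j _ do rewrite subn0.
Qed.

(** The test vector is u on the indices 0..m and 1 at the index n; the rows of index greater than m
    meet only the entry at n, so they contribute the squares of the first n - m coefficients. *)
Lemma contractive_two_blocks a n m (u : nat -> Cplx R) : contractive a -> (0 < m < n)%N ->
  normc (\sum_(0 <= j < m.+1) a j * u j + a n) ^+ 2 +
  normc (a 0%N * u m + a (n - m)%N) ^+ 2 +
  \sum_(0 <= i < n - m) normc (a i) ^+ 2 <=
  \sum_(0 <= j < m.+1) normc (u j) ^+ 2 + 1.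
Proof.
move=> ca /andP[m0 mn]; pose y j := if (j <= m)%N then u j else if j == n then 1 else 0.
have yu j : (j <= m)%N -> y j = u j by rewrite /y => ->.
have y0 j : (m < j < n)%N -> y j = 0.
  by rewrite /y => /andP[mj jn]; rewrite leqNgt mj /= ltn_eqF.
have yn : y n = 1 by rewrite /y leqNgt mn /= eqxx.
have := contractive_column n y ca.
have split_sum (V : zmodType) (F : nat -> V) : (forall j, (m < j < n)%N -> F j = 0) ->
    forall k, (k <= m.+1)%N -> \sum_(k <= j < n.+1) F j = \sum_(k <= j < m.+1) F j + F n.
  move=> F0 k km; rewrite big_nat_recr ?(leq_trans km) //= (@big_cat_nat _ _ _ m.+1) //=.
  by rewrite [X in _ + X + _]big_nat_cond [X in _ + X + _]big1 ?addr0 // => j; rewrite andbT => /F0.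
rewrite split_sum // => [|j jmn]; last by rewrite y0 // mulr0.
rewrite [X in _ <= X -> _]split_sum // => [|j jmn]; last by rewrite y0 // normc0 expr0n.
rewrite yn mulr1 normc1 expr1n [\sum_(1 <= k < n.+1) _](@big_cat_nat _ _ _ m) //=;
  last exact: leq_trans (ltnW mn) _.
rewrite [\sum_(m <= k < n.+1) _]big_ltn ?(ltn_trans mn) //=.
rewrite [\sum_(m <= j < n.+1) _]split_sum // => [|j jmn]; last by rewrite y0 // mulr0.
rewrite big_nat1 subnn yn mulr1 !yu //.
have -> : \sum_(m.+1 <= k < n.+1) normc (\sum_(k <= j < n.+1) a (j - k)%N * y j) ^+ 2 =
    \sum_(0 <= i < n - m) normc (a i) ^+ 2.
  rewrite -{1}(add0n m.+1) big_addn subSS [RHS]big_nat_rev /= add0n.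
  rewrite big_nat_cond [RHS]big_nat_cond; apply: eq_bigr => i /andP[/andP[_ im] _].
  rewrite big_nat_recr ?big1_seq /=.
  - have -> : (n - (i + m.+1) = n - m - i.+1)%N by lia.
    by rewrite yn mulr1 add0r.
  - move=> j; rewrite mem_index_iota => /andP[h1 h2].
    by rewrite y0 ?mulr0 // h2 andbT; lia.
  - lia.
have -> : \sum_(0 <= j < m.+1) a j * y j = \sum_(0 <= j < m.+1) a j * u j.
  by apply: eq_big_nat => j /andP[_ jm]; rewrite yu.
have -> : \sum_(0 <= j < m.+1) normc (y j) ^+ 2 = \sum_(0 <= j < m.+1) normc (u j) ^+ 2.
  by apply: eq_big_nat => j /andP[_ jm]; rewrite yu.
set S := \sum_(1 <= k < m) _.
have : 0 <= S by apply: sumr_ge0 => k _; rewrite exprn_ge0 ?normc_ge0.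
lra.
Qed.

Lemma phase_factor z : exists2 w, normc w = 1 & z = w * ((normc z)%:C)%C.
Proof.
have [->|z0] := eqVneq z 0; first by exists 1; rewrite ?normc1 // normc0 rmorph0 mulr0.
have n0 : normc z != 0 by rewrite normc_eq0.
exists (z * ((normc z)^-1%:C)%C).
  by rewrite normcM normc_real ger0_norm ?invr_ge0 ?normc_ge0 // mulfV.
by rewrite -mulrA -rmorphM /= mulVf // rmorph1 mulr1.
Qed.

Lemma mul_conj z : z * (z^*)%C = ((normc z ^+ 2)%:C)%C.
Proof. by rewrite -sqr_normc normc_E rmorphXn. Qed.

(** With u_j = w conj(a_j) for j <= k, w the phase of the last coefficient, the first row of
    the matrix gives (S + |a_(2k+1)|)^2, where S is the sum on the right; the lower rows give
    S, which is also the norm of u. *)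
Lemma carlson_odd a k : contractive a -> (0 < k)%N ->
  normc (a k.*2.+1) <= 1 - \sum_(0 <= j < k.+1) normc (a j) ^+ 2.
Proof.
move=> ca k0; have [w w1 aw] := phase_factor (a k.*2.+1).
have kk : (0 < k < k.*2.+1)%N by rewrite k0 -addnn ltnS leq_addr.
have := @contractive_two_blocks a k.*2.+1 k (fun j => w * ((a j)^*)%C) ca kk.
have -> : (k.*2.+1 - k = k.+1)%N by lia.
set S := \sum_(0 <= j < k.+1) normc (a j) ^+ 2.
have -> : \sum_(0 <= j < k.+1) normc (w * ((a j)^*)%C) ^+ 2 = S.
  by apply: eq_bigr => j _; rewrite normcM w1 mul1r normc_conj.
have -> : \sum_(0 <= j < k.+1) a j * (w * ((a j)^*)%C) + a k.*2.+1 =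
    w * ((S + normc (a k.*2.+1))%:C)%C.
  rewrite rmorphD rmorph_sum {1}aw mulrDr mulr_sumr; congr (_ + _).
  by apply: eq_bigr => j _; rewrite mulrCA mul_conj.
have S0 : 0 <= S by apply: sumr_ge0 => i _; rewrite exprn_ge0 ?normc_ge0.
have a0 := normc_ge0 (a k.*2.+1).
rewrite normcM w1 mul1r normc_real ger0_norm ?addr_ge0 // => h.
have h1 : (S + normc (a k.*2.+1)) ^+ 2 <= 1.
  by have := sqr_ge0 (normc (a 0%N * (w * ((a k)^*)%C) + a k.+1)); lra.
by move: h1; rewrite expr_le1 ?addr_ge0 // ; lra.
Qed.

(** Here the row k meets both blocks. The entry u_k is divided by 1 + |a_0| so that this row
    still outweighs the contribution of u_k to the norm (the step mid). *)
Lemma carlson_even a k : contractive a -> (0 < k)%N ->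
  normc (a k.*2) <= 1 - \sum_(0 <= j < k) normc (a j) ^+ 2
    - normc (a k) ^+ 2 / (1 + normc (a 0%N)).
Proof.
move=> ca k0; have [w w1 aw] := phase_factor (a k.*2).
have kk : (0 < k < k.*2)%N by rewrite k0 -addnn -[X in (X < _)%N]addn0 ltn_add2l.
set A := normc (a 0%N); have A0 : 0 <= A by exact: normc_ge0.
pose c := (1 + A)^-1; have cA : c * (1 + A) = 1 by rewrite mulVf // gt_eqF //; lra.
have c0 : 0 < c by rewrite invr_gt0; lra.
pose u j := if j == k then w * ((c%:C)%C * ((a k)^*)%C) else w * ((a j)^*)%C.
have := @contractive_two_blocks a k.*2 k u ca kk.
have -> : (k.*2 - k = k)%N by lia.
set S := \sum_(0 <= j < k) normc (a j) ^+ 2; set p := normc (a k) ^+ 2.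
have p0 : 0 <= p by exact: sqr_ge0.
have S0 : 0 <= S by apply: sumr_ge0 => i _; rewrite exprn_ge0 ?normc_ge0.
have a0 := normc_ge0 (a k.*2).
have uj j : (j < k)%N -> u j = w * ((a j)^*)%C by rewrite /u => jk; rewrite ltn_eqF.
have uk : u k = w * ((c%:C)%C * ((a k)^*)%C) by rewrite /u eqxx.
have ukn : normc (u k) ^+ 2 = c ^+ 2 * p.
  by rewrite uk !normcM w1 mul1r normc_conj normc_real gtr0_norm // exprMn.
have -> : \sum_(0 <= j < k.+1) normc (u j) ^+ 2 = S + c ^+ 2 * p.
  rewrite big_nat_recr //= ukn; congr (_ + _); apply: eq_big_nat => j /andP[_ jk].
  by rewrite uj // normcM w1 mul1r normc_conj.
have -> : \sum_(0 <= j < k.+1) a j * u j + a k.*2 = w * ((S + c * p + normc (a k.*2))%:C)%C.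
  rewrite !rmorphD rmorph_sum {1}aw !mulrDr mulr_sumr big_nat_recr //=; congr (_ + _ + _).
    by apply: eq_big_nat => j /andP[_ jk]; rewrite uj // mulrCA mul_conj.
  by rewrite uk mulrCA [a k * _]mulrCA mul_conj -rmorphM.
have mid : c ^+ 2 * p <= normc (a 0%N * u k + a k) ^+ 2.
  have -> : c ^+ 2 * p = (c * normc (a k)) ^+ 2 by rewrite exprMn.
  rewrite lerXn2r ?nnegrE ?mulr_ge0 ?normc_ge0 ?(ltW c0) //.
  have := le_normcD (a 0%N * u k + a k) (- (a 0%N * u k)).
  rewrite addrAC subrr add0r normcN normcM uk !normcM w1 mul1r normc_conj normc_real.
  rewrite (gtr0_norm c0) -/A.
  have -> : A * (c * normc (a k)) = (A * c) * normc (a k) by rewrite mulrA.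
  have -> : A * c = 1 - c by lra.
  by lra.
have cp0 : 0 <= c * p by rewrite mulr_ge0 // ltW.
have x0 : 0 <= S + c * p + normc (a k.*2) by rewrite !addr_ge0.
rewrite normcM w1 mul1r normc_real ger0_norm // => h.
have h1 : (S + c * p + normc (a k.*2)) ^+ 2 <= 1 by lra.
rewrite -[_ / _]mulrC -/c; move: h1; rewrite expr_le1 //; lra.
Qed.

(** The sum is the squared norm of the last column of the Toeplitz matrix. *)
Lemma sum_sqr_le1 a n : contractive a -> \sum_(0 <= j < n.+1) normc (a j) ^+ 2 <= 1.
Proof.
move=> ca; have := contractive_column n (fun j => (j == n)%:R) ca.
have col k : (k < n.+1)%N -> \sum_(k <= j < n.+1) a (j - k)%N * (j == n)%:R = a (n - k)%N.
  move=> kn; rewrite big_nat_recr //= eqxx mulr1 big1_seq ?add0r // => j /andP[_].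
  by rewrite mem_index_iota => /andP[_ jn]; rewrite ltn_eqF // mulr0.
have -> : \sum_(0 <= j < n.+1) normc ((j == n)%:R : Cplx R) ^+ 2 = 1.
  rewrite big_nat_recr //= eqxx normc1 expr1n big1_seq ?add0r // => j /andP[_].
  by rewrite mem_index_iota => /andP[_ jn]; rewrite ltn_eqF // normc0 expr0n.
apply: le_trans; rewrite le_eqVlt; apply/orP; left; apply/eqP.
transitivity (\sum_(0 <= k < n.+1) normc (a (n - k)%N) ^+ 2).
  by rewrite [LHS]big_nat_rev /= add0n; apply: eq_bigr => i _; rewrite subSS.
rewrite big_ltn // subn0; congr (_ + _).
  have := col 0%N (ltn0Sn n); under eq_bigr => j _ do rewrite subn0.
  by rewrite subn0 => ->.
by apply: eq_big_nat => k /andP[_ kn]; rewrite col.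
Qed.

(** The two entries of the test vector are balanced so that the first row of the matrix gives
    exactly a_n. *)
Lemma rogosinski_step a n : contractive a -> (0 < n)%N ->
  normc (a n) ^+ 2 * (1 - normc (a 0%N) ^+ 2) <=
    (1 - normc (a 0%N) ^+ 2) ^+ 2 * (1 - \sum_(0 <= j < n) normc (a j) ^+ 2).
Proof.
move=> ca n0; set A2 := normc (a 0%N) ^+ 2.
have A21 : A2 <= 1 by have := sum_sqr_le1 0 ca; rewrite big_nat1.
pose y j := if j == n then ((1 - A2)%:C)%C else if j == 0%N then ((a 0%N)^*)%C * a n else 0.
have yn : y n = ((1 - A2)%:C)%C by rewrite /y eqxx.
have y00 : y 0%N = ((a 0%N)^*)%C * a n by rewrite /y eq_sym gtn_eqF.
have y0 j : (0 < j < n)%N -> y j = 0.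
  by case/andP=> j0 jn; rewrite /y ltn_eqF // gtn_eqF.
have := contractive_column n y ca.
have split0 (V : zmodType) (F : nat -> V) : (forall j, (0 < j < n)%N -> F j = 0) ->
    \sum_(0 <= j < n.+1) F j = F 0%N + F n.
  move=> F0; rewrite big_nat_recr //= big_ltn // big1_seq ?addr0 // => j /andP[_].
  by rewrite mem_index_iota => /F0.
rewrite split0 => [|j /y0 ->]; last by rewrite mulr0.
rewrite [X in _ <= X -> _]split0 => [|j /y0 ->]; last by rewrite normc0 expr0n.
have -> : a 0%N * y 0%N + a n * y n = a n.
  by rewrite y00 yn mulrA mul_conj -/A2 [_ * a n]mulrC -mulrDr -rmorphD /= addrC subrK rmorph1 mulr1.
have -> : \sum_(1 <= k < n.+1) normc (\sum_(k <= j < n.+1) a (j - k)%N * y j) ^+ 2 =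
    (1 - A2) ^+ 2 * \sum_(0 <= j < n) normc (a j) ^+ 2.
  rewrite -{1}(add0n 1%N) big_addn subn1 /= [in RHS]big_nat_rev /= add0n mulr_sumr.
  apply: eq_big_nat => i /andP[_ im].
  rewrite big_nat_recr ?big1_seq /=.
  - have -> : (n - (i + 1) = n - i.+1)%N by lia.
    by rewrite add0r yn normcM normc_real ger0_norm ?subr_ge0 // exprMn mulrC.
  - move=> j; rewrite mem_index_iota => /andP[h1 h2].
    by rewrite y0 ?mulr0 // h2 andbT; lia.
  - lia.
rewrite y00 yn normcM normc_conj normc_real ger0_norm ?subr_ge0 // exprMn -/A2.
by set S := \sum_(0 <= j < n) _; nra.
Qed.
End Coefficients.

(** * Weighted sums of the coefficients *)

Section Sums.
Variable R : realType.
Implicit Types (a : nat -> Cplx R) (z w : Cplx R) (r e : R).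

(** Each step adds the two Carlson bounds for the coefficients of index 2K+2 and 2K+3. With
    Q K the defect 1 - |a_0|^2 - ... - |a_K|^2, subtracting the geometric tail of Q K makes
    the induction step an identity. *)
Lemma bohr_partial_sums a r K : contractive a -> 0 <= r < 1 ->
  \sum_(2 <= n < K.+1.*2) normc (a n) * r ^+ n +
  (1 / (1 + normc (a 0%N)) + r / (1 - r)) *
    \sum_(1 <= j < K.+1) normc (a j) ^+ 2 * r ^+ (2 * j) <=
  (1 - normc (a 0%N) ^+ 2) * r ^+ 2 / (1 - r).
Proof.
move=> ca /andP[r0 r1]; set A := normc (a 0%N).
have A0 : 0 <= A by exact: normc_ge0.
have r1' : 0 < 1 - r by lra.
pose q := (1 - r)^-1; have qE : q * (1 - r) = 1 by rewrite mulVf // gt_eqF.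
have q0 : 0 < q by rewrite invr_gt0.
pose t := (1 + A)^-1.
rewrite mul1r -/q -/t.
pose Q K := 1 - A ^+ 2 - \sum_(1 <= j < K.+1) normc (a j) ^+ 2.
have QE k : Q k = 1 - \sum_(0 <= j < k.+1) normc (a j) ^+ 2.
  by rewrite /Q [in RHS]big_ltn // -/A; ring.
have Q0 k : 0 <= Q k by rewrite QE subr_ge0 sum_sqr_le1.
suff : \sum_(2 <= n < K.+1.*2) normc (a n) * r ^+ n +
  (t + r * q) * \sum_(1 <= j < K.+1) normc (a j) ^+ 2 * r ^+ (2 * j) <=
  (1 - A ^+ 2) * r ^+ 2 * q - Q K * r ^+ (K.+1.*2) * q.
  have : 0 <= Q K * r ^+ (K.+1.*2) * q.
    by apply: mulr_ge0; [apply: mulr_ge0; [exact: Q0|exact: exprn_ge0]|exact: ltW].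
  lra.
elim: K => [|K IH].
  rewrite /Q !big_geq //; rewrite (_ : 1.*2 = 2)%N //; lra.
have -> : K.+2.*2 = K.+1.*2.+2 by lia.
have m2 : (2 <= K.+1.*2)%N by lia.
rewrite 2?[\sum_(2 <= n < _.+1) _]big_nat_recr ?(leqW m2) //= [\sum_(1 <= j < K.+2) _]big_nat_recr //=.
have odd := carlson_odd ca (ltn0Sn K); have even := carlson_even ca (ltn0Sn K).
rewrite -QE in odd; rewrite -QE -/A -/t in even.
have QS : Q K.+1 = Q K - normc (a K.+1) ^+ 2.
  by rewrite /Q [in LHS]big_nat_recr //=; ring.
rewrite QS in odd *.
have -> : (2 * K.+1)%N = K.+1.*2 by lia.
set X := r ^+ (K.+1.*2) in IH *; have X0 : 0 <= X by exact: exprn_ge0.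
rewrite !(exprS r K.+1.*2.+1) !(exprS r K.+1.*2) -/X; set p := normc (a K.+1) ^+ 2 in odd even *.
have h1 := ler_wpM2r X0 even; have h2 := ler_wpM2r (mulr_ge0 r0 X0) odd.
set U := \sum_(2 <= n < _) _ in IH *; set V := \sum_(1 <= j < _) _ in IH *.
apply: le_trans (_ : U + (t + r * q) * V + (Q K - p * t) * X + (Q K - p) * (r * X)
  + (t + r * q) * (p * X) <= _).
  by lra.
apply: le_trans (_ : (1 - A ^+ 2) * r ^+ 2 * q - Q K * X * q
  + (Q K - p * t) * X + (Q K - p) * (r * X) + (t + r * q) * (p * X) <= _).
  by rewrite !lerD2r; apply: le_trans IH _.
rewrite -subr_ge0; set D := _ - _.
have -> : D = X * ((Q K - p) * (1 + r) + p) * (q * (1 - r) - 1) by rewrite /D; ring.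
by rewrite qE subrr mulr0.
Qed.

(** The right side is the value for the Moebius function with the same a_0. *)
Lemma rogosinski a n : contractive a ->
  \sum_(1 <= j < n.+1) normc (a j) ^+ 2 <=
    (1 - normc (a 0%N) ^+ 2) * (1 - normc (a 0%N) ^+ 2 ^+ n).
Proof.
move=> ca; set A2 := normc (a 0%N) ^+ 2; have A20 : 0 <= A2 by exact: sqr_ge0.
have VE k : \sum_(0 <= j < k.+1) normc (a j) ^+ 2 = A2 + \sum_(1 <= j < k.+1) normc (a j) ^+ 2.
  by rewrite big_ltn.
have A21 : A2 <= 1 by have := sum_sqr_le1 0 ca; rewrite big_nat1.
elim: n => [|n IH]; first by rewrite big_geq // expr0 subrr mulr0.
rewrite big_nat_recr //=; set V := \sum_(1 <= j < _) _ in IH *.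
have := rogosinski_step ca (ltn0Sn n); rewrite VE -/A2 -/V.
set x := normc (a n.+1) ^+ 2 => step.
have [A2lt|A2ge] := ltP A2 1.
  have d0 : 0 < 1 - A2 by lra.
  have : x <= (1 - A2) * (1 - A2 - V).
    by rewrite -(ler_pM2r d0); lra.
  have := ler_wpM2l A20 IH; rewrite exprS; lra.
have := sum_sqr_le1 n.+1 ca; rewrite VE big_nat_recr //= -/V -/x.
have -> : A2 = 1 by lra.
rewrite expr1n; lra.
Qed.

Lemma abel_sum_ge0 (c d : nat -> R) n : (forall i, c i.+1 <= c i) -> (forall i, 0 <= c i) ->
  (forall n, 0 <= \sum_(0 <= i < n) d i) -> 0 <= \sum_(0 <= i < n) c i * d i.
Proof.
move=> cS c0 D0; case: n => [|n]; first by rewrite big_geq.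
apply: le_trans (_ : c n * (\sum_(0 <= i < n.+1) d i) <= _); first by rewrite mulr_ge0.
elim: n => [|n IH]; first by rewrite !big_nat1.
rewrite big_nat_recr // [X in _ <= X]big_nat_recr //= mulrDr lerD2r.
by apply: le_trans IH; rewrite ler_wpM2r.
Qed.

Lemma sum_derived_geometricE (x : R) n :
  (\sum_(0 <= i < n) i.+1%:R * x ^+ i) * (1 - x) ^+ 2 =
    1 - n.+1%:R * x ^+ n + n%:R * x ^+ n.+1.
Proof.
elim: n => [|n IH]; first by rewrite big_geq // mul0r expr0 mulr1 mul0r subrr addr0.
by rewrite big_nat_recr //= mulrDl IH -!(natr1 n.+1) -!(natr1 n) !exprS; ring.
Qed.

Lemma sum_derived_geometric_le (x : R) n : 0 <= x < 1 ->
  \sum_(0 <= i < n) i.+1%:R * x ^+ i <= 1 / (1 - x) ^+ 2.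
Proof.
move=> /andP[x0 x1]; rewrite ler_pdivlMr ?exprn_gt0 ?subr_gt0 // sum_derived_geometricE.
have : n%:R * x ^+ n.+1 <= n.+1%:R * x ^+ n.
  rewrite exprS mulrA ler_wpM2r ?exprn_ge0 // -natr1.
  have : n%:R * x <= n%:R by rewrite ler_piMr // ltW.
  lra.
lra.
Qed.

(** For r^2 <= 1/2 the weights n r^(2n) decrease, so by Abel summation the comparison of
    partial sums in rogosinski carries over to the weighted sums. *)
Lemma area_partial_sums a r N : contractive a -> 0 <= r -> r ^+ 2 <= 1 / 2 ->
  \sum_(1 <= n < N) n%:R * normc (a n) ^+ 2 * r ^+ (2 * n) <=
  r ^+ 2 * (1 - normc (a 0%N) ^+ 2) ^+ 2 / (1 - normc (a 0%N) ^+ 2 * r ^+ 2) ^+ 2.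
Proof.
move=> ca r0 r2; set A2 := normc (a 0%N) ^+ 2.
have A21 : A2 <= 1 by have := sum_sqr_le1 0 ca; rewrite big_nat1.
have A20 : 0 <= A2 by exact: sqr_ge0.
have r20 : 0 <= r ^+ 2 by exact: sqr_ge0.
case: N => [|N].
  by rewrite big_geq //; apply: divr_ge0; [apply: mulr_ge0|]; exact: sqr_ge0.
pose c i := i.+1%:R * r ^+ 2 ^+ i.+1; pose v i := normc (a i.+1) ^+ 2.
pose w i := (1 - A2) ^+ 2 * A2 ^+ i.
have -> : \sum_(1 <= n < N.+1) n%:R * normc (a n) ^+ 2 * r ^+ (2 * n) = \sum_(0 <= i < N) c i * v i.
  rewrite big_add1 /=; apply: eq_bigr => i _; rewrite /c /v exprM; ring.
apply: le_trans (_ : \sum_(0 <= i < N) c i * w i <= _).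
  rewrite -subr_ge0 -sumrB; under eq_bigr => i _ do rewrite -mulrBr.
  apply: abel_sum_ge0 => [i|i|n].
  - rewrite /c exprS mulrA ler_wpM2r ?exprn_ge0 //.
    have h : i.+2%:R * r ^+ 2 <= i.+2%:R * (1 / 2) by rewrite ler_wpM2l.
    apply: le_trans h _; rewrite -(natr1 i.+1) -(natr1 i).
    have : 0 <= i%:R :> R by []. lra.
  - by rewrite mulr_ge0 ?exprn_ge0.
  rewrite sumrB subr_ge0; have -> : \sum_(0 <= i < n) v i = \sum_(1 <= j < n.+1) normc (a j) ^+ 2.
    by rewrite [RHS]big_add1.
  apply: le_trans (rogosinski n ca) _; rewrite -/A2 /w -mulr_sumr expr2 -mulrA.
  by rewrite ler_wpM2l ?subr_ge0 // big_mkord -opprB subrX1 -mulNr opprB.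
have -> : \sum_(0 <= i < N) c i * w i =
    r ^+ 2 * (1 - A2) ^+ 2 * \sum_(0 <= i < N) i.+1%:R * (A2 * r ^+ 2) ^+ i.
  rewrite mulr_sumr; apply: eq_bigr => i _; rewrite /c /w [(A2 * _) ^+ i]exprMn [r ^+ 2 ^+ i.+1]exprS; ring.
have xlt : 0 <= A2 * r ^+ 2 < 1.
  rewrite mulr_ge0 //=; apply: le_lt_trans (_ : 1 * r ^+ 2 < _); last lra.
  by rewrite ler_wpM2r.
have w0 : 0 <= r ^+ 2 * (1 - A2) ^+ 2 by apply: mulr_ge0; exact: sqr_ge0.
by apply: le_trans (ler_wpM2l w0 (sum_derived_geometric_le N xlt)) _; rewrite mul1r.
Qed.
End Sums.

Section Limits.
Variable R : realType.
Implicit Types (a : nat -> Cplx R) (z w : Cplx R) (r e : R).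

Lemma coef_le1 a n : contractive a -> normc (a n) <= 1.
Proof.
move=> ca; rewrite -(@expr_le1 _ 2) ?normc_ge0 //.
apply: le_trans (sum_sqr_le1 n ca); rewrite big_nat_recr //= lerDr.
by apply: sumr_ge0 => i _; exact: sqr_ge0.
Qed.

Lemma sum_nonneg_cvg (u : nat -> R) m K : (forall n, 0 <= u n) ->
  (forall N, \sum_(m <= n < N) u n <= K) -> cvgn (fun N => \sum_(m <= n < N) u n).
Proof.
move=> u0 uK; apply: nondecreasing_is_cvgn; last by exists K => _ [N _ <-].
apply/nondecreasing_seqP => n; have [mn|nm] := leqP m n.
  by rewrite big_nat_recr //= lerDl.
by rewrite !big_geq // ltnW.
Qed.

Lemma limn_le_bound (u : nat -> R) K : cvgn u -> (forall n, u n <= K) -> limn u <= K.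
Proof. by move=> cu uK; apply: limr_le => //; near=> n. Unshelve. all: by end_near. Qed.

Lemma B2_A0_le a r : contractive a -> 0 <= r < 1 ->
  B2 a r + A0 a r <= (1 - normc (a 0%N) ^+ 2) * r ^+ 2 / (1 - r).
Proof.
move=> ca r01; have /andP[r0 r1] := r01; set A := normc (a 0%N).
have rX n : 0 <= r ^+ n by exact: exprn_ge0.
have r1' : 0 < 1 - r by lra.
have geo m N : \sum_(m <= n < N) r ^+ n <= 1 / (1 - r).
  apply: le_trans (geometric_sum_le _ _ r01) _.
  by rewrite ler_wpM2r ?invr_ge0 ?(ltW r1') // exprn_ile1 // ltW.
have cu : cvgn (fun N => \sum_(2 <= n < N) normc (a n) * r ^+ n).
  apply: (@sum_nonneg_cvg _ _ (1 / (1 - r))) => [n|N]; first by rewrite mulr_ge0 ?normc_ge0.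
  by apply: le_trans (geo 2 N); apply: ler_sum => n _; rewrite ler_piMl // coef_le1.
have cv : cvgn (fun N => \sum_(1 <= n < N) normc (a n) ^+ 2 * r ^+ (2 * n)).
  apply: (@sum_nonneg_cvg _ _ (1 / (1 - r))) => [n|N]; first by rewrite mulr_ge0 ?sqr_ge0.
  apply: le_trans (geo 1%N N); apply: ler_sum => n _.
  apply: le_trans (_ : 1 * r ^+ (2 * n) <= _).
    by rewrite ler_wpM2r // exprn_ile1 ?normc_ge0 // coef_le1.
  by rewrite mul1r ler_wiXn2l // ?(ltW r1) // mul2n -addnn leq_addr.
rewrite /A0 /B2 /norm0_sqr -/A; set c := 1 / (1 + A) + r / (1 - r).
have c0 : 0 <= c.
  have A0 : 0 <= A by exact: normc_ge0.
  by rewrite /c; apply: addr_ge0; apply: divr_ge0 => //; lra.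
set u := (fun N => \sum_(2 <= n < N) _) in cu *; set v := (fun N => \sum_(1 <= n < N) _) in cv *.
have -> : limn u + c * limn v = limn (fun N => u N + c * v N).
  by apply/esym/cvg_lim => //; apply: cvgD => //; apply: cvgMr.
apply: limn_le_bound => [|N].
  by apply: is_cvgD; [exact: cu|apply: is_cvgMr; exact: cv].
apply: le_trans (bohr_partial_sums N ca r01); rewrite -/c lerD //.
  have h : (N <= N.+1.*2)%N by lia.
  have [N2|N2] := leqP 2 N; last first.
    by rewrite /u big_geq ?(ltnW N2) // sumr_ge0 // => i _; rewrite mulr_ge0 ?normc_ge0.
  rewrite /u (@big_cat_nat _ _ _ N 2 N.+1.*2) //= lerDl.
  by rewrite sumr_ge0 // => i _; rewrite mulr_ge0 ?normc_ge0.
rewrite ler_wpM2l // /v; case: N => [|N]; first by rewrite !big_geq.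
by rewrite [leRHS]big_nat_recr //= lerDl mulr_ge0 ?sqr_ge0.
Qed.
End Limits.

(** * Derivatives of power series *)

Section Estimates.
Variable R : realType.
Implicit Types (f : Cplx R -> Cplx R) (a : nat -> Cplx R) (z w : Cplx R) (r e : R).

Lemma normc_le_ReIm z : normc z <= `|complex.Re z| + `|complex.Im z|.
Proof.
case: z => x y /=; rewrite -(ler_sqr (sqrtr_ge0 _)) ?nnegrE ?addr_ge0 //.
rewrite sqr_sqrtr ?addr_ge0 ?sqr_ge0 // sqrrD !real_normK ?num_real //.
by rewrite lerD2r lerDl mulrn_wge0 // mulr_ge0.
Qed.

Lemma Re_le_normc z : `|complex.Re z| <= normc z.
Proof. by case: z => x y /=; rewrite -sqrtr_sqr ler_wsqrtr // lerDl sqr_ge0. Qed.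

Lemma Im_le_normc z : `|complex.Im z| <= normc z.
Proof. by case: z => x y /=; rewrite -sqrtr_sqr ler_wsqrtr // lerDr sqr_ge0. Qed.

(** Absolute convergence, obtained from the real and imaginary parts. *)
Lemma summable_complex_series (u : nat -> Cplx R) K :
  (forall N, \sum_(0 <= n < N) normc (u n) <= K) -> exists l : Cplx R, series u @ \oo --> l.
Proof.
move=> uK.
have abs_cvg (v : nat -> R) : (forall n, `|v n| <= normc (u n)) -> cvgn (series v).
  move=> vu; apply: normed_cvg; apply: (@sum_nonneg_cvg _ _ 0 K) => [n|N]; first exact: normr_ge0.
  by apply: le_trans (uK N); apply: ler_sum => n _; exact: vu.
have /cvg_ex[x xP] := abs_cvg _ (fun n => Re_le_normc (u n)).
have /cvg_ex[y yP] := abs_cvg _ (fun n => Im_le_normc (u n)).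
exists (x +i* y)%C; apply/cvg_normcP => e e0; have e2 : 0 < e / 2 by lra.
move/cvgrPdist_lt : xP => /(_ _ e2)[N1 _ N1P]; move/cvgrPdist_lt : yP => /(_ _ e2)[N2 _ N2P].
exists (maxn N1 N2) => n; rewrite geq_max => /andP[/N1P /= h1 /N2P /= h2].
apply: le_lt_trans (normc_le_ReIm _) _.
have -> : series u n = (series (fun n => complex.Re (u n)) n +i* series (fun n => complex.Im (u n)) n)%C.
  rewrite /series /=; elim: n {h1 h2} => [|n IH]; first by rewrite !big_geq.
  by rewrite !big_nat_recr //= IH; case: (u n).
by move: h1 h2; rewrite /series /=; lra.
Qed.

Lemma normc_limit_le (u : nat -> Cplx R) z K : u @ \oo --> z ->
  (forall n, normc (u n) <= K) -> normc z <= K.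
Proof.
move=> /cvg_normc uz uK; have <- := cvg_lim (@Rhausdorff R) uz.
by apply: limn_le_bound => //; apply/cvg_ex; eexists; exact: uz.
Qed.

(** By Bernoulli (n + 1)^2 is at most (1 + d)^(2n) / d^2, and d is small enough for
    (1 + d)^2 r to be less than 1. *)
Lemma square_geometric_bound r : 0 <= r < 1 ->
  exists K, forall N, \sum_(0 <= n < N) n.+1%:R ^+ 2 * r ^+ n <= K.
Proof.
move=> /andP[r0 r1]; pose d := (1 - r) / 3; have d0 : 0 < d by rewrite /d; lra.
have d1 : d <= 1 / 3 by rewrite /d; lra.
have rE : r = 1 - 3 * d by rewrite /d; lra.
pose q := (1 + d) ^+ 2 * r.
have q01 : 0 <= q < 1.
  rewrite /q mulr_ge0 ?sqr_ge0 //= rE.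
  have : 0 <= d ^+ 3 by rewrite exprn_ge0 // ltW.
  have : 0 <= d ^+ 2 by exact: sqr_ge0.
  lra.
have bern n : d * n.+1%:R <= (1 + d) ^+ n.
  elim: n => [|n IH]; first by rewrite mulr1 expr0; lra.
  rewrite exprS -natr1; have h : 1 <= (1 + d) ^+ n by rewrite exprn_ege1 //; lra.
  have : d * 1 <= d * (1 + d) ^+ n by rewrite ler_wpM2l // ltW.
  lra.
exists (1 / (1 - q) / d ^+ 2) => N; rewrite ler_pdivlMr ?exprn_gt0 // mulr_suml.
apply: le_trans (_ : \sum_(0 <= n < N) q ^+ n <= _); last first.
  by apply: le_trans (geometric_sum_le 0 N q01) _; rewrite expr0.
apply: ler_sum => n _; rewrite /q [((1 + d) ^+ 2 * r) ^+ n]exprMn -exprM mulnC exprM.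
have -> : n.+1%:R ^+ 2 * r ^+ n * d ^+ 2 = (d * n.+1%:R) ^+ 2 * r ^+ n by ring.
rewrite ler_wpM2r ?exprn_ge0 // lerXn2r ?nnegrE ?bern //; first by rewrite mulr_ge0 // ltW.
by rewrite exprn_ge0 //; lra.
Qed.

Lemma normc_nat n : normc (n%:R : Cplx R) = n%:R.
Proof. by rewrite -(normr_nat R n) -normc_real rmorph_nat. Qed.

(** The factor r^2 replaces the exponent n - 2 of the usual estimate, which would be truncated
    for n < 2. *)
Lemma power_taylor (z w : Cplx R) r n : 0 <= r -> normc z <= r -> normc w <= r ->
  normc (w ^+ n - z ^+ n - (w - z) * (n%:R * z ^+ n.-1)) * r ^+ 2 <=
    normc (w - z) ^+ 2 * (n%:R ^+ 2 * r ^+ n).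
Proof.
move=> r0 zr wr; set h := w - z; have zX k : normc (z ^+ k) <= r ^+ k.
  by rewrite normcX lerXn2r ?nnegrE ?normc_ge0.
elim: n => [|n IH].
  by rewrite !expr0 subrr mul0r mulr0 subr0 normc0 mul0r expr0n mul0r mulr0.
have -> : w ^+ n.+1 - z ^+ n.+1 - h * (n.+1%:R * z ^+ n.+1.-1) =
    w * (w ^+ n - z ^+ n - h * (n%:R * z ^+ n.-1)) + h ^+ 2 * (n%:R * z ^+ n.-1).
  case: n {IH} => [|n]; first by rewrite /h /=; ring.
  by rewrite /h /= !exprS -natr1; ring.
set D := w ^+ n - _ - _ in IH *.
have p1 : normc (w * D) * r ^+ 2 <= normc h ^+ 2 * (n%:R ^+ 2 * r ^+ n.+1).
  rewrite normcM -mulrA; apply: le_trans (ler_wpM2r _ wr) _.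
    by rewrite mulr_ge0 ?normc_ge0 ?sqr_ge0.
  by apply: le_trans (ler_wpM2l r0 IH) _; rewrite [r ^+ n.+1]exprS; lra.
have p2 : normc (h ^+ 2 * (n%:R * z ^+ n.-1)) * r ^+ 2 <= normc h ^+ 2 * (n%:R * r ^+ n.+1).
  rewrite normcM normcX -mulrA; apply: ler_wpM2l; first exact: sqr_ge0.
  rewrite normcM normc_nat; case: n {IH D p1} => [|n] /=; first by rewrite !mul0r.
  rewrite -mulrA ler_wpM2l // -[n.+2]addn2 exprD.
  by rewrite ler_wpM2r ?sqr_ge0 ?zX.
apply: le_trans (ler_wpM2r (sqr_ge0 r) (le_normcD _ _)) _; rewrite mulrDl.
apply: le_trans (lerD p1 p2) _; rewrite -mulrDr ler_wpM2l ?sqr_ge0 // -mulrDl ler_wpM2r ?exprn_ge0 //.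
by rewrite -natr1; have : 0 <= n%:R :> R by []; nra.
Qed.
End Estimates.

Section PowerSeriesDerivative.
Variable R : realType.
Implicit Types (f : Cplx R -> Cplx R) (a : nat -> Cplx R) (z w d : Cplx R) (r e : R).

(** Summing power_taylor gives a quadratic remainder, which identifies the derivative; the
    coefficients are bounded by 1, so the sum of n^2 r^n with r between |z| and 1 bounds the
    constant. *)
Lemma power_series_taylor f a z : power_series_on_disc f a ->
    (forall n, normc (a n) <= 1) -> normc z < 1 ->
  exists d, exists2 K : R, 0 <= K & [/\ series (fun n => a n * (n%:R * z ^+ n.-1)) @ \oo --> d,
    derive1 f z = d &
    forall w, normc (w - z) < (1 - normc z) / 2 ->
      normc (f w - f z - (w - z) * d) <= K * normc (w - z) ^+ 2].
Proof.
move=> fa a1 z1; have z0 := normc_ge0 z; pose r := (1 + normc z) / 2.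
have r0 : 0 < r by rewrite /r; lra.
have r1 : r < 1 by rewrite /r; lra.
have zr : normc z <= r by rewrite /r; lra.
have [|K KP] := @square_geometric_bound _ r; first by lra.
have zX n : normc (z ^+ n) <= r ^+ n.
  by rewrite normcX lerXn2r ?nnegrE ?normc_ge0 ?(ltW r0).
have [|d dP] := @summable_complex_series _ (fun n => a n * (n%:R * z ^+ n.-1)) K.
  case=> [|N]; first by apply: le_trans (KP 0%N); rewrite !big_geq.
  rewrite big_ltn // mul0r mulr0 normc0 add0r big_add1 /=; apply: le_trans (KP N).
  apply: ler_sum => n _; rewrite !normcM normc_nat.
  apply: le_trans (_ : 1 * (n.+1%:R * r ^+ n) <= _).
    by apply: ler_pM; rewrite ?mulr_ge0 ?normc_ge0 ?a1 // ler_wpM2l.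
  by rewrite mul1r ler_wpM2r ?exprn_ge0 ?(ltW r0) // expr2 ler_peMl // ler1n.
have K0 : 0 <= K by apply: le_trans (KP 0%N); rewrite big_geq.
have r2 : 0 < r ^+ 2 by rewrite exprn_gt0.
have est w : normc (w - z) < (1 - normc z) / 2 ->
      normc (f w - f z - (w - z) * d) <= K / r ^+ 2 * normc (w - z) ^+ 2.
  move=> wz; have wr : normc w <= r.
    by have := le_normcD (w - z) z; rewrite subrK /r; lra.
  rewrite mulrAC ler_pdivlMr //.
  have rN : r ^+ 2 = normc (((r ^+ 2)%:C)%C : Cplx R) by rewrite normc_real ger0_norm // ltW.
  rewrite rN -normcM; pose T (n : nat) := a n * (w ^+ n - z ^+ n - (w - z) * (n%:R * z ^+ n.-1)).
  have cT : (fun N => series T N * ((r ^+ 2)%:C)%C) @ \oo --> (f w - f z - (w - z) * d) * ((r ^+ 2)%:C)%C.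
    have -> : series T = (fun N => series (fun n => a n * w ^+ n) N - series (fun n => a n * z ^+ n) N
        - (w - z) * series (fun n => a n * (n%:R * z ^+ n.-1)) N).
      apply/funext => N; rewrite /series /= mulr_sumr -!sumrB; apply: eq_bigr => n _; rewrite /T; ring.
    apply: cvgMl; apply: cvgB; last exact: cvgMr.
    by apply: cvgB; apply: fa => //; exact: le_lt_trans r1.
  apply: normc_limit_le cT _ => N; rewrite normcM -rN /series /=.
  apply: le_trans (ler_wpM2r (ltW r2) (normc_sum _ _ _)) _; rewrite mulr_suml.
  apply: le_trans (_ : \sum_(0 <= n < N) normc (w - z) ^+ 2 * (n.+1%:R ^+ 2 * r ^+ n) <= _).
    apply: ler_sum => n _; rewrite /T normcM -mulrA.
    apply: le_trans (ler_piMl _ (a1 n)) _; first by rewrite mulr_ge0 ?normc_ge0 // ltW.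
    apply: le_trans (power_taylor n (ltW r0) zr wr) _.
    rewrite ler_wpM2l ?sqr_ge0 // ler_wpM2r ?exprn_ge0 ?(ltW r0) //.
    by rewrite lerXn2r ?nnegrE // ler_nat.
  by rewrite -mulr_sumr mulrC ler_wpM2r ?sqr_ge0.
exists d; exists (K / r ^+ 2); first by rewrite divr_ge0 // ltW.
split=> //; apply: cvg_lim => //; apply/cvgrPdist_lt => e e0.
have /complex_realP[e' ee] := gtr0_real e0; rewrite {e}ee (ltcR 0) in e0 *.
pose K1 := K / r ^+ 2 + 1; have K10 : 0 < K1 by rewrite ltr_wpDl // divr_ge0 // ltW.
have d0 : 0 < ((e' / K1)%:C)%C :> Cplx R by rewrite (ltcR 0) divr_gt0.
have d1 : 0 < (((1 - normc z) / 2)%:C)%C :> Cplx R by rewrite (ltcR 0); lra.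
near=> h.
have h0 : h != 0 by near: h; exact: nbhs_dnbhs_neq.
have : `|h| < ((e' / K1)%:C)%C by near: h; exact: dnbhs0_lt.
have : `|h| < (((1 - normc z) / 2)%:C)%C by near: h; exact: dnbhs0_lt.
rewrite !normc_E !ltcR => h1 h2.
have hz : h + z - z = h by rewrite addrK.
have := est (h + z); rewrite hz => /(_ h1) E.
have nh : 0 < normc h by rewrite lt_def normc_ge0 normc_eq0 h0.
rewrite /GRing.scale /= -(ltr_pM2r nh) -normcM.
have -> : (d - h^-1 * (f (h + z) - f z)) * h = - (f (h + z) - f z - h * d).
  by rewrite mulrBl mulrAC mulVf // mul1r opprB; ring.
rewrite normcN; apply: le_lt_trans E _; rewrite expr2 mulrA ltr_pM2r //.
move: h2; rewrite ltr_pdivlMr // /K1; nra.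
Unshelve. all: by end_near.
Qed.
End PowerSeriesDerivative.

(** * The Schwarz-Pick inequalities *)

Section SzegoKernels.
Variable R : realType.
Implicit Types (f : Cplx R -> Cplx R) (a : nat -> Cplx R) (z w d : Cplx R) (r e : R).

Lemma cvg_Re (u : nat -> Cplx R) z : u @ \oo --> z ->
  (fun n => complex.Re (u n)) @ \oo --> complex.Re z.
Proof.
move=> /cvg_normcP uz; apply/cvgrPdist_lt => e e0.
have [N NP] := uz e e0; exists N => // n Nn /=; apply: le_lt_trans (NP n Nn).
by apply: le_trans (Re_le_normc _); case: (z) (u n) => x y [x' y'].
Qed.

Lemma cvg_geometric_complex (x : Cplx R) : normc x < 1 ->
  series (fun n => x ^+ n) @ \oo --> (1 - x)^-1.
Proof.
move=> x1; have x0 : 1 - x != 0.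
  by rewrite subr_eq0; apply: contraTneq x1 => <-; rewrite normc1 ltxx.
have -> : series (fun n => x ^+ n) = (fun n => (1 - x ^+ n) * (1 - x)^-1).
  apply/funext => n; rewrite /series /= big_mkord -(opprB (x ^+ n)) subrX1.
  by rewrite -mulNr opprB mulrAC mulfV // mul1r.
suff : (fun n => (1 - x ^+ n) * (1 - x)^-1) @ \oo --> (1 - 0) * (1 - x)^-1.
  by rewrite subr0 mul1r.
apply: cvgMl; apply: cvgB; first exact: cvg_cst.
apply/cvg_normcP => e e0; have [|m mP] := @expr_small _ (normc x) e _ e0; first by rewrite normc_ge0.
exists m => n mn; rewrite sub0r normcN normcX; apply: le_lt_trans mP.
by rewrite ler_wiXn2l ?normc_ge0 // ltW.
Qed.

(** The squared norm of al k_z + be k_w, where k_z is the sequence of the powers of z (a Szego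
    kernel). *)
Definition szego_form (al be z w : Cplx R) : R :=
  normc al ^+ 2 / (1 - normc z ^+ 2) + normc be ^+ 2 / (1 - normc w ^+ 2) +
  2 * complex.Re (al * (be^*)%C / (1 - z * (w^*)%C)).

Lemma szego_form_cvg al be z w : normc z < 1 -> normc w < 1 ->
  (fun N => \sum_(0 <= n < N) normc (al * z ^+ n + be * w ^+ n) ^+ 2) @ \oo -->
  szego_form al be z w.
Proof.
move=> z1 w1.
have sqr_geo u (x : Cplx R) : normc x < 1 ->
    (fun N => \sum_(0 <= n < N) normc (u * x ^+ n) ^+ 2) @ \oo --> normc u ^+ 2 / (1 - normc x ^+ 2).
  move=> x1; have -> : (fun N => \sum_(0 <= n < N) normc (u * x ^+ n) ^+ 2) =
      series (geometric (normc u ^+ 2) (normc x ^+ 2)).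
    by apply/funext => N; apply: eq_bigr => n _; rewrite /= normcM normcX exprMn exprAC.
  apply: cvg_geometric_series; rewrite ger0_norm ?sqr_ge0 //.
  by rewrite expr_lt1 ?normc_ge0.
have -> : (fun N => \sum_(0 <= n < N) normc (al * z ^+ n + be * w ^+ n) ^+ 2) =
   (fun N => \sum_(0 <= n < N) normc (al * z ^+ n) ^+ 2 + \sum_(0 <= n < N) normc (be * w ^+ n) ^+ 2
     + 2 * complex.Re (al * (be^*)%C * series (fun n => (z * (w^*)%C) ^+ n) N)).
  apply/funext => N; have -> : complex.Re (al * (be^*)%C * series (fun n => (z * (w^*)%C) ^+ n) N) =
      \sum_(0 <= n < N) complex.Re (al * z ^+ n * ((be * w ^+ n)^*)%C).
    rewrite /series /= mulr_sumr (raddf_sum (@complex.Re R)) //; apply: eq_bigr => n _.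
    by rewrite rmorphM rmorphXn /= exprMn mulrACA.
  rewrite mulr_sumr -!big_split /=; apply: eq_bigr => n _; exact: normc_Re_conj.
apply: cvgD; first by apply: cvgD; exact: sqr_geo.
apply: cvgMr; apply: cvg_Re; apply: cvgMr; apply: cvg_geometric_complex.
by rewrite normcM normc_conj; have := normc_ge0 z; have := normc_ge0 w; nra.
Qed.

(** Up to a tail, the matrix of [a] maps the powers of z to f z times the powers of z: the
    powers of z are an eigenvector of the infinite matrix, with eigenvalue f z. *)
Lemma szego_form_contraction f a al be z w : power_series_on_disc f a -> contractive a ->
  normc z < 1 -> normc w < 1 ->
  szego_form (al * f z) (be * f w) z w <= szego_form al be z w.
Proof.
move=> fa ca z1 w1.
have lim1 := @szego_form_cvg (al * f z) (be * f w) _ _ z1 w1.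
have lim2 := @szego_form_cvg al be _ _ z1 w1.
rewrite -(cvg_lim (@Rhausdorff R) lim1); apply: limn_le_bound => [|K].
  by apply/cvg_ex; eexists; exact: lim1.
pose T z N := series (fun n => a n * z ^+ n) N.
have TE x k N : (k <= N)%N ->
    \sum_(n < N | (k <= n)%N) a (n - k)%N * x ^+ n = x ^+ k * T x (N - k)%N.
  move=> kN; rewrite -(big_geq_mkord _ _ xpredT (fun n => a (n - k)%N * x ^+ n)).
  rewrite -{1}(add0n k) big_addn /T /series /= mulr_sumr; apply: eq_bigr => i _.
  by rewrite addnK exprD; ring.
pose g N k := normc (al * (z ^+ k * T z (N - k)%N) + be * (w ^+ k * T w (N - k)%N)) ^+ 2.
have limK : (fun N => \sum_(0 <= k < K) g N k)
    @ \oo --> \sum_(0 <= k < K) normc (al * f z * z ^+ k + be * f w * w ^+ k) ^+ 2.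
  have lim_shift x k : normc x < 1 -> (fun N => T x (N - k)%N) @ \oo --> f x.
    by move=> /fa /cvg_normcP fx; apply/cvg_normcP => e /fx[N NP]; exists (N + k)%N => n ?; apply: NP; lia.
  elim: K => [|K IH].
    rewrite big_geq //; have -> : (fun N => \sum_(0 <= k < 0) g N k) = cst 0.
      by apply/funext => N; rewrite big_geq.
    exact: cvg_cst.
  rewrite big_nat_recr //=.
  under eq_fun => N do rewrite big_nat_recr //=.
  apply: cvgD => //; apply: (@cvg_comp _ _ _ _ (fun x : R => x ^+ 2)); last exact: exprn_continuous.
  apply: cvg_normc; rewrite -!mulrA [f z * _]mulrC [f w * _]mulrC.
  by apply: cvgD; apply: cvgMr; apply: cvgMr; apply: lim_shift.
apply: ler_cvg_to limK lim2 _; exists K => // N /= KN.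
have := ca N (fun n => al * z ^+ n + be * w ^+ n).
rewrite -[X in _ <= X -> _](big_mkord xpredT (fun n => normc (al * z ^+ n + be * w ^+ n) ^+ 2)).
apply: le_trans; rewrite -(big_mkord xpredT (fun k =>
  normc (\sum_(n < N | (k <= n)%N) a (n - k)%N * (al * z ^+ n + be * w ^+ n)) ^+ 2)).
rewrite [leRHS](@big_cat_nat _ _ _ K) //= ler_wpDr ?sumr_ge0 // => [i _|]; first exact: sqr_ge0.
rewrite le_eqVlt; apply/orP; left; apply/eqP; apply: eq_big_nat => k /andP[_ kK].
congr (normc _ ^+ 2); rewrite -!TE ?(leq_trans (ltnW kK)) // !mulr_sumr -big_split /=.
by apply: eq_bigr => n _; ring.
Qed.
End SzegoKernels.

Section SchwarzPick.
Variable R : realType.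
Implicit Types (f : Cplx R -> Cplx R) (a : nat -> Cplx R) (z w d : Cplx R) (r e : R).

Lemma normc_sub_conj z w : normc (1 - z * (w^*)%C) ^+ 2 =
  (1 - normc z ^+ 2) * (1 - normc w ^+ 2) + normc (w - z) ^+ 2.
Proof.
case: z w => [a b] [c d] /=; rewrite !sqr_sqrtr ?addr_ge0 ?sqr_ge0 //; ring.
Qed.

Lemma quadratic_discriminant (x P Q : R) : 0 <= x -> 0 <= P -> 0 <= Q ->
  (forall t, 0 <= t ^+ 2 * x * P + Q - 2 * t * x) -> x <= P * Q.
Proof.
move=> x0 P0 Q0 H; have [PP|] := ltP 0 P.
  have := H P^-1; rewrite -(ler_pM2l PP) mulr0.
  have -> : P * (P^-1 ^+ 2 * x * P + Q - 2 * P^-1 * x) = P * Q - x by field; lra.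
  lra.
move=> PP; have -> : P = 0 by lra.
rewrite mul0r; have [xx|//] := ltP 0 x.
have := H ((Q + 1) / x); have -> : P = 0 by lra.
have -> : ((Q + 1) / x) ^+ 2 * x * 0 + Q - 2 * ((Q + 1) / x) * x = - Q - 2 by field; lra.
lra.
Qed.

(** The Pick matrix at z and w is positive. Its off-diagonal entry is k, and al = - t conj(k)
    with t real is the line on which the quadratic form detects the determinant. *)
Lemma schwarz_pick f a z w : power_series_on_disc f a ->
  (forall x, normc x < 1 -> normc (f x) <= 1) -> normc z < 1 -> normc w < 1 ->
  normc (f w - f z) ^+ 2 * ((1 - normc z ^+ 2) * (1 - normc w ^+ 2)) <=
  normc (w - z) ^+ 2 * ((1 - normc (f z) ^+ 2) * (1 - normc (f w) ^+ 2)).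
Proof.
move=> fa f1 z1 w1; have ca := bounded_contractive fa f1.
have pos (x : Cplx R) : normc x < 1 -> 0 < 1 - normc x ^+ 2.
  by move=> x1; rewrite subr_gt0 expr_lt1 ?normc_ge0.
have nneg (x : Cplx R) : normc x < 1 -> 0 <= 1 - normc (f x) ^+ 2.
  by move=> x1; rewrite subr_ge0 expr_le1 ?normc_ge0 ?f1.
pose P := (1 - normc (f z) ^+ 2) / (1 - normc z ^+ 2).
pose Q := (1 - normc (f w) ^+ 2) / (1 - normc w ^+ 2).
pose k := (1 - f z * ((f w)^*)%C) / (1 - z * (w^*)%C).
have kE : k = (1 - f z * ((f w)^*)%C) / (1 - z * (w^*)%C) by [].
clearbody k.
have zw0 : 0 < normc (1 - z * (w^*)%C) ^+ 2.
  by rewrite normc_sub_conj ltr_pwDl ?sqr_ge0 ?mulr_gt0 ?pos.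
have : normc k ^+ 2 <= P * Q.
  apply: quadratic_discriminant.
  - exact: sqr_ge0.
  - by apply: divr_ge0; [exact: nneg|exact/ltW/pos].
  - by apply: divr_ge0; [exact: nneg|exact/ltW/pos].
  move=> t; have := szego_form_contraction (- (t%:C)%C * (k^*)%C) 1 fa ca z1 w1.
  rewrite /szego_form mul1r !normcM normcN normc_real normc_conj normc1 rmorph1 mulr1 !exprMn.
  set T1 := _ * f z * _ / _; set T2 := - (t%:C)%C * (k^*)%C / (1 - z * (w^*)%C).
  have Tk : T2 - T1 = - (t%:C)%C * ((normc k ^+ 2)%:C)%C.
    have -> : T2 - T1 = - (t%:C)%C * (k^*)%C * ((1 - f z * ((f w)^*)%C) / (1 - z * (w^*)%C)).
      by rewrite /T1 /T2; ring.
    by rewrite -kE -mul_conj [k * _]mulrC mulrA.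
  have : complex.Re T2 - complex.Re T1 = - t * normc k ^+ 2.
    by rewrite -raddfB Tk /= oppr0 mul0r subr0.
  rewrite -/(normc z) !real_normK ?num_real // /P /Q => h1 h2.
  have -> : t ^+ 2 * normc k ^+ 2 * ((1 - normc (f z) ^+ 2) / (1 - normc z ^+ 2)) +
   (1 - normc (f w) ^+ 2) / (1 - normc w ^+ 2) - 2 * t * normc k ^+ 2 =
   (t ^+ 2 * normc k ^+ 2 / (1 - normc z ^+ 2) + 1 / (1 - normc w ^+ 2)) -
   (t ^+ 2 * normc k ^+ 2 * normc (f z) ^+ 2 / (1 - normc z ^+ 2) + normc (f w) ^+ 2 / (1 - normc w ^+ 2))
   + 2 * (- t * normc k ^+ 2) by ring.
  rewrite -h1; rewrite expr1n in h2; lra.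
rewrite kE normcM normcV exprMn exprVn ler_pdivrMr // /P /Q !normc_sub_conj.
set X := 1 - normc z ^+ 2; set Y := 1 - normc w ^+ 2; set U := 1 - normc (f z) ^+ 2.
set V := 1 - normc (f w) ^+ 2.
have X0 : 0 < X by exact: pos. have Y0 : 0 < Y by exact: pos.
have -> : U / X * (V / Y) = U * V / (X * Y) by field; rewrite !gt_eqF.
rewrite mulrAC ler_pdivlMr ?mulr_gt0 //; lra.
Qed.

(** The case z = 0 of schwarz_pick says that f z lies in a pseudo-hyperbolic disc about a_0; its
    farthest point from 0 is bounded through |f z - a_0| >= |f z| - |a_0|. *)
Lemma growth_bound f a z : power_series_on_disc f a ->
  (forall x, normc x < 1 -> normc (f x) <= 1) -> normc z < 1 ->
  normc (f z) <= (normc (a 0%N) + normc z) / (1 + normc (a 0%N) * normc z).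
Proof.
move=> fa f1 z1; have z00 : normc (0 : Cplx R) < 1 by rewrite normc0.
have f0 : f 0 = a 0%N.
  apply/eqP; rewrite -subr_eq0 -normc_eq0 eq_le normc_ge0 andbT.
  apply/ler_addgt0Pr => e e0; have /cvg_normcP/(_ e e0)[N NP] := fa 0 z00.
  have := NP N.+1 (leqnSn N); rewrite /series /= big_ltn // mulr1 big1_seq ?addr0 ?add0r => [/ltW //|n].
  by rewrite mem_index_iota => /andP[]; case: n => // n _ _; rewrite exprS mul0r mulr0.
have := schwarz_pick fa f1 z00 z1; rewrite subr0 f0 normc0 expr0n subr0 mul1r.
have A1 : normc (a 0%N) <= 1 by rewrite -f0 f1.
have t1 := f1 z z1; have r0 := normc_ge0 z; have A0 := normc_ge0 (a 0%N); have t0 := normc_ge0 (f z).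
have dlow : normc (f z) - normc (a 0%N) <= normc (f z - a 0%N).
  by have := le_normcD (f z - a 0%N) (a 0%N); rewrite subrK; lra.
move: (normc_ge0 (f z - a 0%N)) dlow z1 A1 t1 r0 A0 t0.
set D := normc (f z - _); set A := normc (a 0%N); set t := normc (f z); set r := normc z.
move=> D0 dlow r1 A1 t1 r0 A0 t0 H.
rewrite ler_pdivlMr; last by have := mulr_ge0 A0 r0; lra.
have [tA|At] := leP t A.
  have := mulr_ge0 A0 r0; have : 0 <= r * (1 - t * A) by rewrite mulr_ge0 // subr_ge0 mulr_ile1.
  lra.
suff : t - A <= r * (1 - t * A) by lra.
have tA1 : 0 <= 1 - t * A by rewrite subr_ge0 mulr_ile1.
rewrite -ler_sqr ?nnegrE ?(mulr_ge0 r0 tA1) ?subr_ge0 ?(ltW At) //.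
have D2 : (t - A) ^+ 2 <= D ^+ 2 by rewrite lerXn2r ?nnegrE ?subr_ge0 // ltW.
have r2 : 0 <= 1 - r ^+ 2 by rewrite subr_ge0 exprn_ile1 // ltW.
have := ler_wpM2r r2 D2; move/le_trans => /(_ _ H).
have -> : (r * (1 - t * A)) ^+ 2 = r ^+ 2 * ((1 - A ^+ 2) * (1 - t ^+ 2)) + r ^+ 2 * (t - A) ^+ 2 by ring.
lra.
Qed.

Lemma cvg_of_rate (u : nat -> Cplx R) z (K : R) : (forall n, normc (u n - z) <= K * harmonic n) ->
  u @ \oo --> z.
Proof.
move=> uK; apply/cvg_normcP => e e0.
have : (fun n => K * harmonic n) @ \oo --> K * 0 by apply: cvgMr; exact: cvg_harmonic.
rewrite mulr0 => /cvgrPdist_lt/(_ e e0)[N _ NP]; exists N => n /NP /=.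
rewrite sub0r normrN -(opprB (u n)) normcN; apply: le_lt_trans.
exact: le_trans (uK n) (ler_norm _).
Qed.

(** A sequence of increments is enough to pass to the limit in inequalities and to compute
    derivatives of explicit functions. *)
Lemma difference_quotient_cvg f a z : power_series_on_disc f a ->
    (forall n, normc (a n) <= 1) -> normc z < 1 ->
  exists h : nat -> Cplx R, [/\ forall n, h n != 0, forall n, normc (z + h n) < 1,
    h @ \oo --> (0 : Cplx R) &
    (fun n => (f (z + h n) - f z) / h n) @ \oo --> derive1 f z].
Proof.
move=> fa a1 z1; have r0 := normc_ge0 z.
have [d [K K0 [_ -> dP]]] := power_series_taylor fa a1 z1.
pose c := (1 - normc z) / 4; have c0 : 0 < c by rewrite /c; lra.
pose h n : Cplx R := ((c * harmonic n)%:C)%C.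
have hn n : normc (h n) = c * harmonic n.
  by rewrite normc_real ger0_norm // mulr_ge0 ?(ltW c0) // invr_ge0.
have harm01 n : 0 < (harmonic n : R) <= 1 by rewrite /= invr_gt0 ltr0n invf_le1 ?ler1n ?ltr0n.
have hc n : normc (h n) <= c.
  by rewrite hn ler_piMr ?(ltW c0) //; case/andP: (harm01 n).
have hpos n : 0 < normc (h n) by rewrite hn mulr_gt0 //; case/andP: (harm01 n).
have wz n : z + h n - z = h n by rewrite addrAC subrr add0r.
exists h; split=> [n|n||].
- by rewrite -normc_eq0 gt_eqF.
- by apply: le_lt_trans (le_normcD _ _) _; have := hc n; rewrite /c; lra.
- by apply: (@cvg_of_rate _ _ c) => n; rewrite subr0 hn.
apply: (@cvg_of_rate _ _ (K * c)) => n; rewrite -mulrA -hn -(ler_pM2r (hpos n)) -normcM.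
rewrite mulrBl divfK -?normc_eq0 ?gt_eqF // [d * _]mulrC -mulrA -expr2.
by have := dP (z + h n); rewrite wz; apply; have := hc n; rewrite /c; lra.
Qed.

Lemma schwarz_pick_derivative f a z : power_series_on_disc f a ->
  (forall x, normc x < 1 -> normc (f x) <= 1) -> normc z < 1 ->
  normc (derive1 f z) * (1 - normc z ^+ 2) <= 1 - normc (f z) ^+ 2.
Proof.
move=> fa f1 z1; have ca := bounded_contractive fa f1.
have [h [h0 w1 hlim qlim]] := difference_quotient_cvg fa (fun n => coef_le1 n ca) z1.
pose w n := z + h n; have wz n : w n - z = h n by rewrite /w addrAC subrr add0r.
have wlim : w @ \oo --> z.
  have L : w @ \oo --> z + 0 by apply: cvgD; [exact: cvg_cst|exact: hlim].
  by rewrite addr0 in L.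
have flim : (fun n => f (w n)) @ \oo --> f z.
  have E n : f (w n) = f z + h n * ((f (z + h n) - f z) / h n).
    by rewrite mulrCA mulfV // mulr1 addrC subrK.
  have L : (fun n => f z + h n * ((f (z + h n) - f z) / h n)) @ \oo --> f z + 0 * derive1 f z.
    by apply: cvgD; [exact: cvg_cst|apply: cvgM; [exact: hlim|exact: qlim]].
  by rewrite mul0r addr0 in L; rewrite (eq_cvg _ _ E).
have r2 : 0 <= 1 - normc z ^+ 2 by rewrite subr_ge0 exprn_ile1 ?normc_ge0 // ltW.
have t2 : 0 <= 1 - normc (f z) ^+ 2 by rewrite subr_ge0 exprn_ile1 ?normc_ge0 ?f1.
rewrite -ler_sqr ?nnegrE ?mulr_ge0 ?normc_ge0 // exprMn !expr2.
have sq_lim (u : nat -> Cplx R) (x : Cplx R) : u @ \oo --> x ->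
    (fun n => normc (u n) ^+ 2) @ \oo --> normc x ^+ 2.
  move=> ux; apply: (@cvg_comp _ _ _ _ (fun x : R => x ^+ 2)); last exact: exprn_continuous.
  exact: cvg_normc.
have L1 : (fun n => normc ((f (w n) - f z) / h n) ^+ 2 * ((1 - normc z ^+ 2) * (1 - normc (w n) ^+ 2)))
    @ \oo --> normc (derive1 f z) ^+ 2 * ((1 - normc z ^+ 2) * (1 - normc z ^+ 2)).
  apply: cvgM; first exact: (sq_lim (fun n => (f (w n) - f z) / h n) _ qlim).
  by apply: cvgMr; apply: cvgB; [exact: cvg_cst|exact: (sq_lim w z wlim)].
have L2 : (fun n => (1 - normc (f z) ^+ 2) * (1 - normc (f (w n)) ^+ 2))
    @ \oo --> (1 - normc (f z) ^+ 2) * (1 - normc (f z) ^+ 2).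
  by apply: cvgMr; apply: cvgB; [exact: cvg_cst|exact: (sq_lim (fun n => f (w n)) (f z) flim)].
apply: ler_cvg_to L1 L2 _; exists 0%N => // n _ /=.
have H := schwarz_pick fa f1 z1 (w1 n); rewrite wz in H.
have hpos : 0 < normc (h n) ^+ 2 by rewrite exprn_gt0 // lt_def normc_ge0 normc_eq0 h0.
by rewrite normcM normcV exprMn exprVn mulrAC ler_pdivrMr // [leRHS]mulrC.
Qed.
End SchwarzPick.

(** * The area of a disc *)

Section DiscArea.
Variable R : realType.
Local Notation mu := (@lebesgue_measure R).
Local Notation plane := (measurableTypeR R * measurableTypeR R)%type.
Local Notation mu2 := (mu \x mu)%E.

(** The integrand is the length of a vertical chord; the substitution x = s sin t makes it
    2 s^2 cos^2 t, with primitive s^2 (t + sin t cos t). *)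
Lemma integral_chord (s : R) : 0 < s ->
  (\int[mu]_(x in `[(- s)%R, s]) (2 * Num.sqrt (s ^+ 2 - x ^+ 2))%:E = (pi * s ^+ 2)%:E)%E.
Proof.
move=> s0; pose F (t : R) := s * sin t; pose G (x : R) := 2 * Num.sqrt (s ^+ 2 - x ^+ 2).
have pi0 : 0 < pi / 2 :> R by rewrite divr_gt0 // pi_gt0.
have ab : - (pi / 2) <= pi / 2 :> R by lra.
have dF (x : R) : is_derive x 1 F (s * cos x) by rewrite /F; apply: is_derive_eq.
have F'E : F^`()%classic = (fun x => s * cos x).
  by apply/funext => x; rewrite derive1E; apply: derive_val.
have cF : continuous F by move=> x; apply: differentiable_continuous; apply/derivable1_diffP.
have cF' : continuous (F^`()%classic : R -> R).
  rewrite F'E => x; apply: cvgM; [exact: cvg_cst|exact: continuous_cos].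
have Fb : F (pi / 2) = s by rewrite /F sin_pihalf mulr1.
have Fa : F (- (pi / 2)) = - s by rewrite /F sinN sin_pihalf mulrN mulr1.
transitivity (\int[mu]_(x in `[F (- (pi / 2))%R, F (pi / 2)%R]) (G x)%:E)%E; first by rewrite Fa Fb.
have incF : {in `[(- (pi / 2))%R, (pi / 2)%R] &, {homo F : x y / x < y}}.
  by move=> x y xI yI xy; rewrite /F ltr_pM2l // ltr_sin.
have cG : {within `[F (- (pi / 2))%R, F (pi / 2)%R], continuous G}.
  apply: continuous_subspaceT => x; apply: cvgM; first exact: cvg_cst.
  apply: continuous_cvg; first exact: sqrt_continuous.
  by apply: cvgB; [exact: cvg_cst|exact: exprn_continuous].
have dFb : derivable_oo_LRcontinuous F (- (pi / 2)) (pi / 2).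
  split; first by move=> x _; exact: ex_derive.
    exact/cvg_at_right_filter/cF.
  exact/cvg_at_left_filter/cF.
have F'a : cvg (F^`()%classic x @[x --> (- (pi / 2))^'+]).
  by apply/cvg_ex; eexists; exact/cvg_at_right_filter/cF'.
have F'b : cvg (F^`()%classic x @[x --> (pi / 2)^'-]).
  by apply/cvg_ex; eexists; exact/cvg_at_left_filter/cF'.
rewrite (integration_by_substitution_increasing ab incF (in1W cF') F'a F'b dFb cG).
pose H (t : R) := s ^+ 2 * (t + sin t * cos t); pose h (t : R) := 2 * s ^+ 2 * cos t ^+ 2.
have cos_nn x : x \in `[(- (pi / 2))%R, (pi / 2)%R] -> 0 <= cos x.
  by rewrite in_itv /= => xI; exact: cos_ge0_pihalf.
transitivity (\int[mu]_(x in `[(- (pi / 2))%R, (pi / 2)%R]) (h x)%:E)%E.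
  apply: eq_integral => x; rewrite inE /= => xI; congr EFin.
  rewrite F'E; change (2 * Num.sqrt (s ^+ 2 - (s * sin x) ^+ 2) * (s * cos x) = h x).
  have -> : s ^+ 2 - (s * sin x) ^+ 2 = (s * cos x) ^+ 2.
    by rewrite !exprMn cos2sin2; ring.
  rewrite sqrtr_sqr ger0_norm; last by rewrite mulr_ge0 ?cos_nn // ltW.
  rewrite /h; ring.
have dH (x : R) : is_derive x 1 H (h x).
  rewrite /H; apply: is_derive_eq; rewrite /GRing.scale /= /h.
  have := cos2Dsin2 x; set c := cos x; set t := sin x => ct.
  have -> : t * - t = c ^+ 2 - 1 by rewrite -ct; ring.
  ring.
have ch : {within `[(- (pi / 2))%R, (pi / 2)%R], continuous h}.
  apply: continuous_subspaceT => x; apply: cvgM; first exact: cvg_cst.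
  exact: (cvgM (@continuous_cos R x) (@continuous_cos R x)).
have cH : continuous H.
  move=> x; apply: differentiable_continuous; apply/derivable1_diffP.
  exact: (@ex_derive _ _ _ _ _ _ _ (dH x)).
have dHb : derivable_oo_LRcontinuous H (- (pi / 2)) (pi / 2).
  split; first by move=> x _; exact: ex_derive.
    exact/cvg_at_right_filter/cH.
  exact/cvg_at_left_filter/cH.
have H'h : {in `](- (pi / 2))%R, (pi / 2)%R[, H^`()%classic =1 h}.
  by move=> x _; rewrite derive1E; apply: derive_val.
rewrite (continuous_FTC2 _ ch dHb H'h); last lra.
rewrite -EFinB; congr EFin; rewrite /H sinN cosN cos_pihalf; by field.
Qed.

Lemma measure_closed_disc (t : R) : 0 <= t ->
  mu2 [set p : plane | p.1 ^+ 2 + p.2 ^+ 2 <= t] = (pi * t)%:E.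
Proof.
move=> t0; pose s := Num.sqrt t; have ts : t = s ^+ 2 by rewrite sqr_sqrtr.
have section x : mu (xsection [set p : plane | p.1 ^+ 2 + p.2 ^+ 2 <= t] x) =
    (2 * Num.sqrt (s ^+ 2 - x ^+ 2))%:E.
  have [xt|tx] := leP (x ^+ 2) t.
    have -> : xsection [set p : plane | p.1 ^+ 2 + p.2 ^+ 2 <= t] x =
        [set` `[(- Num.sqrt (s ^+ 2 - x ^+ 2))%R, Num.sqrt (s ^+ 2 - x ^+ 2)]].
      apply/seteqP; split=> y; rewrite /xsection /= inE /= in_itv /= -ler_norml.
        rewrite -ts => h; rewrite -sqrtr_sqr ler_wsqrtr //; lra.
      rewrite -ts => h; have : `|y| ^+ 2 <= Num.sqrt (t - x ^+ 2) ^+ 2.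
        by rewrite lerXn2r ?nnegrE // sqrtr_ge0.
      rewrite sqr_sqrtr ?subr_ge0 // real_normK ?num_real //; lra.
    rewrite lebesgue_measure_itv /= lte_fin; case: ifPn => [_|].
      by rewrite -EFinB; congr EFin; ring.
    have := sqrtr_ge0 (s ^+ 2 - x ^+ 2); rewrite -leNgt => h1 h2; congr EFin; lra.
  rewrite -ts ler0_sqrtr ?mulr0; last lra.
  rewrite (_ : xsection _ x = set0) ?measure0 //.
  apply/seteqP; split=> y //; rewrite /xsection /= inE /= => h.
  by have := sqr_ge0 y; lra.
rewrite /product_measure1 /= (eq_integral _ _ (fun x _ => section x)).
have [tt|] := ltP 0 t; last first.
  move=> tle; have t00 : t = 0 by lra.
  rewrite ts; have -> : s = 0 by rewrite /s t00 sqrtr0.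
  rewrite expr0n mulr0 integral0_eq // => x _; congr EFin.
  by rewrite ler0_sqrtr ?mulr0 // sub0r oppr_le0 sqr_ge0.
have s0 : 0 < s by rewrite sqrtr_gt0.
rewrite ts -integral_chord // [RHS]integral_mkcond; apply: eq_integral => x _.
rewrite patchE; case: ifPn => //; rewrite notin_setE /= in_itv /= -ler_norml => /negP.
rewrite -ltNge => sx; rewrite ler0_sqrtr ?mulr0 // subr_le0.
by rewrite -(real_normK (num_real x)) lerXn2r ?nnegrE ?(ltW s0) // ltW.
Qed.
End DiscArea.

(** * Rotations preserve planar Lebesgue measure *)

Section Rotation.
Variable R : realType.
Local Notation mu := (@lebesgue_measure R).
Local Notation plane := (measurableTypeR R * measurableTypeR R)%type.
Local Notation mu2 := (mu \x mu)%E.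

(** The translated measure agrees with Lebesgue measure on intervals. *)
Lemma lebesgue_measure_translation (t : R) (A : set R) : measurable A ->
  pushforward mu ((fun x => x + t) : _ -> measurableTypeR R) A = mu A.
Proof.
move=> mA; have mt : measurable_fun setT ((fun x => x + t) : measurableTypeR R -> measurableTypeR R).
  by apply: measurable_funD => //; exact: measurable_id.
apply/esym/lebesgue_measure_unique => //= _ [[a b]] _ <-.
rewrite /pushforward /=.
have -> : (fun x : R => x + t) @^-1` [set` `]a, b]] = [set` `]a - t, b - t]].
  by apply/seteqP; split=> x /=; rewrite !in_itv /= ltrBlDr lerBrDr.
rewrite !lebesgue_measure_itv /= !lte_fin ltrD2r; case: ifP => // _.
by rewrite -!EFinB; congr EFin; ring.
Qed.

Definition measure_preserving (phi : plane -> plane) :=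
  measurable_fun setT phi /\ forall A, measurable A -> mu2 A = mu2 (phi @^-1` A).

Lemma measure_preserving_comp phi psi :
  measure_preserving phi -> measure_preserving psi -> measure_preserving (phi \o psi).
Proof.
move=> [mphi phiA] [mpsi psiA]; split; first exact: measurableT_comp.
move=> A mA; rewrite phiA // psiA //.
by rewrite -[X in measurable X]setTI; exact: mphi.
Qed.

Lemma measure_preserving_rectangles phi : measurable_fun setT phi ->
  (forall A B, measurable A -> measurable B -> mu2 (phi @^-1` (A `*` B)) = (mu A * mu B)%E) ->
  measure_preserving phi.
Proof.
move=> mphi phiAB; split=> // A mA.
exact: (@product_measure_unique _ _ _ _ _ mu mu (pushforward mu2 phi)).
Qed.

Lemma swap_preserving : measure_preserving (fun p : plane => (p.2, p.1)).
Proof.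
apply: measure_preserving_rectangles.
  by apply: measurable_fun_pair; [exact: measurable_snd|exact: measurable_fst].
move=> A B mA mB; rewrite muleC -product_measure1E //; congr (mu2 _).
by apply/seteqP; split=> -[x y] [].
Qed.

(** Every vertical section of the set is translated. *)
Lemma shear_preserving (c : R) : measure_preserving (fun p : plane => (p.1, p.2 + c * p.1)).
Proof.
have mphi : measurable_fun setT (fun p : plane => (p.1, p.2 + c * p.1) : plane).
  apply: measurable_fun_pair; first exact: measurable_fst.
  apply: measurable_funD; first exact: measurable_snd.
  by apply: measurable_funM => //; exact: measurable_fst.
apply: measure_preserving_rectangles => // A B mA mB.
rewrite /product_measure1 /=.
rewrite (eq_integral (fun x => (\1_A x)%:E * mu B)%E) => [|x _].
  rewrite ge0_integralZr ?integral_indic ?setIT //; exact: measurableT_comp.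
rewrite indicE; have [xA|xA] := boolP (x \in A).
  rewrite mul1e -(lebesgue_measure_translation (c * x) mB); congr (mu _).
  by apply/seteqP; split=> y; rewrite /xsection /= inE /=; [case|split=> //; exact: set_mem].
rewrite mul0e (_ : xsection _ x = set0) ?measure0 //.
apply/seteqP; split=> y //; rewrite /xsection /= inE /= => -[xA' _].
by move: xA; rewrite notin_setE.
Qed.

(** A rotation by an angle th is a product of three shears, with coefficients - tan (th / 2),
    sin th and - tan (th / 2); the first one is s / (1 + c), whence c != -1. *)
Lemma rotation_preserving (c s : R) : c ^+ 2 + s ^+ 2 = 1 -> c != -1 ->
  measure_preserving (fun p : plane => (c * p.1 - s * p.2, s * p.1 + c * p.2)).
Proof.
move=> cs c1; have c10 : 1 + c != 0 by rewrite addrC addr_eq0.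
pose t := s / (1 + c).
have ts : 1 - t * s = c.
  have : (1 + c) * (1 - c) = s ^+ 2 by rewrite -(addrK (c ^+ 2) (s ^+ 2)) [s ^+ 2 + _]addrC cs; ring.
  rewrite /t => h; have -> : 1 - s / (1 + c) * s = (1 + c - s ^+ 2) / (1 + c) by field.
  by rewrite -h; field.
have swapsh k : measure_preserving (fun p : plane => (p.1 + k * p.2, p.2)).
  exact: (measure_preserving_comp swap_preserving
            (measure_preserving_comp (shear_preserving k) swap_preserving)).
have -> : (fun p : plane => (c * p.1 - s * p.2, s * p.1 + c * p.2)) =
  (fun p : plane => (p.1 + - t * p.2, p.2)) \o ((fun p : plane => (p.1, p.2 + s * p.1)) \o
    (fun p : plane => (p.1 + - t * p.2, p.2))).
  apply/funext => -[x y] /=; congr (_, _); last first.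
    by rewrite -[in LHS]ts; ring.
  have tt : t + c * t = s by rewrite /t; field.
  transitivity ((1 - t * s) * x - (t + (1 - t * s) * t) * y); first by rewrite ts tt.
  ring.
apply: measure_preserving_comp; first exact: swapsh.
by apply: measure_preserving_comp; [exact: shear_preserving|exact: swapsh].
Qed.

Lemma integral_measure_preserving phi (g : plane -> \bar R) : measure_preserving phi ->
  measurable_fun setT g -> (forall p, 0 <= g p)%E ->
  (\int[mu2]_p g p = \int[mu2]_p g (phi p))%E.
Proof.
move=> [mphi phiA] mg g0; transitivity (\int[pushforward mu2 phi]_p g p)%E.
  by apply: eq_measure_integral => A mA _; exact: phiA.
have := ge0_integral_pushforward mphi mu2 measurableT mg (fun p _ => g0 p).
by rewrite preimage_setT.
Qed.
End Rotation.

(** * Integrals of radial functions *)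

Section Radial.
Variable R : realType.
Local Notation mu := (@lebesgue_measure R).
Local Notation plane := (measurableTypeR R * measurableTypeR R)%type.
Local Notation mu2 := (mu \x mu)%E.

Definition sqdist (p : plane) : measurableTypeR R := p.1 ^+ 2 + p.2 ^+ 2.

Lemma measurable_sqdist : measurable_fun setT sqdist.
Proof.
by apply: measurable_funD; apply: measurable_funX; [exact: measurable_fst|exact: measurable_snd].
Qed.

Lemma measurable_sqdist_preimage (A : set (measurableTypeR R)) : measurable A -> measurable (sqdist @^-1` A).
Proof. by move=> mA; rewrite -[X in measurable X]setTI; exact: measurable_sqdist. Qed.

Lemma sqdist_ge0 p : 0 <= sqdist p.
Proof. by rewrite addr_ge0 ?sqr_ge0. Qed.

Lemma measure_annulus (x y : R) : 0 <= x <= y ->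
  mu2 (sqdist @^-1` [set` `]x, y]]) = (pi * (y - x))%:E.
Proof.
move=> /andP[x0 xy]; have y0 := le_trans x0 xy.
have -> : sqdist @^-1` [set` `]x, y]] =
    [set p : plane | p.1 ^+ 2 + p.2 ^+ 2 <= y] `\` [set p : plane | p.1 ^+ 2 + p.2 ^+ 2 <= x].
  apply/seteqP; split=> p /=; rewrite in_itv /= /sqdist.
    by move=> /andP[h1 h2]; split=> //; apply/negP; rewrite -ltNge.
  by move=> [h1 /negP h2]; rewrite h1 andbT ltNge.
have mle t : measurable [set p : plane | p.1 ^+ 2 + p.2 ^+ 2 <= t].
  have -> : [set p : plane | p.1 ^+ 2 + p.2 ^+ 2 <= t] = sqdist @^-1` [set` `]-oo, t]].
    by apply/seteqP; split=> p /=; rewrite in_itv.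
  exact: measurable_sqdist_preimage.
have disc t := @measure_closed_disc R t.
rewrite measureD; [|exact: mle|exact: mle|by rewrite /= [X in (X < _)%E]disc // ltry].
rewrite /=.
rewrite setIidr; last by move=> p /= /le_trans; apply.
by rewrite !disc // -EFinB mulrBr.
Qed.

(** Areas of annuli show that the image of planar measure under the squared distance is pi times
    Lebesgue measure on intervals of the half-line. *)
Lemma radial_measure (A : set (measurableTypeR R)) :
  measurable A -> A `<=` [set` `[0, +oo[] ->
  mu2 (sqdist @^-1` A) = (pi%:E * mu A)%E.
Proof.
move=> mA A0; have pi0 : 0 < pi :> R by exact: pi_gt0.
have piV0 : 0 <= (pi : R)^-1 by rewrite invr_ge0 ltW.
have mneg : measurable ([set` `]-oo, 0]] : set (measurableTypeR R)) by exact: measurable_itv.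
pose nu := pushforward mu2 sqdist.
have nu_itv (x y : R) : nu [set` `]x, y]] = (pi * (Num.max y 0 - Num.max (Num.min x y) 0))%:E.
  have [xy|yx] := ltP x y; last first.
    by rewrite set_itv_ge ?bnd_simp -?leNgt // /nu /pushforward preimage_set0 measure0 subrr mulr0.
  have [x0|x0] := leP 0 x.
    have y0 := le_trans x0 (ltW xy).
    by rewrite (max_idPl y0) // /nu /pushforward measure_annulus ?x0 ?ltW.
  rewrite subr0 /nu /pushforward; have [y0|y0] := leP 0 y.
    rewrite -measure_closed_disc //; congr (mu2 _).
    apply/seteqP; split=> p /=; rewrite in_itv /= ; first by case/andP.
    by move=> ->; rewrite andbT (lt_le_trans x0) ?sqdist_ge0.
  rewrite mulr0 (_ : _ @^-1` _ = set0) ?measure0 //.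
  apply/seteqP; split=> p //=; rewrite in_itv /= => /andP[_ py].
  by have := le_lt_trans py y0; rewrite ltNge sqdist_ge0.
(* completed by Lebesgue measure on the negative half-line, so that the
   characterization of Lebesgue measure on the whole line applies *)
pose m_of := measure_add (mscale (NngNum piV0) nu) (mrestr mu mneg).
pose m' : {measure set (measurableTypeR R) -> \bar R} := m_of measurable_sqdist.
have m'E B : m' B = ((pi^-1)%:E * nu B + mu (B `&` [set` `]-oo, 0%R]]))%E.
  exact: measure_addE.
have mum' : forall B, measurable B -> mu B = m' B.
  apply: (lebesgue_measure_unique (mu := m')) => _ [[a b]] _ <-.
  rewrite m'E /= nu_itv -EFinM mulKf ?gt_eqF //=.
  have -> : [set` `]a, b]] `&` [set` `]-oo, 0]] = [set` `]a, Num.min b 0]] :> set R.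
    apply/seteqP; split=> x /=; rewrite !in_itv /= le_min.
      by move=> [/andP[-> ->] ->].
    by move=> /and3P[-> -> ->].
  rewrite !lebesgue_measure_itv /= !lte_fin lt_min.
  have [ab|ba] := ltP a b; last first.
    by rewrite subrr adde0.
  have [a0|a0] := ltP a 0 => /=.
    rewrite -!EFinB -EFinD; congr EFin; rewrite subr0.
    by have [b0|b0] := leP 0 b; ring.
  rewrite adde0 -EFinB; congr EFin.
  by have [b0|b0] := leP 0 b => //; lra.
have nuE : nu A = (pi%:E * m' A)%E.
  rewrite m'E (_ : mu _ = 0%E) ?adde0.
    by rewrite muleA -EFinM mulfV ?mul1e // gt_eqF.
  apply/eqP; rewrite eq_le measure_ge0 andbT -(lebesgue_measure_set1 (0 : R)).
  apply: le_measure; rewrite ?inE; [exact: measurableI|exact: measurable_set1|].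
  move=> x [/A0] /=; rewrite !in_itv /= andbT => h1 h2; apply/eqP; rewrite eq_le h2 h1 //.
by rewrite mum'.
Qed.

Lemma integral_radial_power (r : R) n : 0 <= r ->
  (\int[mu2]_(p in sqdist @^-1` [set` `[0%R, (r ^+ 2)%R[]) (sqdist p ^+ n)%:E =
   (pi * (r ^+ (2 * n.+1) / n.+1%:R))%:E)%E.
Proof.
move=> r0; have pi0 : 0 <= pi :> R by exact: pi_ge0.
set D : set (measurableTypeR R) := [set` _].
have mD : measurable D by exact: measurable_itv.
have mX : measurable_fun D (fun t : measurableTypeR R => (t ^+ n)%:E).
  by apply/measurable_EFinP; apply: measurable_funX; exact: measurable_id.
have X0 : {in D, forall t : measurableTypeR R, (0 <= (t ^+ n)%:E)%E}.
  by move=> t; rewrite inE /D /= in_itv /= => /andP[t0 _]; rewrite lee_fin exprn_ge0.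
rewrite -[LHS](ge0_integral_pushforward measurable_sqdist mu2 mD mX X0).
transitivity (\int[mscale (NngNum pi0) mu]_(t in D) (t ^+ n)%:E)%E.
  refine (eq_measure_integral _ _) => A mA AD.
  have A0 : A `<=` [set` `[0, +oo[] by move=> x /AD; rewrite /D /= !in_itv /= => /andP[->].
  exact: (radial_measure mA A0).
rewrite ge0_integral_mscale //=; last by move=> t tD; apply: X0; rewrite inE.
rewrite EFinM; congr (_ * _)%E; rewrite exprM.
rewrite /D; set b := r ^+ 2; have b0 : 0 <= b by exact: sqr_ge0.
rewrite integral_itv_bndo_bndc; last first.
  by apply/measurable_EFinP; apply: measurable_funX; exact: measurable_id.
have [bpos|] := ltP 0 b; last first.
  move=> ble; have -> : b = 0 by apply/eqP; rewrite eq_le ble b0.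
  by rewrite set_itv1 integral_set1 expr0n mul0r.
pose F (t : R) := n.+1%:R^-1 * t ^+ n.+1.
have dF (x : R) : is_derive x 1 F (x ^+ n).
  have dX : is_derive x 1 (@GRing.exp R ^~ n.+1) (n.+1%:R * x ^+ n).
    by apply: DeriveDef; [exact: exprn_derivable|rewrite exp_derive /GRing.scale /= mulr1].
  have := is_deriveZ n.+1%:R^-1 dX; rewrite /GRing.scale /= mulrA mulVf ?mul1r // pnatr_eq0 //.
have cF : continuous F by move=> x; apply: differentiable_continuous; apply/derivable1_diffP.
have ch : {within `[0%R, b], continuous (fun t : R => t ^+ n)}.
  by apply: continuous_subspaceT => x; exact: exprn_continuous.
have dFb : derivable_oo_LRcontinuous F 0 b.
  split; first by move=> x _; exact: ex_derive.
    exact/cvg_at_right_filter/cF.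
  exact/cvg_at_left_filter/cF.
have F'h : {in `]0%R, b[, F^`()%classic =1 (fun t : R => t ^+ n)}.
  by move=> x _; rewrite derive1E; apply: derive_val.
rewrite (continuous_FTC2 bpos ch dFb F'h) -EFinB; congr EFin.
by rewrite /F expr0n mulr0 subr0 mulrC.
Unshelve. all: exact: measurable_sqdist.
Qed.
End Radial.

(** * The area functional as a series *)

Section AreaSeries.
Variable R : realType.
Local Notation mu := (@lebesgue_measure R).
Local Notation plane := (measurableTypeR R * measurableTypeR R)%type.
Local Notation mu2 := (mu \x mu)%E.

Definition plane_point (p : plane) : Cplx R := (p.1 +i* p.2)%C.

Definition disc (r : R) : set plane := [set p | normc (plane_point p) < r].

Lemma normc_plane_point p : normc (plane_point p) ^+ 2 = sqdist p.
Proof. by rewrite /= sqr_sqrtr // addr_ge0 ?sqr_ge0. Qed.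

Lemma discE r : 0 <= r -> disc r = @sqdist R @^-1` [set` `[0, (r ^+ 2)[].
Proof.
move=> r0; apply/seteqP; split=> p; rewrite /disc /= in_itv /= sqdist_ge0 -normc_plane_point /=.
  by move=> pr; rewrite ltrXn2r // normc_ge0.
by rewrite ltr_pXn2r ?nnegrE ?normc_ge0.
Qed.

Lemma measurable_disc r : 0 <= r -> measurable (disc r).
Proof. by move=> r0; rewrite discE //; apply: measurable_sqdist_preimage; exact: measurable_itv. Qed.

Definition cmeasurable (g : plane -> Cplx R) :=
  measurable_fun setT (fun p => complex.Re (g p) : measurableTypeR R) /\
  measurable_fun setT (fun p => complex.Im (g p) : measurableTypeR R).

Lemma cmeasurable_cst z : cmeasurable (fun=> z).
Proof. by split; exact: measurable_cst. Qed.

Lemma cmeasurable_plane_point : cmeasurable plane_point.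
Proof. by split; [exact: measurable_fst|exact: measurable_snd]. Qed.

Lemma cmeasurable_add g h : cmeasurable g -> cmeasurable h -> cmeasurable (fun p => g p + h p).
Proof.
move=> [g1 g2] [h1 h2]; split.
  have -> : (fun p => complex.Re (g p + h p)) = (fun p => complex.Re (g p)) \+ (fun p => complex.Re (h p)).
    by apply/funext => p /=; case: (g p) (h p) => [? ?] [].
  exact: measurable_funD.
have -> : (fun p => complex.Im (g p + h p)) = (fun p => complex.Im (g p)) \+ (fun p => complex.Im (h p)).
  by apply/funext => p /=; case: (g p) (h p) => [? ?] [].
exact: measurable_funD.
Qed.

Lemma cmeasurable_mul g h : cmeasurable g -> cmeasurable h -> cmeasurable (fun p => g p * h p).
Proof.
move=> [g1 g2] [h1 h2]; split.
  have -> : (fun p => complex.Re (g p * h p)) =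
     (fun p => complex.Re (g p) * complex.Re (h p) - complex.Im (g p) * complex.Im (h p)).
    by apply/funext => p /=; case: (g p) (h p) => [? ?] [].
  by apply: measurable_funB; apply: measurable_funM.
have -> : (fun p => complex.Im (g p * h p)) =
   (fun p => complex.Re (g p) * complex.Im (h p) + complex.Im (g p) * complex.Re (h p)).
  by apply/funext => p /=; case: (g p) (h p) => [? ?] [].
by apply: measurable_funD; apply: measurable_funM.
Qed.

Lemma cmeasurable_poly (c : nat -> Cplx R) N :
  cmeasurable (fun p => \sum_(0 <= n < N) c n * plane_point p ^+ n).
Proof.
have cX n : cmeasurable (fun p => plane_point p ^+ n).
  elim: n => [|n IH]; first exact: cmeasurable_cst.
  have -> : (fun p => plane_point p ^+ n.+1) = (fun p => plane_point p * plane_point p ^+ n).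
    by apply/funext => p; rewrite exprS.
  exact: cmeasurable_mul cmeasurable_plane_point IH.
elim: N => [|N IH].
  have -> : (fun p => \sum_(0 <= n < 0) c n * plane_point p ^+ n) = fun=> 0.
    by apply/funext => p; rewrite big_geq.
  exact: cmeasurable_cst.
have -> : (fun p => \sum_(0 <= n < N.+1) c n * plane_point p ^+ n) =
   (fun p => \sum_(0 <= n < N) c n * plane_point p ^+ n + c N * plane_point p ^+ N).
  by apply/funext => p; rewrite big_nat_recr.
by apply: cmeasurable_add => //; apply: cmeasurable_mul; [exact: cmeasurable_cst|exact: cX].
Qed.

Lemma measurable_normc_sqr g : cmeasurable g ->
  measurable_fun setT (fun p => normc (g p) ^+ 2 : measurableTypeR R).
Proof.
move=> [g1 g2]; have -> : (fun p => normc (g p) ^+ 2) =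
    (fun p => complex.Re (g p) ^+ 2 + complex.Im (g p) ^+ 2).
  by apply/funext => p; case: (g p) => x y /=; rewrite sqr_sqrtr // addr_ge0 ?sqr_ge0.
by apply: measurable_funD; apply: measurable_funX.
Qed.

(** Averaging over the rotations by all M-th roots of unity kills the mixed products. *)
Lemma sum_rotations (w z : Cplx R) (c : nat -> Cplx R) M N : M.-primitive_root w -> (N <= M)%N ->
  \sum_(j < M) normc (\sum_(0 <= n < N) c n * (w ^+ j * z) ^+ n) ^+ 2 =
  M%:R * \sum_(0 <= n < N) normc (c n) ^+ 2 * (normc z ^+ 2) ^+ n.
Proof.
move=> wM NM; pose p : {poly R[i]} := \poly_(n < N) (c n * z ^+ n).
have pM : (size p <= M)%N by exact: leq_trans (size_poly _ _) NM.
have := parseval wM pM pM; move=> H; apply: complexI.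
rewrite rmorph_sum rmorphM rmorph_nat rmorph_sum /=.
transitivity (\sum_(j < M) p.[w ^+ j] * (p.[w ^+ j])^*)%R.
  apply: eq_bigr => j _; rewrite -normCK normc_E -rmorphXn /=; congr ((normc _ ^+ 2)%:C)%C.
  by rewrite horner_poly big_mkord; apply: eq_bigr => n _; rewrite exprMn; ring.
rewrite H; congr (_ * _).
rewrite (big_mkord xpredT (fun n => ((normc (c n) ^+ 2 * (normc z ^+ 2) ^+ n)%:C)%C)).
rewrite (big_ord_widen _ (fun n => ((normc (c n) ^+ 2 * (normc z ^+ 2) ^+ n)%:C)%C) NM).
rewrite [RHS]big_mkcond; apply: eq_bigr => n _; rewrite coef_poly.
case: ifP => _; last by rewrite mul0r.
rewrite -normCK normc_E -rmorphXn /= normcM normcX exprMn; congr ((_ * _)%:C)%C.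
by rewrite -!exprM mulnC.
Qed.

Lemma integral_disc_poly (c : nat -> Cplx R) N r : 0 <= r ->
  (\int[mu2]_(p in disc r) (normc (\sum_(0 <= n < N) c n * plane_point p ^+ n) ^+ 2)%:E =
   (\sum_(0 <= n < N) normc (c n) ^+ 2 * (pi * (r ^+ (2 * n.+1) / n.+1%:R)))%:E)%E.
Proof.
(* M is odd, so that no power of w is the half-turn, excluded in rotation_preserving *)
move=> r0; pose M := N.*2.+1; have [w wM] : exists w : R[i], M.-primitive_root w by exact: prim_root_exists.
have NM : (N <= M)%N by rewrite /M; lia.
pose h p := normc (\sum_(0 <= n < N) c n * plane_point p ^+ n) ^+ 2.
have mh : measurable_fun setT (EFin \o h).
  apply/measurable_EFinP; apply: measurable_normc_sqr; exact: cmeasurable_poly.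
pose g := (EFin \o h) \_ (disc r).
have mg : measurable_fun setT g.
  apply/(measurable_restrict _ (measurable_disc r0) measurableT).
  by rewrite setTI; exact: measurable_funTS.
have h0 p : (0 <= (EFin \o h) p)%E by rewrite lee_fin exprn_ge0 ?normc_ge0.
have g0 p : (0 <= g p)%E by rewrite /g patchE; case: ifP.
pose rot (j : nat) (p : plane) : plane :=
  (complex.Re (w ^+ j) * p.1 - complex.Im (w ^+ j) * p.2,
   complex.Im (w ^+ j) * p.1 + complex.Re (w ^+ j) * p.2).
have rotE j p : plane_point (rot j p) = w ^+ j * plane_point p.
  by rewrite /plane_point /rot; case: (w ^+ j) => x y /=; congr (_ +i* _)%C; ring.
have wj1 j : normc (w ^+ j : Cplx R) = 1.
  have := prim_root_norm wM; rewrite normc_E normcX => /complexI ->; exact: expr1n.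
have rotP j : measure_preserving (rot j).
  apply: rotation_preserving.
    have := wj1 j; case: (w ^+ j) => x y /= xy; rewrite -(sqr_sqrtr (_ : 0 <= x ^+ 2 + y ^+ 2)).
      by rewrite xy expr1n.
    by rewrite addr_ge0 ?sqr_ge0.
  apply/eqP => Re1; have wj : w ^+ j = -1.
    have := wj1 j; move: Re1; case: (w ^+ j) => x y /= -> xy.
    have : (-1) ^+ 2 + y ^+ 2 = 1.
      by rewrite -(sqr_sqrtr (_ : 0 <= (-1) ^+ 2 + y ^+ 2)) ?addr_ge0 ?sqr_ge0 // xy expr1n.
    rewrite sqrrN expr1n => /eqP; rewrite -subr_eq0 addrAC subrr add0r sqrf_eq0 => /eqP ->.
    by apply/eqP; rewrite eq_complex /= oppr0 !eqxx.
  have : (w ^+ j) ^+ M = 1 by rewrite exprAC (prim_expr_order wM) expr1n.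
  rewrite wj /M exprS -muln2 mulnC exprM sqrrN !expr1n mulr1 => m1.
  have : (2%:R : R[i]) == 0 by rewrite -[2%N]/(1 + 1)%N natrD -{1}m1 addNr.
  by rewrite pnatr_eq0.
have gE : (\int[mu2]_(p in disc r) (h p)%:E = \int[mu2]_p g p)%E by rewrite integral_mkcond.
have rot_int j : (\int[mu2]_p g p = \int[mu2]_p g (rot j p))%E.
  exact: integral_measure_preserving.
rewrite -[LHS]/(\int[mu2]_(p in disc r) (h p)%:E)%E gE; clear gE.
pose S := \sum_(0 <= n < N) normc (c n) ^+ 2 * (pi * (r ^+ (2 * n.+1) / n.+1%:R)).
suff MI : (M%:R%:E * \int[mu2]_p g p = (M%:R * S)%:E)%E.
  have M0 : (M%:R : R) != 0 by rewrite pnatr_eq0.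
  transitivity ((M%:R^-1)%:E * (M%:R%:E * \int[mu2]_p g p))%E.
    by rewrite muleA -EFinM mulVf // mul1e.
  by rewrite MI -EFinM mulKf.
have rot_disc j p : disc r (rot j p) <-> disc r p.
  have E : normc (plane_point (rot j p)) = normc (plane_point p) by rewrite rotE normcM wj1 mul1r.
  by rewrite /disc /mkset E.
transitivity (\sum_(j < M) \int[mu2]_p g (rot j p))%E.
  under eq_bigr => j _ do rewrite -rot_int.
  by rewrite sumr_const card_ord mule_natl.
have mgrot (j : 'I_M) : measurable_fun setT (fun p => g (rot j p)).
  by apply: measurableT_comp => //; case: (rotP j).
have gsum := @ge0_integral_sum _ _ _ mu2 _ measurableT 'I_M (fun j p => g (rot j p)) mgrot
  (fun j p _ => g0 (rot j p)) (index_enum 'I_M).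
rewrite -[LHS]gsum {gsum}.
transitivity (\int[mu2]_(p in disc r) (\sum_(n < N) (M%:R * normc (c n) ^+ 2)%:E * (sqdist p ^+ n)%:E))%E.
  rewrite [RHS]integral_mkcond; apply: eq_integral => p _; rewrite patchE.
  case: ifPn => [|pD].
    rewrite inE => pD; transitivity (\sum_(j < M) (h (rot j p))%:E)%E.
      by apply: eq_bigr => j _; rewrite /g patchE mem_set //; apply/rot_disc.
    have -> : (\sum_(n < N) (M%:R * normc (c n) ^+ 2)%:E * (sqdist p ^+ n)%:E =
       \sum_(n < N) (M%:R * normc (c n) ^+ 2 * sqdist p ^+ n)%:E)%E.
      by apply: eq_bigr => n _; rewrite -EFinM.
    rewrite !sumEFin; congr EFin; rewrite /h.
    under eq_bigr => j _ do rewrite rotE.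
    rewrite (sum_rotations (plane_point p) c wM NM) mulr_sumr big_mkord; apply: eq_bigr => n _.
    by rewrite normc_plane_point mulrA.
  rewrite big1 // => j _; rewrite /g patchE; case: ifPn => //; rewrite inE => /rot_disc pD'.
  by move: pD; rewrite notin_setE.
have mX n : measurable_fun (disc r) (fun p => (sqdist p ^+ n)%:E).
  apply/measurable_EFinP; apply: measurable_funX; apply: measurable_funTS; exact: measurable_sqdist.
have sX0 n p : (0 <= (@sqdist R p ^+ n)%:E)%E by rewrite lee_fin exprn_ge0 ?sqdist_ge0.
have cM0 n : 0 <= M%:R * normc (c n) ^+ 2 by rewrite mulr_ge0 ?sqr_ge0.
have mXc (n : 'I_N) : measurable_fun (disc r) (fun p => (M%:R * normc (c n) ^+ 2)%:E * (sqdist p ^+ n)%:E)%E.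
  exact: measurable_funeM.
have sXc (n : 'I_N) p : disc r p -> (0 <= (M%:R * normc (c n) ^+ 2)%:E * (sqdist p ^+ n)%:E)%E.
  by move=> _; apply: mule_ge0; [rewrite lee_fin; exact: cM0|exact: sX0].
have gsum := @ge0_integral_sum _ _ _ mu2 _ (measurable_disc r0) 'I_N
  (fun n p => (M%:R * normc (c n) ^+ 2)%:E * (sqdist p ^+ n)%:E)%E mXc sXc (index_enum 'I_N).
rewrite [LHS]gsum {gsum}.
transitivity (\sum_(n < N) (M%:R * (normc (c n) ^+ 2 * (pi * (r ^+ (2 * n.+1) / n.+1%:R))))%:E)%E.
  apply: eq_bigr => n _; rewrite ge0_integralZl_EFin //; [|exact: measurable_disc].
  by rewrite discE // integral_radial_power // -EFinM -!mulrA.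
by rewrite sumEFin /S mulr_sumr big_mkord.
Qed.
End AreaSeries.

Section AreaLimit.
Variable R : realType.
Local Notation mu := (@lebesgue_measure R).
Local Notation plane := (measurableTypeR R * measurableTypeR R)%type.
Local Notation mu2 := (mu \x mu)%E.

Lemma measurable_poly_sqr (c : nat -> Cplx R) N : measurable_fun setT
  (fun p : plane => (normc (\sum_(0 <= n < N) c n * plane_point p ^+ n) ^+ 2)%:E).
Proof. by apply/measurable_EFinP; apply: measurable_normc_sqr; exact: cmeasurable_poly. Qed.

(** Dominated convergence: the partial sums of the derivative are bounded by 1 / (1 - r)^2 on the
    disc of radius r, and their integrals are known. *)
Lemma area_cvg (f : Cplx R -> Cplx R) (a : nat -> Cplx R) r :
  power_series_on_disc f a -> (forall n, normc (a n) <= 1) -> 0 <= r < 1 ->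
  (fun N => pi * \sum_(1 <= n < N) n%:R * normc (a n) ^+ 2 * r ^+ (2 * n)) @ \oo --> area f r.
Proof.
move=> fa a1 r01; have /andP[r0 r1] := r01.
pose c n : Cplx R := n.+1%:R * a n.+1.
pose P N (z : Cplx R) := \sum_(0 <= n < N) c n * z ^+ n.
pose K : R := 1 / (1 - r) ^+ 2.
have Pf (z : Cplx R) : normc z < 1 -> (fun N => P N z) @ \oo --> derive1 f z.
  move=> z1; have [d [B B0 [dP -> _]]] := power_series_taylor fa a1 z1.
  rewrite -cvg_shiftS in dP.
  have -> : (fun N => P N z) = [sequence series (fun n => a n * (n%:R * z ^+ n.-1)) n.+1]_n => //.
  apply/funext => N; rewrite /series /= big_ltn // mul0r mulr0 add0r big_add1 /=.
  by apply: eq_bigr => n _; rewrite /c mulrCA mulrA.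
have PK N (z : Cplx R) : normc z < r -> normc (P N z) <= K.
  move=> zr; apply: le_trans (normc_sum _ _ _) _; apply: le_trans (sum_derived_geometric_le N r01).
  apply: ler_sum => n _; rewrite /c !normcM normc_nat normcX -mulrA ler_wpM2l //.
  rewrite -[leRHS]mul1r; apply: ler_pM; rewrite ?normc_ge0 ?exprn_ge0 ?normc_ge0 //.
  by rewrite lerXn2r ?nnegrE ?normc_ge0 // ltW.
have mD := measurable_disc r0.
pose F N (p : plane) : \bar R := (normc (P N (plane_point p)) ^+ 2)%:E.
pose G (p : plane) : \bar R := (normc (derive1 f (plane_point p)) ^+ 2)%:E.
have mF N : measurable_fun (disc r) (F N).
  exact: (measurable_funTS (measurable_poly_sqr c N)).
have FG p : disc r p -> F ^~ p @ \oo --> G p.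
  move=> pr; apply: cvg_EFin; first by near=> N.
  apply: (@cvg_comp _ _ _ _ (fun x : R => x ^+ 2)); last exact: exprn_continuous.
  by apply: cvg_normc; apply: Pf; exact: lt_trans r1.
have mG : measurable_fun (disc r) G.
  by apply: (emeasurable_fun_cvg F).
have discfin : mu2 (disc r) = (pi * r ^+ 2)%:E.
  have := integral_radial_power 0 r0; rewrite -discE //.
  under eq_integral do rewrite expr0.
  by rewrite integral_cst // mul1e => ->; rewrite divr1.
have iK : mu2.-integrable (disc r) (cst (K ^+ 2)%:E).
  apply/integrableP; split; first exact: measurable_cst.
  by rewrite /= integral_cst //= [X in (_ * X)%E]discfin -EFinM ltry.
have FK : forall p N, disc r p -> (`|F N p| <= cst (K ^+ 2)%:E p)%E.
  move=> p N pr; rewrite /F /= lee_fin ger0_norm ?sqr_ge0 //.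
  have K0 : 0 <= K by rewrite /K divr_ge0 ?sqr_ge0.
  by rewrite lerXn2r ?nnegrE ?normc_ge0 //; exact: PK.
have [iG _ lim] := @dominated_convergence _ _ _ mu2 (disc r) mD F G (cst (K ^+ 2)%:E) mF mG
  (aeW _ FG) iK (aeW _ FK).
have fin := integrable_fin_num mD iG.
rewrite -(fineK fin) in lim; have := fine_cvg lim; rewrite /= -[fine _]/(area f r) => lim'.
have E N : pi * (\sum_(1 <= n < N.+1) n%:R * normc (a n) ^+ 2 * r ^+ (2 * n)) =
    fine (\int[mu2]_(p in disc r) F N p)%E.
  rewrite /F /P (integral_disc_poly c N r0) /= mulr_sumr big_add1 /=; apply: eq_bigr => n _.
  rewrite /c normcM normc_nat exprMn; field.
  by rewrite addrC natr1 pnatr_eq0.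
rewrite -cvg_shiftS (eq_cvg _ _ E); exact: lim'.
Unshelve. all: by end_near.
Qed.
End AreaLimit.

(** * Numerical location of the root *)

Section Numerics.
Variable R : realType.
Local Notation s17 := (Num.sqrt 17%:R : R).

Lemma sqr_s17 : s17 ^+ 2 = 17.
Proof. by rewrite sqr_sqrtr // ler0n. Qed.

(** The combinations u + v sqrt 17 in Psi2, E1 and E2 are small differences of large numbers, which
    takes many decimals of sqrt 17; 29 leave a margin. *)
Definition s17_lo : R := 412310562561766054982140985597%:R / 10%:R ^+ 29.
Definition s17_hi : R := 412310562561766054982140985598%:R / 10%:R ^+ 29.

Lemma s17_bounds : s17_lo < s17 < s17_hi.
Proof.
have s0 : 0 <= s17 by exact: sqrtr_ge0.
apply/andP; split.
  rewrite -(ltr_pXn2r (ltn0Sn 1)) ?nnegrE // ?sqr_s17 /s17_lo; lra.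
rewrite -(ltr_pXn2r (ltn0Sn 1)) ?nnegrE // ?sqr_s17 /s17_hi; lra.
Qed.

(** The coefficients of (Psi2 t - Psi2 0) / t, lowest degree first, for a Horner evaluation. *)
Definition Psi2_tail : seq R := [:: 64%:R * (- 207084487%:R + 50225361%:R * s17);
    - (32%:R * (- 1297411581%:R + 314668555%:R * s17));
    32440299472%:R - 7867928752%:R * s17;
    16%:R * (- 10605671261%:R + 2572253099%:R * s17);
    85784031284%:R - 20805683692%:R * s17;
    197798732932%:R - 47973239324%:R * s17;
    - 193832516055%:R + 47011290433%:R * s17;
    - 132672807253%:R + 32177882227%:R * s17;
    75432873692%:R - 18295159172%:R * s17;
    170513297282%:R - 41355549134%:R * s17;
    - 33414320906%:R + 8104163206%:R * s17;
    2%:R * (- 22164247583%:R + 5375619641%:R * s17)].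

Definition Psi2_head : R := 128%:R * (- 12782703%:R + 3100265%:R * s17).

Definition E1_coefs : seq R := [:: 321568%:R - 77024%:R * s17;
    8%:R * (- 1166421%:R + 282995%:R * s17);
    2287452%:R - 554244%:R * s17;
    16%:R * (- 974531%:R + 236341%:R * s17);
    - (40%:R * (- 181177%:R + 43951%:R * s17));
    88788654%:R - 21534594%:R * s17;
    7%:R * (- 2416805%:R + 586147%:R * s17);
    32%:R * (- 3664887%:R + 888865%:R * s17);
    36%:R * (- 1952633%:R + 473583%:R * s17)].

Definition E2_coefs : seq R := [:: 8%:R * (- 251%:R + 61%:R * s17);
    - 33442%:R + 8110%:R * s17;
    - (3%:R * (- 36847%:R + 8937%:R * s17));
    7%:R * (- 11351%:R + 2753%:R * s17)].

Lemma Psi2_horner (t : R) : Psi2 t = Psi2_head + t * horner_rec Psi2_tail t.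
Proof. by rewrite /Psi2 /Psi2_head /Psi2_tail /horner_rec; ring. Qed.

Lemma E1_horner (t : R) : E1 t = horner_rec E1_coefs t.
Proof. by rewrite /E1 /E1_coefs /horner_rec; ring. Qed.

Lemma E2_horner (t : R) : E2 t = horner_rec E2_coefs t.
Proof. by rewrite /E2 /E2_coefs /horner_rec; ring. Qed.

Lemma horner_rec_neg (cs : seq R) (t u : R) : all (fun c => c < 0) cs -> 0 <= t <= u ->
  horner_rec cs u <= horner_rec cs t <= 0.
Proof.
elim: cs => [|c cs IH] /=; first by rewrite !lexx.
move=> /andP[c0 /IH {}IH] tu; have /andP[h1 h2] := IH tu; have /andP[t0 tu'] := tu.
have : horner_rec cs u * u <= horner_rec cs t * t by nra.
have : horner_rec cs t * t <= 0 by rewrite mulr_le0_ge0.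
by move=> h3 h4; apply/andP; split; lra.
Qed.

Lemma continuous_horner_rec (cs : seq R) : continuous (horner_rec cs).
Proof.
elim: cs => [|c cs IH] x /=; first exact: cvg_cst.
by apply: cvgD; [apply: cvgM => //; exact: IH|exact: cvg_cst].
Qed.

(** A crude Lipschitz constant; the interval of width 10^-10 around the root absorbs it. *)
Lemma horner_rec_lipschitz (cs : seq R) (C t u : R) : all (fun c => `|c| <= C) cs ->
  0 <= t <= 1 -> 0 <= u <= 1 ->
  `|horner_rec cs t| <= C *+ size cs /\
  `|horner_rec cs t - horner_rec cs u| <= C *+ (size cs ^ 2) * `|t - u|.
Proof.
move=> + t01 u01; have /andP[t0 t1] := t01; have /andP[u0 u1] := u01.
elim: cs => [|c cs IH] /=; first by rewrite subrr normr0 mulr0n mul0r.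
move=> /andP[cC /IH[h1 h2]]; set h := horner_rec cs t in h1 h2 *; set k := horner_rec cs u in h2 *.
have sq : (size cs + size cs ^ 2 <= (size cs).+1 ^ 2)%N.
  by rewrite -!mulnn -mulnS leq_mul2r leqnSn orbT.
have ht : `|h * t| <= `|h| by rewrite normrM ler_piMr // ger0_norm.
split; first by apply: le_trans (ler_normD _ _) _; rewrite mulrSr lerD // (le_trans ht).
have -> : h * t + c - (k * u + c) = h * (t - u) + (h - k) * u by ring.
apply: le_trans (ler_normD _ _) _; rewrite !normrM (ger0_norm u0).
have hu : `|h - k| * u <= `|h - k| by rewrite ler_piMr.
have d0 : 0 <= `|t - u| by [].
have C0 : 0 <= C by exact: le_trans cC.
have := ler_wpM2r d0 h1; move: hu h2.
set x := `|h - k|; set d := `|t - u| in d0 *.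
have : C *+ size cs * d + C *+ (size cs ^ 2) * d <= C *+ ((size cs).+1 ^ 2) * d.
  by rewrite -mulrDl -mulrnDr ler_wpM2r // ler_wpMn2l.
lra.
Qed.

Lemma Psi2_tail_neg : all (fun c => c < 0) Psi2_tail.
Proof.
have /andP[] := s17_bounds; rewrite /s17_lo /s17_hi /Psi2_tail => lo hi; cbn [all].
by do 12?[apply/andP; split; first lra].
Qed.

Lemma Psi2_decreasing (t u : R) : 0 <= t < u -> Psi2 u < Psi2 t.
Proof.
move=> /andP[t0 tu]; rewrite !Psi2_horner ltrD2l.
have u0 : 0 < u by exact: le_lt_trans tu.
have tu' : 0 <= t <= u by rewrite t0 ltW.
have /andP[h1 h2] := horner_rec_neg Psi2_tail_neg tu'.
have uu : 0 <= u <= u by rewrite lexx ltW.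
have : horner_rec Psi2_tail u < 0.
  have := Psi2_tail_neg; have : Psi2_tail != [::] by [].
  case: Psi2_tail => // c cs _ /= /andP[c0 cs0].
  have /andP[_ k0] := horner_rec_neg cs0 uu.
  have : horner_rec cs u * u <= 0 by rewrite mulr_le0_ge0 // ltW.
  lra.
nra.
Qed.

Lemma Psi2_root_between (l h : R) : l <= h -> 0 < Psi2 l -> Psi2 h < 0 ->
  exists2 t, l <= t <= h & Psi2 t = 0.
Proof.
move=> lh l0 h0; have cP : {within [set` `[l, h]], continuous (@Psi2 R)}.
  apply: continuous_subspaceT; have -> : @Psi2 R = fun t => Psi2_head + t * horner_rec Psi2_tail t.
    by apply/funext => t; exact: Psi2_horner.
  move=> x; apply: cvgD; first exact: cvg_cst.
  by apply: cvgM => //; exact: continuous_horner_rec.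
have [|t tI t0] := IVT lh cP (v := 0); last by exists t => //; rewrite in_itv in tI.
by rewrite ge_min le_max (ltW l0) (ltW h0) orbT.
Qed.

Definition root_lo : R := 5656714785%:R / 10%:R ^+ 10.
Definition root_hi : R := 5656714786%:R / 10%:R ^+ 10.

Lemma Psi2_root_lo : 0 < Psi2 root_lo.
Proof. have /andP[] := s17_bounds; rewrite /s17_lo /s17_hi /Psi2 /root_lo; lra. Qed.

Lemma Psi2_root_hi : Psi2 root_hi < 0.
Proof. have /andP[] := s17_bounds; rewrite /s17_lo /s17_hi /Psi2 /root_hi; lra. Qed.

Lemma Psi2_root_exists : exists2 t, root_lo <= t <= root_hi & Psi2 t = 0.
Proof.
apply: Psi2_root_between Psi2_root_lo Psi2_root_hi.
rewrite /root_lo /root_hi; lra.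
Qed.

Lemma horner_rec_near (cs : seq R) (C l d t : R) : all (fun c => `|c| <= C) cs ->
  0 <= l -> l + d <= 1 -> l <= t <= l + d ->
  `|horner_rec cs t - horner_rec cs l| <= C *+ (size cs ^ 2) * d.
Proof.
move=> csC l0 ld1 /andP[tl th]; have C0 : cs != [::] -> 0 <= C.
  by case: cs csC => //= c cs /andP[cC _] _; exact: le_trans cC.
have [||_] := @horner_rec_lipschitz cs C t l csC.
- by apply/andP; split; lra.
- by apply/andP; split; lra.
move/le_trans; apply; have [->|/C0 {}C0] := eqVneq cs [::]; first by rewrite !mulr0n !mul0r.
by rewrite ler_wpM2l ?mulrn_wge0 // ger0_norm ?subr_ge0 // lerBlDl.
Qed.

Lemma E1_lipschitz (l d t : R) : 0 <= l -> l + d <= 1 -> l <= t <= l + d ->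
  `|E1 t - E1 l| <= 5000%:R *+ 81 * d.
Proof.
move=> l0 ld1 tI; have /andP[] := s17_bounds; rewrite /s17_lo /s17_hi => slo shi.
have C : all (fun c => `|c| <= 5000%:R) E1_coefs.
  rewrite /E1_coefs; cbn [all].
  by do 9?[apply/andP; split; first by rewrite ler_norml; apply/andP; split; lra].
have := horner_rec_near C l0 ld1 tI; rewrite -(E1_horner t) -(E1_horner l).
exact.
Qed.

Lemma E2_lipschitz (l d t : R) : 0 <= l -> l + d <= 1 -> l <= t <= l + d ->
  `|E2 t - E2 l| <= 5%:R *+ 16 * d.
Proof.
move=> l0 ld1 tI; have /andP[] := s17_bounds; rewrite /s17_lo /s17_hi => slo shi.
have C : all (fun c => `|c| <= 5%:R) E2_coefs.
  rewrite /E2_coefs; cbn [all].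
  by do 4?[apply/andP; split; first by rewrite ler_norml; apply/andP; split; lra].
have := horner_rec_near C l0 ld1 tI; rewrite -(E2_horner t) -(E2_horner l).
exact.
Qed.

Lemma root_interval (t : R) : root_lo <= t <= root_hi ->
  [/\ 0 <= root_lo, root_lo + 1 / 10%:R ^+ 10 <= 1 & root_lo <= t <= root_lo + 1 / 10%:R ^+ 10].
Proof.
rewrite /root_lo /root_hi => /andP[tl th]; split; [lra|lra|].
by apply/andP; split; lra.
Qed.

Lemma E1_near_root (t : R) : root_lo <= t <= root_hi ->
  6084615%:R / 10%:R ^+ 3 < E1 t < 60846152%:R / 10%:R ^+ 4.
Proof.
move=> /root_interval[l0 ld1 tI]; have := E1_lipschitz l0 ld1 tI; rewrite -mulr_natr.
move: (E1 t) => x; rewrite ler_norml => /andP[].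
have /andP[] := s17_bounds; rewrite /s17_lo /s17_hi /E1 /root_lo => *.
by apply/andP; split; lra.
Qed.

Lemma E2_near_root (t : R) : root_lo <= t <= root_hi ->
  7701376%:R / 10%:R ^+ 7 < E2 t < 7701378%:R / 10%:R ^+ 7.
Proof.
move=> /root_interval[l0 ld1 tI]; have := E2_lipschitz l0 ld1 tI; rewrite -mulr_natr.
move: (E2 t) => x; rewrite ler_norml => /andP[].
have /andP[] := s17_bounds; rewrite /s17_lo /s17_hi /E2 /root_lo => *.
by apply/andP; split; lra.
Qed.

Lemma mu_near_root (t : R) : root_lo <= t <= root_hi ->
  160824%:R / (10%:R ^+ 4) <= mu t < 160825%:R / (10%:R ^+ 4).
Proof.
move=> tI; have /andP[a1 a2] := E1_near_root tI; have /andP[b1 b2] := E2_near_root tI.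
have : (1 + root_lo) ^+ 3 <= (1 + t) ^+ 3 <= (1 + root_hi) ^+ 3.
  move: tI => /andP[]; rewrite /root_lo /root_hi => tl th.
  by rewrite !lerXn2r ?nnegrE //; lra.
rewrite /mu /root_lo /root_hi => /andP[c1 c2].
set c := (1 + t) ^+ 3 in c1 c2 *; set x := E1 t in a1 a2 *; set y := E2 t in b1 b2 *.
have y0 : 0 < y by lra.
have c0 : 0 < c by lra.
have D0 : 0 < 128%:R * c * y by apply: mulr_gt0 y0; apply: mulr_gt0 c0; rewrite ltr0n.
have l1 : c * y <= 38379731%:R / 10%:R ^+ 7 * (7701378%:R / 10%:R ^+ 7).
  by apply: ler_pM; lra.
have l2 : 38379730%:R / 10%:R ^+ 7 * (7701376%:R / 10%:R ^+ 7) <= c * y.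
  by apply: ler_pM; lra.
rewrite ler_pdivlMr // ltr_pdivrMr //; apply/andP; split; lra.
Qed.
End Numerics.

(** * The extremal problem in one variable *)

Section Extremal.
Variable R : realType.
Local Notation s17 := (Num.sqrt 17%:R : R).

(** The defect is the difference between 1 and the majorant without its last term, at the largest
    radius. This polynomial in t, with s the square root of 17, is what remains of its numerator
    after division by (1 - t)^3. *)
Definition bohr_gap (s t : R) : R :=
  (409%:R - 95%:R * s) / 64%:R + t * ((54%:R - 10%:R * s) / 64%:R + t * ((677%:R * s - 2771%:R) / 256%:R
    + t * ((459%:R - 109%:R * s) / 256%:R + t * ((689%:R - 167%:R * s) / 64%:R
    + t * ((367%:R - 89%:R * s) / 64%:R))))).

(** The quotient bohr_num / bohr_den is the defect divided by the square of
    (1 - t^2)^2 / (1 - r_max^2 t^4), which is S / (pi - S) up to the factor area_ratio. *)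
Definition bohr_num (s t : R) : R :=
  bohr_gap s t * (1 - (13%:R - 3%:R * s) / 8%:R * (t * t * t * t)).

Definition bohr_den (s t : R) : R :=
  (1 - t) * ((1 + t) * (1 + t) * ((1 + t) * (1 + t))) *
  ((1 + (s - 3%:R) / 4%:R * t) * (1 + (s - 3%:R) / 4%:R * t)).

Definition bohr_num' (s t : R) : R :=
  ((54%:R - 10%:R * s) / 64%:R + t * (2%:R * ((677%:R * s - 2771%:R) / 256%:R)
    + t * (3%:R * ((459%:R - 109%:R * s) / 256%:R) + t * (4%:R * ((689%:R - 167%:R * s) / 64%:R)
    + t * (5%:R * ((367%:R - 89%:R * s) / 64%:R)))))) * (1 - (13%:R - 3%:R * s) / 8%:R * (t * t * t * t)) -
  bohr_gap s t * (4%:R * ((13%:R - 3%:R * s) / 8%:R * (t * t * t))).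

Definition bohr_den' (s t : R) : R :=
  (1 + t) ^+ 3 * (1 + (s - 3%:R) / 4%:R * t) *
  ((4%:R * (1 - t) - (1 + t)) * (1 + (s - 3%:R) / 4%:R * t) + 2%:R * ((s - 3%:R) / 4%:R) * (1 - t) * (1 + t)).

Lemma is_derive_bohr_num (s t : R) : is_derive t 1 (bohr_num s) (bohr_num' s t).
Proof.
rewrite /bohr_num /bohr_gap; apply: is_derive_eq; rewrite /GRing.scale /= /bohr_num' /bohr_gap; ring.
Qed.

Lemma is_derive_bohr_den (s t : R) : is_derive t 1 (bohr_den s) (bohr_den' s t).
Proof.
rewrite /bohr_den; apply: is_derive_eq; rewrite /GRing.scale /= /bohr_den'; ring.
Qed.

Definition wronskian_c0 : R := 46611968%:R * s17 - 192188928%:R.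
Definition wronskian_c1 : R := 342242560%:R - 83006208%:R * s17.

(** The reduced numerator of the derivative has degree 11 and Psi2 has degree 12: besides it, Psi2
    has an affine factor, which is negative for t >= 0. *)
Lemma bohr_wronskian (t : R) :
  (bohr_num' s17 t * bohr_den s17 t - bohr_num s17 t * bohr_den' s17 t) *
    (wronskian_c0 + wronskian_c1 * t) =
  (1 + t) ^+ 3 * (1 + (s17 - 3%:R) / 4%:R * t) * Psi2 t.
Proof.
have := sqr_s17 R.
rewrite /bohr_num' /bohr_den /bohr_num /bohr_den' /bohr_gap /Psi2 /wronskian_c0 /wronskian_c1.
move: s17 => s s2; by field: s2.
Qed.

Lemma wronskian_c0_neg : wronskian_c0 < 0.
Proof. by have /andP[] := s17_bounds R; rewrite /s17_lo /s17_hi /wronskian_c0; lra. Qed.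

Lemma wronskian_c1_neg : wronskian_c1 < 0.
Proof. by have /andP[] := s17_bounds R; rewrite /s17_lo /s17_hi /wronskian_c1; lra. Qed.

Lemma wronskian_cofactor_neg (t : R) : 0 <= t -> wronskian_c0 + wronskian_c1 * t < 0.
Proof.
move=> t0; move: wronskian_c0_neg wronskian_c1_neg; move: wronskian_c0 wronskian_c1 => x y x0 y0.
by have : y * t <= 0 by [rewrite mulr_le0_ge0 // ltW]; lra.
Qed.

Lemma s17_gt4_lt5 : 4 < s17 < 5.
Proof. by have /andP[] := s17_bounds R; rewrite /s17_lo /s17_hi => *; apply/andP; split; lra. Qed.

Lemma bohr_den_gt0 (t : R) : 0 <= t < 1 -> 0 < bohr_den s17 t.
Proof.
move=> /andP[t0 t1]; have /andP[s1 s2] := s17_gt4_lt5; rewrite /bohr_den.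
move: s17 s1 s2 => s s1 s2; have u0 : 0 < 1 + (s - 3%:R) / 4%:R * t.
  by have : 0 <= (s - 3%:R) / 4%:R * t by [apply: mulr_ge0 => //; lra]; lra.
have v0 : 0 < 1 + t by lra.
have w0 : 0 < 1 - t by lra.
exact: (mulr_gt0 (mulr_gt0 w0 (mulr_gt0 (mulr_gt0 v0 v0) (mulr_gt0 v0 v0))) (mulr_gt0 u0 u0)).
Qed.

(** The derivative of f / g has the sign of f' g - f g'. *)
Lemma quotient_le (f g f' g' : R -> R) (x y : R) : x <= y ->
  (forall t : R, is_derive t 1 f (f' t)) -> (forall t : R, is_derive t 1 g (g' t)) ->
  (forall t, x <= t <= y -> 0 < g t) ->
  (forall t, x < t < y -> 0 <= f' t * g t - f t * g' t) -> f x / g x <= f y / g y.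
Proof.
move=> xy df dg g0 W; pose h (t : R) : R := f t * (g t)^-1.
have dh (t : R) : x <= t <= y -> is_derive t 1 h ((f' t * g t - f t * g' t) / g t ^+ 2).
  move=> tI; have gt := g0 t tI; have gn : g t != 0 by rewrite gt_eqF.
  have D := is_deriveM (df t) (is_deriveV gn (dg t)).
  by refine (is_derive_eq D _); rewrite /GRing.scale /=; field.
have xI : x \in `[x, y] by rewrite in_itv /= lexx.
have yI : y \in `[x, y] by rewrite in_itv /= xy lexx.
apply: (@ger0_derive1_le_cc _ h x y) => //.
- move=> t; rewrite in_itv /= => /andP[/ltW t1 /ltW t2].
  by have := dh t; rewrite t1 t2 => /(_ isT) /@ex_derive.
- move=> t; rewrite in_itv /= => tI; have /andP[/ltW t1 /ltW t2] := tI.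
  have := dh t; rewrite t1 t2 => /(_ isT) dht; rewrite derive1E (@derive_val _ _ _ _ _ _ _ dht).
  by rewrite divr_ge0 ?sqr_ge0 ?W.
- apply: continuous_in_subspaceT => t; rewrite inE /= in_itv /= => tI.
  by apply: differentiable_continuous; apply/derivable1_diffP; have /@ex_derive := dh t tI.
Qed.

(** Psi2 changes sign from positive to negative at t0, and the derivative of the quotient
    has the opposite sign. *)
Lemma bohr_quotient_min (a t0 : R) : 0 <= a < 1 -> 0 < t0 < 1 -> Psi2 t0 = 0 ->
  bohr_num s17 t0 / bohr_den s17 t0 <= bohr_num s17 a / bohr_den s17 a.
Proof.
move=> /andP[a0 a1] /andP[t00 t01] P0; have /andP[s4 s5] := s17_gt4_lt5.
have sgn t : 0 <= t -> exists2 k, 0 < k &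
    bohr_num' s17 t * bohr_den s17 t - bohr_num s17 t * bohr_den' s17 t = - (k * Psi2 t).
  move=> tge; have cneg := wronskian_cofactor_neg tge; have := bohr_wronskian t.
  move: cneg; move: (wronskian_c0 + wronskian_c1 * t) => c cneg.
  move: (bohr_num' s17 t * bohr_den s17 t - bohr_num s17 t * bohr_den' s17 t) (Psi2 t) => W P.
  move: s17 s4 s5 => s s4 s5 E.
  exists (- ((1 + t) ^+ 3 * (1 + (s - 3%:R) / 4%:R * t) / c)).
    rewrite oppr_gt0 pmulr_rlt0 ?invr_lt0 //; apply: mulr_gt0; first by rewrite exprn_gt0; lra.
    by have : 0 <= (s - 3%:R) / 4%:R * t by [apply: mulr_ge0 => //; lra]; lra.
  by rewrite mulNr opprK mulrAC -E mulfK // lt_eqF.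
have [at0|t0a] := leP a t0.
  have := @quotient_le (fun t => - bohr_num s17 t) (bohr_den s17)
    (fun t => - bohr_num' s17 t) (bohr_den' s17) a t0 at0.
  rewrite !mulNr lerN2; apply.
  - by move=> t; apply: is_deriveN; exact: is_derive_bohr_num.
  - exact: is_derive_bohr_den.
  - by move=> t /andP[h1 h2]; apply: bohr_den_gt0; apply/andP; split; lra.
  move=> t /andP[h1 h2]; have t0' : 0 <= t by lra.
  have [k k0 E] := sgn t t0'; rewrite !mulNr -opprD E opprK mulr_ge0 ?ltW // -P0.
  by apply: Psi2_decreasing; rewrite t0'.
have := @quotient_le (bohr_num s17) (bohr_den s17) (bohr_num' s17) (bohr_den' s17) t0 a (ltW t0a).
apply.
- exact: is_derive_bohr_num.
- exact: is_derive_bohr_den.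
- by move=> t /andP[h1 h2]; apply: bohr_den_gt0; apply/andP; split; lra.
move=> t /andP[h1 h2]; have t0' : 0 <= t by lra.
have [k k0 E] := sgn t t0'; rewrite E oppr_ge0 mulr_ge0_le0 ?ltW // -P0.
by apply: Psi2_decreasing; rewrite h1 ltW.
Qed.

(** The values at r_max of r^2 and, for area_ratio, of r^2 / (1 - r^2), as expressions of degree
    1 in the square root of 17. *)
Definition rmax_sqr (s : R) : R := (13%:R - 3%:R * s) / 8%:R.
Definition area_ratio (s : R) : R := (3%:R * s - 11%:R) / 16%:R.

(** The rational functions mu area_ratio^2 and bohr_num / bohr_den of t are different; the left side
    is the numerator of their difference. *)
Lemma mu_numerator (t : R) :
  area_ratio s17 ^+ 2 * E1 t * ((1 - t) * (1 + t) * (1 + (s17 - 3%:R) / 4%:R * t) ^+ 2) -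
    128%:R * bohr_num s17 t * E2 t = - ((s17 + 7%:R) / 256%:R) * ((3%:R * s17 + 5%:R) / 16%:R) ^+ 2 * Psi2 t.
Proof.
have := sqr_s17 R; rewrite /area_ratio /bohr_num /bohr_gap /Psi2 /E1 /E2.
clear; move: s17 => s s2; by field: s2.
Qed.

Lemma mu_bohr_quotient (t : R) : 0 < t < 1 -> Psi2 t = 0 -> E2 t != 0 ->
  mu t * area_ratio s17 ^+ 2 = bohr_num s17 t / bohr_den s17 t.
Proof.
move=> /andP[t0 t1] P0 e2; have := mu_numerator t; rewrite P0 mulr0 => /subr0_eq.
have tI : 0 <= t < 1 by rewrite t1 ltW.
have := bohr_den_gt0 tI; rewrite /mu /bohr_den.
move: e2 (area_ratio s17); move: (E1 t) (E2 t) (bohr_num s17 t) => x y n y0 k.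
move: ((s17 - 3%:R) / 4%:R) => p D0 E.
have tn : 1 + t != 0 by rewrite gt_eqF //; lra.
have tm : 1 - t != 0 by rewrite gt_eqF //; lra.
have pn : 1 + p * t != 0.
  by apply: contraTneq D0 => ->; rewrite !mulr0 ltxx.
have -> : x / (128%:R * (1 + t) ^+ 3 * y) * k ^+ 2 =
   k ^+ 2 * x * ((1 - t) * (1 + t) * (1 + p * t) ^+ 2) /
     (128%:R * (1 + t) ^+ 4 * y * (1 - t) * (1 + p * t) ^+ 2) by field; rewrite y0 tn tm pn.
by rewrite E; field; rewrite y0 tn tm pn.
Qed.

Lemma bohr_gap_identity (a : R) : 0 <= a < 1 ->
  (a + r_max R) / (1 + a * r_max R) + r_max R * (1 - a ^+ 2) / (1 + a * r_max R) ^+ 2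
  + (1 - a ^+ 2) * r_max R ^+ 2 / (1 - r_max R)
  + (221%:R - 43%:R * s17) / 64%:R * (area_ratio s17 * ((1 - a ^+ 2) ^+ 2 / (1 - rmax_sqr s17 * a ^+ 4))) =
  1 - bohr_num s17 a / bohr_den s17 a * ((1 - a ^+ 2) ^+ 2 / (1 - rmax_sqr s17 * a ^+ 4)) ^+ 2.
Proof.
move=> aI; have /andP[a0 a1] := aI; have := bohr_den_gt0 aI.
have /andP[s4 s5] := s17_gt4_lt5.
have q1 : r_max R ^+ 2 / (1 - r_max R) = (5%:R - s17) / 8%:R.
  rewrite /r_max.
  have n0 : 1 - (s17 - 3%:R) / 4%:R != 0 by rewrite gt_eqF //; lra.
  by apply: (mulIf n0); rewrite divfK //; move: (sqr_s17 R); move: s17 => s s2; field: s2.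
rewrite -[(1 - a ^+ 2) * r_max R ^+ 2 / _]mulrA q1 /r_max.
have qlt : 0 <= rmax_sqr s17 <= 1.
  have -> : rmax_sqr s17 = ((s17 - 3%:R) / 4%:R) ^+ 2.
    by rewrite /rmax_sqr; move: (sqr_s17 R); move: s17 => s s2; field: s2.
  rewrite sqr_ge0 /= exprn_ile1 //; lra.
have a4 : a ^+ 4 < 1 by rewrite exprn_ilt1.
have Y0 : 1 - rmax_sqr s17 * a ^+ 4 != 0.
  case/andP: qlt => q0 q1'; rewrite gt_eqF //.
  by have : rmax_sqr s17 * a ^+ 4 <= 1 * a ^+ 4 by [rewrite ler_wpM2r ?exprn_ge0 //]; lra.
have ra : 1 + a * ((s17 - 3%:R) / 4%:R) != 0.
  by rewrite gt_eqF //; have : 0 <= a * ((s17 - 3%:R) / 4%:R) by [apply: mulr_ge0 => //; lra]; lra.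
have am : 1 - a != 0 by rewrite gt_eqF //; lra.
have ap : 1 + a != 0 by rewrite gt_eqF //; lra.
move: Y0 ra; rewrite /bohr_num /bohr_den /bohr_gap /area_ratio /rmax_sqr.
have := sqr_s17 R; move: s17 => s s2 Y0 ra _.
have Y1 : 8%:R - (13%:R - 3%:R * s) * a ^+ 4 != 0.
  have -> : 8%:R - (13%:R - 3%:R * s) * a ^+ 4 = 8%:R * (1 - (13%:R - 3%:R * s) / 8%:R * a ^+ 4) by field.
  by rewrite mulf_neq0 // pnatr_eq0.
have ra1 : 4%:R + (s - 3%:R) * a != 0.
  have -> : 4%:R + (s - 3%:R) * a = 4%:R * (1 + a * ((s - 3%:R) / 4%:R)) by field.
  by rewrite mulf_neq0 // pnatr_eq0.
by field: s2; rewrite am ap ra1 Y1.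
Qed.

Lemma r_max_bounds : 1 / 4%:R < r_max R < 1 / 2%:R.
Proof. by have /andP[] := s17_gt4_lt5; rewrite /r_max => *; apply/andP; split; lra. Qed.

Lemma r_max_sqrE : r_max R ^+ 2 = rmax_sqr s17.
Proof. by rewrite /r_max /rmax_sqr; move: (sqr_s17 R); move: s17 => s s2; field: s2. Qed.

Lemma area_ratioE : rmax_sqr s17 / (1 - rmax_sqr s17) = area_ratio s17.
Proof.
have n0 : 1 - rmax_sqr s17 != 0.
  by have /andP[] := s17_gt4_lt5; rewrite /rmax_sqr => *; rewrite gt_eqF //; lra.
apply: (mulIf n0); rewrite divfK //; rewrite /area_ratio /rmax_sqr.
by move: (sqr_s17 R); clear; move: s17 => s s2; field: s2.
Qed.

(** The value of J m for the function (a - z) / (1 - a z) at z = - r, see J_moebius; x is its area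
    divided by pi. *)
Definition bohr_majorant (m a r : R) : R :=
  let x := r ^+ 2 * (1 - a ^+ 2) ^+ 2 / (1 - a ^+ 2 * r ^+ 2) ^+ 2 in
  (a + r) / (1 + a * r) + r * (1 - a ^+ 2) / (1 + a * r) ^+ 2 + (1 - a ^+ 2) * r ^+ 2 / (1 - r)
  + (221%:R - 43%:R * s17) / 64%:R * (x / (1 - x)) + m * (x / (1 - x)) ^+ 2.

Lemma area_quotient (a q : R) : 0 <= a <= 1 -> 0 <= q < 1 ->
  let x := q * (1 - a ^+ 2) ^+ 2 / (1 - a ^+ 2 * q) ^+ 2 in
  x < 1 /\ x / (1 - x) = q / (1 - q) * ((1 - a ^+ 2) ^+ 2 / (1 - q * a ^+ 4)).
Proof.
move=> /andP[a0 a1] /andP[q0 q1] x.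
have A1 : a ^+ 2 <= 1 by rewrite exprn_ile1.
have A0 : 0 <= a ^+ 2 by exact: sqr_ge0.
have B1 : a ^+ 4 <= 1 by rewrite exprn_ile1.
have aq : a ^+ 2 * q < 1 by apply: le_lt_trans q1; rewrite ler_piMl.
have aq4 : q * a ^+ 4 < 1 by apply: le_lt_trans q1; rewrite ler_piMr.
have n1 : 1 - a ^+ 2 * q != 0 by rewrite gt_eqF //; lra.
have n2 : 1 - q * a ^+ 4 != 0 by rewrite gt_eqF //; lra.
have n3 : 1 - q != 0 by rewrite gt_eqF //; lra.
have xE : 1 - x = (1 - q) * (1 - q * a ^+ 4) / (1 - a ^+ 2 * q) ^+ 2 by rewrite /x; field.
have x1 : 0 < 1 - x by rewrite xE divr_gt0 ?exprn_gt0 ?mulr_gt0 ?subr_gt0.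
split; first lra.
by rewrite xE /x; field; rewrite n1 n2 n3.
Qed.

Lemma bohr_majorantE (m a : R) : 0 <= a < 1 ->
  bohr_majorant m a (r_max R) = 1 - bohr_num s17 a / bohr_den s17 a *
    ((1 - a ^+ 2) ^+ 2 / (1 - rmax_sqr s17 * a ^+ 4)) ^+ 2 +
  m * area_ratio s17 ^+ 2 * ((1 - a ^+ 2) ^+ 2 / (1 - rmax_sqr s17 * a ^+ 4)) ^+ 2.
Proof.
move=> aI; have /andP[a0 a1] := aI; have := bohr_gap_identity aI.
have /andP[r1 r2] := r_max_bounds.
have q01 : 0 <= r_max R ^+ 2 < 1 by rewrite sqr_ge0 /= exprn_ilt1 //; lra.
have aI' : 0 <= a <= 1 by rewrite a0 ltW.
have [_ xE] := area_quotient aI' q01; rewrite /bohr_majorant xE r_max_sqrE area_ratioE.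
by move=> <-; rewrite exprMn [m * (_ * _)]mulrA.
Qed.

Lemma E2_root_neq0 (t : R) : root_lo R <= t <= root_hi R -> E2 t != 0.
Proof.
move=> /E2_near_root/andP[h _]; rewrite gt_eqF //; apply: lt_trans h.
by rewrite divr_gt0 ?exprn_gt0 ?ltr0n.
Qed.

Lemma bohr_majorant_le1 (t a : R) : root_lo R <= t <= root_hi R -> Psi2 t = 0 -> 0 <= a <= 1 ->
  bohr_majorant (mu t) a (r_max R) <= 1.
Proof.
move=> tI P0 /andP[a0]; rewrite le_eqVlt => /predU1P[->|a1].
  have /andP[r1 r2] := r_max_bounds.
  rewrite /bohr_majorant expr1n subrr expr0n !(mulr0, mul0r) addr0 expr0n !mulr0 !addr0 mul1r divff //.
  by rewrite gt_eqF //; lra.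
have aI : 0 <= a < 1 by rewrite a0.
have t01 : 0 < t < 1 by move: tI => /andP[]; rewrite /root_lo /root_hi => *; apply/andP; split; lra.
have e2 := E2_root_neq0 tI.
rewrite bohr_majorantE // mu_bohr_quotient //.
have := bohr_quotient_min aI t01 P0; set y := (_ / _) ^+ 2; have y0 : 0 <= y by exact: sqr_ge0.
by move=> /(ler_wpM2r y0); lra.
Qed.

Lemma bohr_majorant_eq1 (t : R) : root_lo R <= t <= root_hi R -> Psi2 t = 0 ->
  bohr_majorant (mu t) t (r_max R) = 1.
Proof.
move=> tI P0.
have t01 : 0 < t < 1 by move: tI => /andP[]; rewrite /root_lo /root_hi => *; apply/andP; split; lra.
have e2 := E2_root_neq0 tI.
have tI' : 0 <= t < 1 by case/andP: t01 => h ->; rewrite ltW.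
by rewrite bohr_majorantE // mu_bohr_quotient // subrK.
Qed.

End Extremal.

(** * The functional is bounded by its value at Moebius functions *)

Section Majorant.
Variable R : realType.
Local Notation s17 := (Num.sqrt 17%:R : R).
Implicit Types (f : Cplx R -> Cplx R) (a : nat -> Cplx R) (z w : Cplx R).

Lemma limit_ge_bound (u : nat -> R) l K : u @ \oo --> l -> (forall n, K <= u n) -> K <= l.
Proof.
move=> ul Ku; rewrite -(cvg_lim (@Rhausdorff R) ul); apply: limr_ge; last by near=> n.
by apply/cvg_ex; eexists; exact: ul.
Unshelve. all: by end_near.
Qed.

Lemma limit_le_bound (u : nat -> R) l K : u @ \oo --> l -> (forall n, u n <= K) -> l <= K.
Proof.
move=> ul uK; rewrite -(cvg_lim (@Rhausdorff R) ul); apply: limn_le_bound => //.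
by apply/cvg_ex; eexists; exact: ul.
Qed.

(** The derivative bound leaves t + k (1 - t^2) with k = r / (1 - r^2). Since k <= 1/2 for
    r < 2/5, this increases with t in [0, 1], so t may be replaced by the growth bound. *)
Lemma value_derivative_bound (A t D r p : R) : 0 <= A <= 1 -> 0 <= t -> 0 <= r <= p -> p < 2 / 5%:R ->
  t <= (A + r) / (1 + A * r) -> D * (1 - r ^+ 2) <= 1 - t ^+ 2 ->
  t + D * r <= (A + p) / (1 + A * p) + p * (1 - A ^+ 2) / (1 + A * p) ^+ 2.
Proof.
move=> /andP[A0 A1] t0 /andP[r0 rp] pl tT Dt.
have Ar : 0 <= A * r by exact: mulr_ge0.
have Ap : 0 <= A * p by apply: mulr_ge0 => //; lra.
have r2 : r ^+ 2 < 1 by rewrite exprn_ilt1 //; lra.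
have r2' : 0 < 1 - r ^+ 2 by lra.
pose k := r / (1 - r ^+ 2); have k0 : 0 <= k by rewrite divr_ge0 // ltW.
have k1 : k <= 1 / 2.
  rewrite /k ler_pdivrMr //.
  have : r ^+ 2 <= (2 / 5%:R) * r by rewrite expr2 ler_wpM2r //; lra.
  lra.
have Dk : D * r <= k * (1 - t ^+ 2).
  rewrite /k mulrAC ler_pdivlMr // mulrAC -mulrA [r * _]mulrC mulrA; exact: ler_wpM2r.
set T := (A + r) / (1 + A * r) in tT *.
have T1 : T <= 1.
  rewrite ler_pdivrMr; last lra.
  have : 0 <= (1 - A) * (1 - r) by rewrite mulr_ge0 //; lra.
  lra.
have inc1 : t + k * (1 - t ^+ 2) <= T + k * (1 - T ^+ 2).
  have : 0 <= (T - t) * (1 - k * (T + t)).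
    apply: mulr_ge0; first lra.
    have : k * (T + t) <= 1 / 2 * 2 by apply: ler_pM => //; lra.
    lra.
  lra.
have n1 : 1 + A * r != 0 by rewrite gt_eqF //; lra.
have TE : T + k * (1 - T ^+ 2) = (A + r) / (1 + A * r) + r * (1 - A ^+ 2) / (1 + A * r) ^+ 2.
  by rewrite /T /k; field; rewrite n1 gt_eqF.
apply: le_trans (lerD (lexx t) Dk) _; apply: le_trans inc1 _; rewrite TE.
have A2 : 0 <= 1 - A ^+ 2 by rewrite subr_ge0 exprn_ile1.
apply: lerD.
  rewrite ler_pdivrMr; last lra.
  rewrite mulrAC ler_pdivlMr; last lra.
  have : 0 <= (p - r) * (1 - A ^+ 2) by apply: mulr_ge0 => //; lra.
  lra.
have p1 : 0 < (1 + A * p) ^+ 2 by rewrite exprn_gt0 //; lra.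
have p2 : 0 < (1 + A * r) ^+ 2 by rewrite exprn_gt0 //; lra.
rewrite ler_pdivrMr // mulrAC ler_pdivlMr //.
have : 0 <= (1 - A ^+ 2) * ((p - r) * (1 - (A * r) * (A * p))).
  apply: mulr_ge0 => //; apply: mulr_ge0; first lra.
  have : (A * r) * (A * p) <= 1 * 1.
    by apply: ler_pM => //; [have := ler_wpM2r r0 A1|have := ler_wpM2r (le_trans r0 rp) A1]; lra.
  lra.
lra.
Qed.

Lemma lambda_ge0 : 0 <= (221%:R - 43%:R * s17) / 64%:R.
Proof. by have /andP[_] := s17_gt4_lt5 R; lra. Qed.

Lemma J_le_majorant (m : R) f a z : 0 <= m -> power_series_on_disc f a ->
  (forall x : Cplx R, normc x < 1 -> normc (f x) <= 1) -> normc z <= r_max R ->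
  J m f a z <= bohr_majorant m (normc (a 0%N)) (r_max R).
Proof.
move=> m0 fa f1 zp; have ca := bounded_contractive fa f1.
have /andP[p1 p2] := r_max_bounds R; have z1 : normc z < 1 by lra.
have pl : r_max R < 2 / 5%:R.
  by rewrite /r_max; have /andP[] := s17_bounds R; rewrite /s17_lo /s17_hi; lra.
have r0 := normc_ge0 z; have r01 : 0 <= normc z < 1 by rewrite r0.
have A01 : 0 <= normc (a 0%N) <= 1 by rewrite normc_ge0 coef_le1.
have rp : 0 <= normc z <= r_max R by rewrite r0.
have T1 := value_derivative_bound A01 (normc_ge0 (f z)) rp pl (growth_bound fa f1 z1)
  (schwarz_pick_derivative fa f1 z1).
have T2 : B2 a (normc z) + A0 a (normc z) <= (1 - normc (a 0%N) ^+ 2) * r_max R ^+ 2 / (1 - r_max R).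
  apply: le_trans (B2_A0_le ca r01) _; rewrite -mulrA -[leRHS]mulrA ler_wpM2l //.
    by case/andP: A01 => h1 h2; rewrite subr_ge0 exprn_ile1.
  apply: ler_pM; [exact: sqr_ge0|by rewrite invr_ge0; lra|by rewrite lerXn2r ?nnegrE //; lra|].
  by rewrite lef_pV2 ?posrE; lra.
have p2' : r_max R ^+ 2 <= 1 / 2.
  have : r_max R ^+ 2 <= (1 / 2) ^+ 2 by rewrite lerXn2r ?nnegrE //; lra.
  lra.
have sl := area_cvg fa (fun n => coef_le1 n ca) r01.
set x := r_max R ^+ 2 * (1 - normc (a 0%N) ^+ 2) ^+ 2 / (1 - normc (a 0%N) ^+ 2 * r_max R ^+ 2) ^+ 2.
have q01 : 0 <= r_max R ^+ 2 < 1 by rewrite sqr_ge0; lra.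
have [x1 _] := area_quotient A01 q01; rewrite -/x in x1.
have pi0 : 0 < pi :> R by exact: pi_gt0.
have S0 : 0 <= area f (normc z).
  apply: limit_ge_bound sl _ => N; apply: mulr_ge0; first exact: ltW.
  by apply: sumr_ge0 => n _; apply: mulr_ge0; [apply: mulr_ge0; [exact: ler0n|exact: sqr_ge0]|exact: exprn_ge0].
have S1 : area f (normc z) <= pi * x.
  apply: limit_le_bound sl _ => N; rewrite ler_pM2l //.
  have pp : 0 <= r_max R by lra.
  apply: le_trans (area_partial_sums N ca pp p2').
  apply: ler_sum => n _; apply: ler_wpM2l; last by rewrite lerXn2r ?nnegrE.
  by apply: mulr_ge0; [exact: ler0n|exact: sqr_ge0].
have S2 : area f (normc z) < pi.
  by apply: le_lt_trans S1 _; rewrite gtr_pMr.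
rewrite /J /bohr_majorant -/x; set S := area f (normc z) in S0 S1 S2 *.
have Q0 : 0 <= S / (pi - S) by rewrite divr_ge0 // subr_ge0 ltW.
have Q1 : S / (pi - S) <= x / (1 - x).
  rewrite ler_pdivrMr ?subr_gt0 // mulrAC ler_pdivlMr ?subr_gt0 //; lra.
have Q2 : (S / (pi - S)) ^+ 2 <= (x / (1 - x)) ^+ 2.
  by rewrite lerXn2r ?nnegrE // (le_trans Q0).
have := ler_wpM2l m0 Q2; have := ler_wpM2l lambda_ge0 Q1.
move: T1 T2; move: (A0 a _) (B2 a _) (_ * normc z) => *; lra.
Qed.

Definition moebius_coef (b : R) (n : nat) : Cplx R :=
  if n is n'.+1 then ((- ((1 - b ^+ 2) * b ^+ n'))%:C)%C else (b%:C)%C.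

Lemma moebius_den_neq0 (b : R) z : 0 <= b < 1 -> normc z < 1 -> 1 - (b%:C)%C * z != 0.
Proof.
move=> /andP[b0 b1] z1; rewrite subr_eq0; apply/eqP => h.
have : normc ((b%:C)%C * z) = 1 by rewrite -h normc1.
rewrite normcM normc_real ger0_norm // => e.
have := normc_ge0 z; have : b * normc z <= 1 * normc z by rewrite ler_wpM2r ?normc_ge0 // ltW.
lra.
Qed.

Lemma moebius_series (b : R) : 0 <= b < 1 -> power_series_on_disc (moebius b) (moebius_coef b).
Proof.
move=> bI z z1; have D0 := moebius_den_neq0 bI z1; have /andP[b0 b1] := bI.
set B : Cplx R := (b%:C)%C in D0.
have bz1 : normc (B * z) < 1.
  rewrite normcM normc_real ger0_norm //.
  have := normc_ge0 z; have : b * normc z <= 1 * normc z by rewrite ler_wpM2r ?normc_ge0 // ltW.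
  lra.
rewrite -cvg_shiftS.
have -> : moebius b z = B + - (1 - B ^+ 2) * z * (1 - B * z)^-1 by rewrite /moebius -/B; field.
have -> : [sequence series (fun n => moebius_coef b n * z ^+ n) n.+1]_n =
   (fun n => B + - (1 - B ^+ 2) * z * series (fun n => (B * z) ^+ n) n).
  apply/funext => n; rewrite /series /= big_ltn // mulr1; congr (_ + _).
  rewrite big_add1 mulr_sumr /=; apply: eq_bigr => k _.
  rewrite (_ : ((- ((1 - b ^+ 2) * b ^+ k))%:C)%C = - ((1 - B ^+ 2) * B ^+ k) :> Cplx R).
    rewrite [z ^+ _]exprS exprMn; ring.
  by rewrite rmorphN rmorphM rmorphB !rmorphXn rmorph1.
by apply: cvgD; [exact: cvg_cst|apply: cvgMr; exact: cvg_geometric_complex].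
Qed.

Lemma moebius_bounded (b : R) z : 0 <= b < 1 -> normc z < 1 -> normc (moebius b z) <= 1.
Proof.
move=> bI z1; have D0 := moebius_den_neq0 bI z1; have /andP[b0 b1] := bI.
have n0 : 0 < normc (1 - (b%:C)%C * z) by rewrite lt_def normc_ge0 normc_eq0 D0.
rewrite /moebius normcM normcV ler_pdivrMr // mul1r -ler_sqr ?nnegrE ?normc_ge0 //.
have := normc_sub_conj z ((b%:C)%C : Cplx R); rewrite conjc_real [z * _]mulrC => ->.
rewrite lerDr normc_real ger0_norm // mulr_ge0 ?subr_ge0 ?exprn_ile1 ?normc_ge0 //; exact: ltW.
Qed.

Lemma derive1_moebius (b : R) z : 0 <= b < 1 -> normc z < 1 ->
  derive1 (moebius b) z = - (1 - (b%:C)%C ^+ 2) / (1 - (b%:C)%C * z) ^+ 2.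
Proof.
move=> bI z1; have fa := moebius_series bI; have ca := bounded_contractive fa (fun x => moebius_bounded bI).
have [h [h0 w1 hlim qlim]] := difference_quotient_cvg fa (fun n => coef_le1 n ca) z1.
set B : Cplx R := (b%:C)%C; pose w n := z + h n.
have D0 := moebius_den_neq0 bI z1; rewrite -/B in D0.
pose e n := - (1 - B ^+ 2) / ((1 - B * w n) * (1 - B * z)).
have lim1 : e @ \oo --> derive1 (moebius b) z.
  have E n : (moebius b (w n) - moebius b z) / h n = e n.
    have Dw := moebius_den_neq0 bI (w1 n); rewrite -/B in Dw.
    apply: (mulIf (h0 n)); rewrite divfK // /e /moebius -/B -[h n](addKr z) [- z + _]addrC -/(w n).
    by field; rewrite Dw D0.
  by rewrite (eq_cvg _ _ E) in qlim.
have wlim : w @ \oo --> z.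
  have L : w @ \oo --> z + 0 by apply: cvgD; [exact: cvg_cst|exact: hlim].
  by rewrite addr0 in L.
have lim2 : e @ \oo --> - (1 - B ^+ 2) / ((1 - B * z) * (1 - B * z)).
  apply: cvgMr; apply: cvgV; first by rewrite mulf_neq0.
  apply: cvgMl; apply: cvgB; first exact: cvg_cst.
  by apply: cvgMr.
rewrite expr2; exact: (cvg_unique (@norm_hausdorff _ (Cplx R)) lim1 lim2).
Qed.

(** The partial sums differ from the limit by at most a multiple of (N + 1) x^N, itself at most a
    multiple of 1 / (N + 1) because (N + 1)^2 x^N is bounded. *)
Lemma sum_derived_geometric_cvg (x : R) : 0 <= x < 1 ->
  (fun N => \sum_(0 <= i < N) i.+1%:R * x ^+ i) @ \oo --> 1 / (1 - x) ^+ 2.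
Proof.
move=> xI; have /andP[x0 x1] := xI; have [K KP] := square_geometric_bound xI.
have d0 : 0 < (1 - x) ^+ 2 by rewrite exprn_gt0 // subr_gt0.
have lim : (fun n => (1 - K * harmonic n) / (1 - x) ^+ 2) @ \oo --> (1 - K * 0) / (1 - x) ^+ 2.
  by apply: cvgMl; apply: cvgB; [exact: cvg_cst|apply: cvgMr; exact: cvg_harmonic].
rewrite mulr0 subr0 in lim; apply: (squeeze_cvgr _ lim (cvg_cst _)).
near=> N; rewrite sum_derived_geometric_le // andbT ler_pdivrMr // sum_derived_geometricE.
have n0 : 0 < N.+1%:R :> R by rewrite ltr0n.
have : N.+1%:R * x ^+ N <= K * harmonic N.
  rewrite -(ler_pM2r n0) -[leRHS]mulrA [harmonic N * _]mulVf ?gt_eqF // mulr1 mulrAC -expr2.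
  apply: le_trans (KP N.+1); rewrite big_nat_recr //= lerDr.
  by apply: sumr_ge0 => n _; rewrite mulr_ge0 ?sqr_ge0 ?exprn_ge0.
have : 0 <= N%:R * x ^+ N.+1 by rewrite mulr_ge0 ?exprn_ge0.
lra.
Unshelve. all: by end_near.
Qed.

(** The coefficients are geometric, so all the series can be summed; the area is computed as the
    sum of its series and not as an integral. *)
Lemma J_moebius (m b p : R) : 0 <= b < 1 -> 0 <= p < 1 ->
  J m (moebius b) (moebius_coef b) ((- p)%:C)%C = bohr_majorant m b p.
Proof.
move=> bI pI; have /andP[b0 b1] := bI; have /andP[p0 p1] := pI.
set z : Cplx R := ((- p)%:C)%C.
have zp : normc z = p by rewrite normc_real normrN ger0_norm.
have z1 : normc z < 1 by rewrite zp.
have bp : 0 <= b * p by exact: mulr_ge0.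
have b2 : 0 <= 1 - b ^+ 2 by rewrite subr_ge0 exprn_ile1 // ltW.
have fa := moebius_series bI; have ca := bounded_contractive fa (fun x => moebius_bounded bI).
have DE : 1 - (b%:C)%C * z = ((1 + b * p)%:C)%C.
  by rewrite /z -rmorphM -(rmorph1 (real_complex R)) -rmorphB mulrN opprK.
have v1 : normc (moebius b z) = (b + p) / (1 + b * p).
  rewrite /moebius DE /z -rmorphB opprK normcM normcV !normc_real !ger0_norm //; lra.
have v2 : normc (derive1 (moebius b) z) = (1 - b ^+ 2) / (1 + b * p) ^+ 2.
  rewrite derive1_moebius // DE normcM normcN normcV normcX normc_real ger0_norm; last lra.
  by rewrite -rmorphXn -(rmorph1 (real_complex R)) -rmorphB normc_real ger0_norm.
have cn n : normc (moebius_coef b n.+1) = (1 - b ^+ 2) * b ^+ n.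
  by rewrite normc_real normrN ger0_norm // mulr_ge0 ?exprn_ge0.
have geo (q k : R) : 0 <= q < 1 -> (fun N => \sum_(0 <= n < N) k * q ^+ n) @ \oo --> k / (1 - q).
  move=> /andP[q0 q1]; have := @cvg_geometric_series R k q.
  by rewrite ger0_norm // => /(_ q1).
have bp1 : 0 <= b * p < 1.
  by rewrite bp /=; have := ler_wpM2r p0 (ltW b1); lra.
have bp2 : 0 <= b ^+ 2 * p ^+ 2 < 1.
  by rewrite -exprMn sqr_ge0 exprn_ilt1 //; case/andP: bp1.
have B2E : B2 (moebius_coef b) p = (1 - b ^+ 2) * b * p ^+ 2 / (1 - b * p).
  rewrite /B2; apply: (cvg_lim (@Rhausdorff R)); rewrite -(cvg_shiftn 2).
  have E N : \sum_(2 <= k < (N + 2)%N) normc (moebius_coef b k) * p ^+ k =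
      \sum_(0 <= n < N) (1 - b ^+ 2) * b * p ^+ 2 * (b * p) ^+ n.
    rewrite -{1}(add0n 2%N) big_addn addnK; apply: eq_bigr => n _.
    by rewrite addn2 cn exprMn (exprS b n) (exprS p n.+1) (exprS p n); ring.
  rewrite (eq_cvg _ _ E); exact: geo.
have normE : norm0_sqr (moebius_coef b) p = (1 - b ^+ 2) ^+ 2 * p ^+ 2 / (1 - b ^+ 2 * p ^+ 2).
  rewrite /norm0_sqr; apply: (cvg_lim (@Rhausdorff R)); rewrite -cvg_shiftS.
  have E N : \sum_(1 <= k < N.+1) normc (moebius_coef b k) ^+ 2 * p ^+ (2 * k) =
      \sum_(0 <= n < N) (1 - b ^+ 2) ^+ 2 * p ^+ 2 * (b ^+ 2 * p ^+ 2) ^+ n.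
    rewrite big_add1 [_.-1]/=; apply: eq_bigr => n _.
    rewrite cn exprMn -[(b ^+ n) ^+ 2]exprM (mulnC n) (mulnS 2) (exprD p).
    by rewrite [(_ * p ^+ 2) ^+ n]exprMn -!exprM; ring.
  rewrite (eq_cvg _ _ E); exact: geo.
have areaE : area (moebius b) p = pi * (p ^+ 2 * (1 - b ^+ 2) ^+ 2 / (1 - b ^+ 2 * p ^+ 2) ^+ 2).
  have pI' : 0 <= p < 1 by rewrite p0.
  have c1 n : normc (moebius_coef b n) <= 1 by exact: coef_le1.
  have lim1 := area_cvg fa c1 pI'; rewrite -cvg_shiftS in lim1.
  have lim2 : (fun N => pi * (p ^+ 2 * (1 - b ^+ 2) ^+ 2) * \sum_(0 <= i < N) i.+1%:R * (b ^+ 2 * p ^+ 2) ^+ i)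
      @ \oo --> pi * (p ^+ 2 * (1 - b ^+ 2) ^+ 2) * (1 / (1 - b ^+ 2 * p ^+ 2) ^+ 2).
    by apply: cvgMr; exact: sum_derived_geometric_cvg.
  rewrite mul1r -mulrA in lim2.
  have E N : pi * (\sum_(1 <= n < N.+1) n%:R * normc (moebius_coef b n) ^+ 2 * p ^+ (2 * n)) =
      pi * (p ^+ 2 * (1 - b ^+ 2) ^+ 2) * \sum_(0 <= i < N) i.+1%:R * (b ^+ 2 * p ^+ 2) ^+ i.
    rewrite -mulrA; congr (_ * _); rewrite big_add1 [_.-1]/= mulr_sumr; apply: eq_bigr => n _.
    rewrite cn exprMn -[(b ^+ n) ^+ 2]exprM (mulnC n) (mulnS 2) (exprD p).
    by rewrite [(_ * p ^+ 2) ^+ n]exprMn -!exprM; ring.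
  rewrite (eq_cvg _ _ E) in lim1; exact: (cvg_unique (@Rhausdorff R) lim1 lim2).
have q01 : 0 <= p ^+ 2 < 1 by rewrite sqr_ge0 exprn_ilt1.
have bI' : 0 <= b <= 1 by rewrite b0 ltW.
have [x1 _] := area_quotient bI' q01.
rewrite /J zp v1 v2 B2E /A0 normE areaE /bohr_majorant normc_real ger0_norm //.
move: x1; set x := p ^+ 2 * _ / _ => x1.
have xE : pi * x / (pi - pi * x) = x / (1 - x).
  have pi0 : pi != 0 :> R by rewrite gt_eqF // pi_gt0.
  by rewrite -{2}(mulr1 pi) -mulrBr -mulf_div divff // mul1r.
have AE : (1 - b ^+ 2) * b * p ^+ 2 / (1 - b * p) +
  (1 / (1 + b) + p / (1 - p)) * ((1 - b ^+ 2) ^+ 2 * p ^+ 2 / (1 - b ^+ 2 * p ^+ 2)) =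
  (1 - b ^+ 2) * p ^+ 2 / (1 - p).
  have n1 : 1 - b * p != 0 by case/andP: bp1 => _ h; rewrite gt_eqF // subr_gt0.
  have n2 : 1 + b * p != 0 by rewrite gt_eqF //; lra.
  have -> : 1 - b ^+ 2 * p ^+ 2 = (1 - b * p) * (1 + b * p) by ring.
  field; rewrite n1 n2 /=; apply/andP; split; rewrite gt_eqF //; lra.
rewrite xE -AE; ring.
Qed.
End Majorant.

Local Close Scope classical_set_scope.

Theorem theorem2p2 (R : realType) :
  exists t0 : R,
    [/\ (* t0 is the unique root of Psi2 in (0, 1), and t0 ~ 0.565671 *)
        unique (fun t : R => 0 < t < 1 /\ Psi2 t = 0) t0,
        `|t0 - 565671%:R / (10%:R ^+ 6)| < 5%:R / (10%:R ^+ 7),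
        (* mu = 16.0824... *)
        160824%:R / (10%:R ^+ 4) <= mu t0 < 160825%:R / (10%:R ^+ 4),
        forall (f : Cplx R -> Cplx R) (a : nat -> Cplx R),
          power_series_on_disc f a ->
          (forall z : Cplx R, normc z < 1 -> normc (f z) <= 1) ->
          forall z : Cplx R, normc z < 1 -> normc z <= r_max R ->
            J (mu t0) f a z <= 1
      & exists (b : R) (a : nat -> Cplx R) (z : Cplx R),
          [/\ 0 <= b < 1, power_series_on_disc (moebius b) a,
              normc z < 1, normc z <= r_max R
            & J (mu t0) (moebius b) a z = 1]].
Proof.
have [t0 tI P0] := Psi2_root_exists R; have /andP[tlo thi] := tI.
have t01 : 0 < t0 < 1.
  by move: tlo thi; rewrite /root_lo /root_hi => *; apply/andP; split; lra.
have tI' : 0 <= t0 < 1 by case/andP: t01 => h ->; rewrite ltW.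
have muI := mu_near_root tI.
have mu0 : 0 <= mu t0 by case/andP: muI => h _; apply: le_trans h; rewrite divr_ge0 ?exprn_ge0 ?ler0n.
have /andP[p1 p2] := r_max_bounds R.
have pI : 0 <= r_max R < 1 by apply/andP; split; lra.
exists t0; split => //.
- split=> [|u [/andP[u0 _] Pu]]; first by split.
  have [tu|ut|//] := ltgtP t0 u.
    have : Psi2 u < Psi2 t0 by apply: Psi2_decreasing; rewrite tu ltW //; case/andP: t01.
    by rewrite P0 Pu ltxx.
  have : Psi2 t0 < Psi2 u by apply: Psi2_decreasing; rewrite ut ltW.
  by rewrite P0 Pu ltxx.
- by move: tlo thi; rewrite /root_lo /root_hi ltr_norml => *; apply/andP; split; lra.
- move=> f a fa f1 z _ zp; apply: le_trans (J_le_majorant mu0 fa f1 zp) _.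
  by apply: bohr_majorant_le1 => //; rewrite normc_ge0 coef_le1 //; exact: bounded_contractive fa f1.
exists t0, (moebius_coef t0), ((- r_max R)%:C)%C.
have zE : normc ((- r_max R)%:C)%C = r_max R by rewrite normc_real normrN ger0_norm //; lra.
split=> //; [exact: moebius_series|by rewrite zE; lra|by rewrite zE|].
by rewrite J_moebius // bohr_majorant_eq1.
Qed.
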